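(* There exist universal constants $C, C_1, C_2 > 0$ such that the following holds. Let $\|\cdot\|_g$ and $\|\cdot\|_e$ be semi-norms on $\mathbb{R}^p$, let $(x,y) \in \mathbb{R}^p \times \mathbb{R}$ be a joint random pair such that $x$ exhibits generic Bernstein concentration with respect to $(\|\cdot\|_g, \|\cdot\|_e)$ and $y$ is sub-exponential. Let $K \subset \mathbb{R}^p$ be convex, set $K^\Delta := \operatorname{span}(K-K) \cap \mathbb{S}^{p-1}$, and assume that $Q_{2\tau}(K^\Delta, x) > 0$ for some $\tau > 0$. Let $(x_1,y_1), \dots, (x_n,y_n)$ be independent copies of $(x,y)$. Fix a vector $\beta^\natural \in K$. Then for every $u \ge 8$ and $t \ge 0$, the following holds true with probability at least $1 - 5\exp(-C u^2) - 2\exp(-C\sqrt{n})$: If $$n \ge C_1 \cdot \bigg(\frac{q_{0,n}^{(g,e)}(K - \beta^\natural) + \tau \cdot u}{\tau \cdot Q_{2\tau}(K^\Delta, x)}\bigg)^2$$ and $$t \ge C_2 \cdot \frac{1}{(\tau \cdot Q_{2\tau}(K^\Delta, x))^2} \cdot \bigg[\rho_0(\beta^\natural) + u^2 \cdot \sigma(\beta^\natural) \cdot \frac{m_0^{(g,e)}(K - \beta^\natural)}{\sqrt{n}}\bigg]_+,$$ then every minimizer $\hat\beta$ of $$\min_{\beta \in K} \ \tfrac{1}{n}\sum_{i=1}^n (y_i - \langle x_i, \beta\rangle)^2$$ satisfies $\|\hat\beta - \beta^\natural\|_2 \le t$.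
   Context: Notation: $\mathbb{S}^{p-1}$ is the Euclidean unit sphere in $\mathbb{R}^p$; $\operatorname{span}$, $\operatorname{cone}$, $\operatorname{conv}$ denote linear, conic and convex hull; $[s]_+ := \max\{s,0\}$. A constant is universal if its value does not depend on any other involved parameter. Measure-theoretic issues are disregarded. Sub-exponential: $\|Z\|_{\psi_1} := \inf\{s > 0 : \mathbb{E}[\exp(|Z|/s)] \le 2\}$; a random variable $Z$ is sub-exponential if $\|Z\|_{\psi_1} < \infty$. Generic Bernstein concentration: a random vector $x \in \mathbb{R}^p$ exhibits generic Bernstein concentration with respect to semi-norms $(\|\cdot\|_g, \|\cdot\|_e)$ if for all $v \in \mathbb{R}^p$ and $s \ge 0$, $$\mathbb{P}(|\langle x, v\rangle| \ge s) \le 2\exp\Big(-\min\Big\{\tfrac{s^2}{\|v\|_g^2}, \tfrac{s}{\|v\|_e}\Big\}\Big),$$ where $\exp(-\infty) := 0$, and $s/0 := \infty$ for $s > 0$, $0/0 := 0$. $\gamma$-functional: for a set $L$ with pseudo-metric $d$ and $\alpha \in \{1,2\}$, $\gamma_\alpha(L,d) := \inf \sup_{v \in L} \sum_{s=0}^\infty 2^{s/\alpha} \Delta(A_s(v))$, where the infimum is over all increasing sequences $(\mathcal{A}_s)_{s \ge 0}$ of partitions of $L$ (every $A \in \mathcal{A}_{s+1}$ is contained in some $B \in \mathcal{A}_s$) with $|\mathcal{A}_0| = 1$ and $|\mathcal{A}_s| \le 2^{2^s}$ for $s \ge 1$, $A_s(v)$ is the element of $\mathcal{A}_s$ containing $v$,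 and $\Delta$ is the diameter with respect to $d$. For a semi-norm $\|\cdot\|$, $\gamma_\alpha(L, \|\cdot\|)$ uses the induced pseudo-metric. Conic complexities for $L \subset \mathbb{R}^p$: $$q_{0,n}^{(g,e)}(L) := \inf\Big\{\tfrac{\gamma_1(S,\|\cdot\|_e)}{\sqrt{n}} + \gamma_2(S, \|\cdot\|_g + \|\cdot\|_e) : S \subset \mathbb{R}^p, \operatorname{conv}(S) \supset \operatorname{cone}(L) \cap \mathbb{S}^{p-1}\Big\},$$ $$m_0^{(g,e)}(L) := \inf\Big\{\gamma_1(S,\|\cdot\|_e) + \gamma_2(S, \|\cdot\|_g) : S \subset \mathbb{R}^p, \operatorname{conv}(S) \supset (\operatorname{cone}(L) \cap \mathbb{S}^{p-1}) \cup \{0\}\Big\}.$$ Small-ball function: $Q_\theta(L, x) := \inf_{v \in L} \mathbb{P}(|\langle x, v\rangle| \ge \theta)$ for $\theta \ge 0$. Mismatch parameters: $\sigma(\beta^\natural) := \|y - \langle x, \beta^\natural\rangle\|_{\psi_1}$ and $\rho_0(\beta^\natural) := \sup_{v \in K^0} \big\langle \mathbb{E}[(y - \langle x, \beta^\natural\rangle) x], v\big\rangle$, where $K^0 := \operatorname{cone}(K - \beta^\natural) \cap \mathbb{S}^{p-1}$. *)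

(* Defs.v *)
From HB Require Import structures.
From mathcomp Require Import all_boot all_order all_algebra.
From mathcomp Require Import all_classical all_reals all_analysis.

Set Implicit Arguments.
Unset Strict Implicit.
Unset Printing Implicit Defensive.

Import Order.TTheory GRing.Theory Num.Theory.
Import numFieldNormedType.Exports.

Local Open Scope classical_set_scope.
Local Open Scope ring_scope.

Section Euclidean.
Context {R : realType} {p : nat}.
Implicit Types (v : 'rV[R]_p) (L : set 'rV[R]_p) (N : 'rV[R]_p -> R).

Definition dot (u v : 'rV[R]_p) : R := \sum_(j < p) u 0 j * v 0 j.

(* The library norm on matrices is the max-norm, hence this separate
   definition. *)
Definition norm2 v : R := Num.sqrt (dot v v).

Definition sphere : set 'rV[R]_p := [set v | norm2 v = 1].

Definition linear_hull L : set 'rV[R]_p :=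
  [set v | exists (m : nat) (a : 'I_m -> R) (s : 'I_m -> 'rV[R]_p),
     (forall i, L (s i)) /\ v = \sum_(i < m) a i *: s i].

Definition conic_hull L : set 'rV[R]_p :=
  [set v | exists (m : nat) (a : 'I_m -> R) (s : 'I_m -> 'rV[R]_p),
     [/\ forall i, L (s i), forall i, 0 <= a i
       & v = \sum_(i < m) a i *: s i]].

Definition convex_hull L : set 'rV[R]_p :=
  [set v | exists (m : nat) (a : 'I_m -> R) (s : 'I_m -> 'rV[R]_p),
     [/\ forall i, L (s i), forall i, 0 <= a i, \sum_(i < m) a i = 1
       & v = \sum_(i < m) a i *: s i]].

Definition diff_set L1 L2 : set 'rV[R]_p :=
  [set u - v | u in L1 & v in L2].

Definition seminorm N : Prop :=
  [/\ forall v, 0 <= N v,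
      forall (a : R) v, N (a *: v) = `|a| * N v
    & forall u v, N (u + v) <= N u + N v].

End Euclidean.

Section Gamma.
Context {R : realType} {T : Type}.
Implicit Types (L : set T) (d : T -> T -> R) (A : nat -> set (set T)).

(* [partition] requires nonempty blocks; in particular the empty set has no
   admissible sequence. *)
Definition admissible L A : Prop :=
  [/\ forall s, partition (A s) id L,
      forall s B, A s.+1 B -> exists2 B', A s B' & B `<=` B',
      (A 0%N #= `I_1)%card
    & forall s, (1 <= s)%N -> (A s #<= `I_(2 ^ (2 ^ s)))%card].

Definition diameter d (B : set T) : \bar R :=
  ereal_sup [set (d u v)%:E | u in B & v in B].

Definition gamma (alpha : nat) L d : \bar R :=
  ereal_inf [set
    ereal_sup [set
      (\sum_(0 <= s <oo)
         (2 `^ (s%:R / alpha%:R))%:E * diameter d (pblock (A s) id v))%E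
      | v in L]
    | A in admissible L].

End Gamma.

Section Complexities.
Context {R : realType} {p : nat}.
Implicit Types (L S : set 'rV[R]_p) (N Ng Ne : 'rV[R]_p -> R).

Definition gammaN (alpha : nat) L N : \bar R :=
  gamma alpha L (fun u v => N (u - v)).

Definition q0 (n : nat) Ng Ne L : \bar R :=
  ereal_inf [set
    (gammaN 1 S Ne / (Num.sqrt n%:R)%:E
     + gammaN 2 S (fun v => Ng v + Ne v)%R)%E
    | S in [set S | conic_hull L `&` sphere `<=` convex_hull S]].

Definition m0 Ng Ne L : \bar R :=
  ereal_inf [set
    (gammaN 1 S Ne + gammaN 2 S Ng)%E
    | S in [set S |
        (conic_hull L `&` sphere) `|` [set 0] `<=` convex_hull S]].

End Complexities.

Notation borel_rV R p := (g_sigma_algebraType (@open 'rV[R]_p)).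

Section Probability.
Context {R : realType} {d : measure_display} {Omega : measurableType d}.
Variable P : probability Omega R.

Definition psi1_norm (Z : Omega -> R) : \bar R :=
  ereal_inf [set s%:E | s in
    [set s : R | 0 < s /\ ('E_P[fun w => expR (`|Z w| / s)] <= 2%:E)%E]].

Definition sub_exponential (Z : Omega -> R) : Prop := (psi1_norm Z < +oo)%E.

Definition same_law d' (T : measurableType d') (f g : Omega -> T) : Prop :=
  forall B, measurable B -> P (f @^-1` B) = P (g @^-1` B).

(* Choosing [B i := setT] outside a subfamily gives the product rule for that
   subfamily. *)
Definition mutually_independent d' (T : measurableType d') (n : nat)
    (f : 'I_n -> Omega -> T) : Prop :=
  forall B : 'I_n -> set T, (forall i, measurable (B i)) ->
    P (\bigcap_(i in [set: 'I_n]) (f i @^-1` B i)) =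
    (\prod_(i < n) P (f i @^-1` B i))%E.

Context {p : nat}.
Implicit Types (x : Omega -> 'rV[R]_p) (y : Omega -> R).

(* In [\bar R] one has [s / 0 = +oo] for [0 < s], [0 / 0 = 0] and
   [expeR -oo = 0]. *)
Definition generic_bernstein x (Ng Ne : 'rV[R]_p -> R) : Prop :=
  forall (v : 'rV[R]_p) (s : R), 0 <= s ->
    (P [set w | (s <= `|dot (x w) v|)%R] <=
     2%:E * expeR (- Order.min ((s ^+ 2)%:E / (Ng v ^+ 2)%:E)
                               (s%:E / (Ne v)%:E)))%E.

Definition small_ball (theta : R) (L : set 'rV[R]_p) x : \bar R :=
  ereal_inf [set P [set w | theta <= `|dot (x w) v|] | v in L].

Definition mismatch_deviation x y (b : 'rV[R]_p) : \bar R :=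
  psi1_norm (fun w => y w - dot (x w) b).

Definition mismatch_covariance x y (K : set 'rV[R]_p) (b : 'rV[R]_p) : \bar R :=
  ereal_sup [set
    (dot (\row_j fine 'E_P[fun w => (y w - dot (x w) b) * x w 0 j]) v)%:E
    | v in conic_hull (diff_set K [set b]) `&` sphere].

End Probability.

Definition empirical_risk (R : realType) (p n : nat)
    (x : 'I_n -> 'rV[R]_p) (y : 'I_n -> R) (b : 'rV[R]_p) : R :=
  n%:R^-1 * \sum_(i < n) (y i - dot (x i) b) ^+ 2.

Definition minimizer (T : Type) (R : realType) (K : set T) (f : T -> R)
    (b : T) : Prop :=
  K b /\ forall b', K b' -> f b <= f b'.

(* Main.v *)
Require Import Defs.
From HB Require Import structures.
From mathcomp Require Import all_boot all_order all_algebra.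
From mathcomp Require Import all_classical all_reals all_analysis.
From mathcomp Require finmap.
From mathcomp Require Import measurable_realfun.
From mathcomp Require Import ring lra zify.

(** Comparing the empirical risks at a minimizer and at [b], and writing
    [bhat - b = r v] with [v] in the conic sphere [L], gives
    [r * \sum_i <X_i, v> ^ 2 <= 2 * \sum_i (Y_i - <X_i, b>) <X_i, v>], so it
    suffices to bound the quadratic process from below and the multiplier
    process from above, uniformly over [L].

    Lower bound: [t ^ 2 >= tau ^ 2 1(|t| > tau)] up to constants, and the
    indicator is replaced by a Lipschitz threshold.  The bounded differences
    inequality, symmetrization and contraction leave a Rademacher process,
    which is chained.  These steps are carried out for a discretized sample,
    whose law is finitely supported, and for finite subsets of [L]; a dense
    sequence of [L] recovers the supremum.

    Upper bound: the summands are products of dependent factors and have no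
    exponential moments, so each is truncated and compensated by a multiple of
    [(Y_i - <X_i, b>) ^ 2], which does give an exponential moment.  The sum of
    the compensators is [O(n sigma ^ 2)] with probability
    [1 - exp (- sqrt n)], and the compensated process is chained.

    Every numerical constant is absorbed into [u]: the failure probability is
    vacuous unless [u] is large. *)

Set Implicit Arguments.
Unset Strict Implicit.
Unset Printing Implicit Defensive.

Import Order.TTheory GRing.Theory Num.Theory.
Import numFieldNormedType.Exports.

Local Open Scope classical_set_scope.
Local Open Scope ring_scope.

(** * Symmetrization and bounded differences for finite laws *)

(** The compensators are direction-free up to the factor [g ^ 2]: they are multiples of the same
    residual energy. One energy event therefore serves every link of the chaining, and
    [exp (- sqrt n)] is paid once instead of once per link.

    The two complexities differ because the chaining treats its base point differently. The
    quadratic process needs only the mean of a Rademacher maximum, and the base point has mean zero.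
    The multiplier process is bounded with high probability, so its base point is compared with 0,
    which must lie in the hull. The Gaussian scale of a marginal is of order [Ng + Ne], because its
    variance also sees the exponential part of the tail. In the multiplier process the contribution
    of [Ne] to it is absorbed by [gamma_1], as [2 ^ (k / 2) <= 2 ^ k]; in the quadratic process it
    carries an extra [sqrt n] and stays in [gamma_2].

    For finitely supported laws and finite sets of directions, expectations are finite sums and
    suprema are maxima, so symmetrization raises no question of measurability. Semi-norms may vanish
    and infima are only approached, hence the small slacks [eta], [eps] and [gap]. *)

Section ExpBounds.
Context {R : realType}.
Implicit Types x k q : R.

(** Everything follows from [exp x * (1 - x) <= 1]. For [0 < x] it gives [exp x - 1 <= x * exp x],
    and using it twice gives [exp x <= 1 + x + x ^ 2 * exp x]. For [x <= 0] one has [(1 + x + x ^ 2)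
    * (1 - x) = 1 - x ^ 3 >= 1]. *)
Lemma expR_le_quadratic x : expR x <= 1 + x + x ^+ 2 * expR (Num.max x 0).
Proof.
have e0 := expR_gt0 x; have en := expR_ge1Dx (- x).
have ee := expRxMexpNx_1 x.
case: (leP x 0) => x0.
  rewrite expR0 mulr1.
  have : expR x * (1 - x) <= 1 by rewrite -ee ler_pM2l// -subr_ge0; lra.
  nra.
have H : expR x * (1 - x) <= 1 by rewrite -ee ler_pM2l//; lra.
nra.
Qed.

(** Only the excess of [x] over the compensator [k] needs an exponential moment, whereas the linear
    term [x], whose mean is known, is kept intact. *)
Lemma expR_sub_le_quadratic x k q : 0 <= k -> 0 <= q -> x - k <= q ->
  expR (x - k) <= 1 + x + x ^+ 2 * expR q.
Proof.
move=> k0 q0 xkq.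
have q1 : 1 <= expR q by have := expR_ge1Dx q; lra.
have x20 : 0 <= x ^+ 2 by exact: sqr_ge0.
case: (leP x 0) => x0.
  have := expR_le_quadratic x; rewrite (max_r x0) expR0 mulr1 => H.
  have : expR (x - k) <= expR x by rewrite ler_expR; lra.
  nra.
case: (leP x k) => xk.
  have : expR (x - k) <= 1 by rewrite expR_le1; lra.
  nra.
have := expR_le_quadratic (x - k); rewrite max_l; last lra.
have : expR (x - k) <= expR q by rewrite ler_expR.
have : (x - k) ^+ 2 <= x ^+ 2 by rewrite ler_sqr ?nnegrE//; lra.
have := sqr_ge0 (x - k); have := expR_gt0 (x - k).
nra.
Qed.

Lemma expR1_le4 : expR 1 <= 4 :> R.
Proof.
have en := expR_ge1Dx (- (1 / 2) : R).
have ee := expRxMexpNx_1 (1 / 2 : R).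
have e0 := expR_gt0 (1 / 2 : R).
have -> : 1 = 1 / 2 + 1 / 2 :> R by lra.
rewrite expRD; nra.
Qed.

Lemma sqr_le_expR x : 0 <= x -> x ^+ 2 <= 2 * expR x.
Proof. by move=> x0; have := expR_ge1Dxn 1 x0; rewrite (_ : 2`! = 2)%N //; nra. Qed.

End ExpBounds.

Section MaxOver.
Context {R : realType} {F : finType} (v0 : F).
Implicit Types h g : F -> R.

(** An argmax gives a maximum in [R] itself that is attained by construction; [v0] witnesses that
    [F] is nonempty. *)
Definition maxover h : R := h [arg max_(v > v0) h v]%O.

Lemma maxover_ge h v : h v <= maxover h.
Proof. by rewrite /maxover; case: arg_maxP => // i _; apply. Qed.

Lemma maxover_le h c : (forall v, h v <= c) -> maxover h <= c.
Proof. exact. Qed.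

Lemma maxover_attained h : exists v, maxover h = h v.
Proof. by eexists. Qed.

Lemma le_maxover h g : (forall v, h v <= g v) -> maxover h <= maxover g.
Proof. by move=> hg; apply: maxover_le => v; exact: le_trans (maxover_ge g v). Qed.

End MaxOver.

(* [Ex p n f] is the expectation of [f (a_1, ..., a_n)] for independent [a_i]
   with the finitely supported law [p]. *)
Fixpoint Ex (R : realType) (I : finType) (p : I -> R) (n : nat)
    (f : seq I -> R) : R :=
  if n is n'.+1 then \sum_a p a * Ex p n' (fun l => f (a :: l)) else f [::].

Section FiniteExpectation.
Context {R : realType} {I : finType} (p : I -> R).
Hypothesis p_ge0 : forall a, 0 <= p a.
Hypothesis p_sum1 : \sum_a p a = 1.
Implicit Types f g : seq I -> R.

Lemma eq_Ex n f g : (forall l, size l = n -> f l = g l) -> Ex p n f = Ex p n g.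
Proof.
elim: n f g => [|n IH] f g fg /=; first exact: fg.
by apply: eq_bigr => a _; congr (_ * _); apply: IH => l sl; apply: fg => /=; rewrite sl.
Qed.

Lemma le_Ex n f g : (forall l, size l = n -> f l <= g l) -> Ex p n f <= Ex p n g.
Proof.
elim: n f g => [|n IH] f g fg /=; first exact: fg.
apply: ler_sum => a _; rewrite ler_wpM2l//.
by apply: IH => l sl; apply: fg => /=; rewrite sl.
Qed.

Lemma Ex_cst n c : Ex p n (fun=> c) = c.
Proof. by elim: n => //= n ->; rewrite -mulr_suml p_sum1 mul1r. Qed.

Lemma ExD n f g : Ex p n (fun l => f l + g l) = Ex p n f + Ex p n g.
Proof.
elim: n f g => //= n IH f g; rewrite -big_split/=.
by apply: eq_bigr => a _; rewrite IH mulrDr.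
Qed.

Lemma ExZ n c f : Ex p n (fun l => c * f l) = c * Ex p n f.
Proof.
elim: n f => //= n IH f; rewrite mulr_sumr.
by apply: eq_bigr => a _; rewrite IH mulrCA.
Qed.

Lemma Ex_sum n (J : Type) (r : seq J) (P : pred J) (f : J -> seq I -> R) :
  Ex p n (fun l => \sum_(j <- r | P j) f j l) = \sum_(j <- r | P j) Ex p n (f j).
Proof.
elim: r => [|j r IH].
  rewrite big_nil -[RHS](Ex_cst n); apply: eq_Ex => l _; exact: big_nil.
under eq_Ex do rewrite big_cons.
by rewrite big_cons; case: ifP => // _; rewrite ExD IH.
Qed.

Lemma Ex_prod n (h : I -> R) :
  Ex p n (fun l => \prod_(a <- l) h a) = (\sum_a p a * h a) ^+ n.
Proof.
elim: n => [|n IH] /=; first by rewrite big_nil.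
rewrite exprS mulr_suml; apply: eq_bigr => a _; rewrite -mulrA; congr (_ * _).
by rewrite -IH -ExZ; apply: eq_Ex => l _; rewrite big_cons.
Qed.

Lemma Ex_centered n (h : I -> R) : \sum_a p a * h a = 0 ->
  Ex p n (fun l => \sum_(a <- l) h a) = 0.
Proof.
move=> h0; elim: n => [|n IH] /=; first by rewrite big_nil.
rewrite -[RHS]h0; apply: eq_bigr => a _; congr (_ * _).
under eq_Ex do rewrite big_cons.
by rewrite ExD Ex_cst IH addr0.
Qed.

Section BoundedDifferences.
Context {F : finType} (v0 : F) (psi : F -> I -> R).
Hypothesis psi_diff : forall v a a', psi v a - psi v a' <= 1.

(** Hoeffding's lemma with a crude constant: the factor 4 bounds [exp 1] in the remainder of the
    quadratic expansion. *)
Lemma centered_mgf (z : I -> R) (lam : R) :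
    (forall a, `|z a| <= 1) -> \sum_a p a * z a = 0 -> 0 <= lam <= 1 ->
  \sum_a p a * expR (lam * z a) <= expR (4 * lam ^+ 2).
Proof.
move=> z1 z0 /andP[l0 l1].
have H a : expR (lam * z a) <= 1 + lam * z a + 4 * lam ^+ 2.
  apply: le_trans (expR_le_quadratic _) _.
  have lz : `|lam * z a| <= lam by rewrite normrM ger0_norm// ler_piMr.
  have e4 : expR (Num.max (lam * z a) 0) <= 4.
    apply: le_trans expR1_le4; rewrite ler_expR ge_max ler01 andbT.
    by apply: le_trans (ler_norm _) _; exact: le_trans lz l1.
  have : (lam * z a) ^+ 2 <= lam ^+ 2.
    by rewrite -(real_normK (num_real (lam * z a))) ler_sqr ?nnegrE.
  have := sqr_ge0 (lam * z a); have := expR_ge0 (Num.max (lam * z a) 0).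
  nra.
apply: le_trans (_ : \sum_a p a * (1 + lam * z a + 4 * lam ^+ 2) <= _).
  by apply: ler_sum => a _; rewrite ler_wpM2l.
have -> : \sum_a p a * (1 + lam * z a + 4 * lam ^+ 2) =
    (\sum_a p a) * (1 + 4 * lam ^+ 2) + lam * \sum_a p a * z a.
  rewrite mulr_suml mulr_sumr -big_split/=; apply: eq_bigr => a _; ring.
by rewrite p_sum1 z0 mul1r mulr0 addr0; exact: expR_ge1Dx.
Qed.

Let f (h : F -> R) (l : seq I) := maxover v0 (fun v => h v + \sum_(a <- l) psi v a).

(** McDiarmid's martingale argument by induction on the sample. The offset [h] carries the draws
    already made; the conditional mean [g a] after the first draw varies by at most 1, so each draw
    costs a factor [exp (4 * lam ^ 2)]. *)
Lemma maxover_mgf n h (lam : R) : 0 <= lam <= 1 ->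
  Ex p n (fun l => expR (lam * f h l)) <=
  expR (lam * Ex p n (f h) + n%:R * (4 * lam ^+ 2)).
Proof.
move=> lam01; elim: n h => [|n IH] h /=; first by rewrite mul0r addr0.
have fE a l : f h (a :: l) = f (fun v => h v + psi v a) l.
  by rewrite /f/=; congr maxover; apply/funext => v; rewrite big_cons addrA.
set g := fun a => Ex p n (f (fun v => h v + psi v a)).
have gE a : Ex p n (fun l => f h (a :: l)) = g a.
  by apply: eq_Ex => l _; rewrite fE.
under [X in _ <= expR (_ * X + _)]eq_bigr do rewrite gE.
pose m := \sum_a p a * g a; rewrite -[X in _ <= expR (_ * X + _)]/m.
have gd a a' : g a - g a' <= 1.
  have -> : 1 = Ex p n (fun=> 1) by rewrite Ex_cst.
  rewrite lerBlDl -ExD; apply: le_Ex => l _.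
  apply: maxover_le => v; apply: le_trans (_ : _ <= (h v + psi v a' + \sum_(j <- l) psi v j) + 1) _.
    have := psi_diff v a a'; lra.
  by rewrite lerD2r; exact: (maxover_ge v0 (fun v => h v + psi v a' + \sum_(j <- l) psi v j)).
have gm a : `|g a - m| <= 1.
  have mE : g a - m = \sum_b p b * (g a - g b).
    under eq_bigr do rewrite mulrBr.
    by rewrite sumrB -mulr_suml p_sum1 mul1r.
  rewrite mE; apply: le_trans (ler_norm_sum _ _ _) _.
  rewrite -p_sum1; apply: ler_sum => b _.
  rewrite normrM ger0_norm// ler_piMr// ler_norml.
  by have := gd a b; have := gd b a; lra.
have step : Ex p n.+1 (fun l => expR (lam * f h l)) <=
    \sum_a p a * expR (lam * g a + n%:R * (4 * lam ^+ 2)).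
  rewrite /=; apply: ler_sum => a _; rewrite ler_wpM2l//.
  apply: le_trans (IH (fun v => h v + psi v a)).
  by apply: le_Ex => l _; rewrite fE.
apply: le_trans step _.
have -> : \sum_a p a * expR (lam * g a + n%:R * (4 * lam ^+ 2)) =
    expR (lam * m + n%:R * (4 * lam ^+ 2)) * \sum_a p a * expR (lam * (g a - m)).
  rewrite mulr_sumr; apply: eq_bigr => a _; rewrite [RHS]mulrCA -expRD; congr (_ * expR _).
  by ring.
apply: le_trans (_ : _ <= expR (lam * m + n%:R * (4 * lam ^+ 2)) * expR (4 * lam ^+ 2)) _.
  rewrite ler_wpM2l ?expR_ge0//; apply: centered_mgf => //.
  under eq_bigr do rewrite mulrBr.
  by rewrite sumrB -mulr_suml p_sum1 mul1r subrr.
by rewrite -expRD ler_expR -natr1; lra.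
Qed.

Lemma maxover_tail n (t : R) (lam : R) : 0 <= lam <= 1 ->
  Ex p n (fun l => ((t <= f (fun=> 0) l)%R)%:R) <=
  expR (lam * (Ex p n (f (fun=> 0)) - t) + n%:R * (4 * lam ^+ 2)).
Proof.
move=> lam01; have /andP[l0 _] := lam01.
apply: le_trans (_ : Ex p n (fun l => expR (- (lam * t)) * expR (lam * f (fun=> 0) l)) <= _).
  apply: le_Ex => l _; rewrite -expRD; have [tf|_] := leP t (f (fun=> 0) l); last by rewrite expR_ge0.
  rewrite mulr1n.
  have := expR_ge1Dx (- (lam * t) + lam * f (fun=> 0) l).
  have : lam * t <= lam * f (fun=> 0) l by rewrite ler_wpM2l.
  lra.
rewrite ExZ; apply: le_trans (_ : expR (- (lam * t)) * expR (lam * Ex p n (f (fun=> 0)) + n%:R * (4 * lam ^+ 2)) <= _).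
  by rewrite ler_wpM2l ?expR_ge0//; exact: maxover_mgf.
by rewrite -expRD ler_expR; lra.
Qed.

End BoundedDifferences.

End FiniteExpectation.

(* Rademacher extension of the law [p]: the second component is a fair sign. *)
Definition rade (R : realType) (I : finType) (p : I -> R) (ae : I * bool) : R :=
  p ae.1 / 2.

Section Symmetrization.
Context {R : realType} {I : finType} (p : I -> R).
Hypothesis p_ge0 : forall a, 0 <= p a.
Hypothesis p_sum1 : \sum_a p a = 1.

Lemma rade_ge0 ae : 0 <= rade p ae.
Proof. by rewrite /rade divr_ge0. Qed.

Lemma sum_rade (h : I * bool -> R) :
  \sum_ae rade p ae * h ae = \sum_a p a * ((h (a, false) + h (a, true)) / 2).
Proof.
transitivity (\sum_a \sum_e rade p (a, e) * h (a, e)).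
  by rewrite pair_bigA; apply: eq_bigr => -[a e].
apply: eq_bigr => a _; rewrite big_bool/= /rade/=; lra.
Qed.

Lemma rade_sum1 : \sum_ae rade p ae = 1.
Proof.
have := sum_rade (fun=> 1); under eq_bigr do rewrite mulr1; move=> ->.
by rewrite -[RHS]p_sum1; apply: eq_bigr => a _; lra.
Qed.

Context {F : finType} (v0 : F).

(** If [v] and [w] attain the two maxima on the left, then testing the right-hand maxima at [v] and
    [w], or at [w] and [v], suffices; the sign of [s v - s w] decides which. *)
Lemma contraction2 (h s q : F -> R) :
    (forall v w, `|q v - q w| <= `|s v - s w|) ->
  maxover v0 (fun v => h v + q v) + maxover v0 (fun v => h v - q v) <=
  maxover v0 (fun v => h v + s v) + maxover v0 (fun v => h v - s v).
Proof.
move=> qs.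
have [v ->] := maxover_attained v0 (fun v => h v + q v).
have [w ->] := maxover_attained v0 (fun v => h v - q v).
have qsw := le_trans (ler_norm _) (qs v w).
have := maxover_ge v0 (fun v => h v + s v) v.
have := maxover_ge v0 (fun v => h v - s v) w.
have := maxover_ge v0 (fun v => h v + s v) w.
have := maxover_ge v0 (fun v => h v - s v) v.
rewrite /=; case: (lerP 0 (s v - s w)) qsw => svw.
  by rewrite ger0_norm//; lra.
by rewrite ltr0_norm//; lra.
Qed.

(* Symmetrization and Talagrand's contraction principle, performed one sample
   at a time by convexity of the maximum. *)
Lemma symmetrization (q s : F -> I -> R) n (h : F -> R) :
    (forall v w a, `|q v a - q w a| <= `|s v a - s w a|) ->
  Ex p n (fun l => maxover v0 (fun v => h v +
    \sum_(a <- l) ((\sum_b p b * q v b) - q v a))) <=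
  Ex (rade p) n (fun l => maxover v0 (fun v => h v +
    \sum_(ae <- l) (-1) ^+ ae.2 * (2 * s v ae.1))).
Proof.
move=> qs; elim: n h => [|n IH] h /=.
  by apply: le_maxover => v; rewrite !big_nil.
pose G (h : F -> R) := Ex (rade p) n (fun l => maxover v0 (fun v => h v +
    \sum_(ae <- l) (-1) ^+ ae.2 * (2 * s v ae.1))).
have leG h1 h2 : (forall v, h1 v <= h2 v) -> G h1 <= G h2.
  move=> h12; apply: le_Ex => [|l _]; first exact: rade_ge0.
  by apply: le_maxover => v; rewrite lerD2r.
have GD h1 h2 : G (fun v => (h1 v + h2 v) / 2) <= (G h1 + G h2) / 2.
  rewrite [_ / 2]mulrC /G -ExD -ExZ.
  apply: le_Ex => [|l _]; first exact: rade_ge0.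
  apply: maxover_le => v.
  have := maxover_ge v0 (fun v => h1 v + \sum_(ae <- l) (-1) ^+ ae.2 * (2 * s v ae.1)) v.
  have := maxover_ge v0 (fun v => h2 v + \sum_(ae <- l) (-1) ^+ ae.2 * (2 * s v ae.1)) v.
  by rewrite /=; lra.
have GS (J : finType) (c : J -> R) (H : J -> F -> R) : (forall j, 0 <= c j) -> \sum_j c j = 1 ->
    G (fun v => \sum_j c j * H j v) <= \sum_j c j * G (H j).
  move=> c0 c1; rewrite /G; under [leRHS]eq_bigr do rewrite -ExZ.
  rewrite -(Ex_sum rade_sum1); apply: le_Ex => [|l _]; first exact: rade_ge0.
  apply: maxover_le => v.
  pose S v := \sum_(ae <- l) (-1) ^+ ae.2 * (2 * s v ae.1).
  have SE : S v = \sum_j c j * S v by rewrite -mulr_suml c1 mul1r.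
  rewrite -[X in _ + X <= _]/(S v) SE -big_split/=.
  apply: ler_sum => j _; rewrite -mulrDr ler_wpM2l//.
  exact: (maxover_ge v0 (fun v => H j v + \sum_(ae <- l) (-1) ^+ ae.2 * (2 * s v ae.1))).
have Gcontr h1 a : G (fun v => h1 v + 2 * q v a) + G (fun v => h1 v - 2 * q v a) <=
    G (fun v => h1 v + 2 * s v a) + G (fun v => h1 v - 2 * s v a).
  rewrite /G -!ExD; apply: le_Ex => [|l _]; first exact: rade_ge0.
  pose S v := \sum_(ae <- l) (-1) ^+ ae.2 * (2 * s v ae.1).
  have := @contraction2 (fun v => h1 v + S v) (fun v => 2 * s v a) (fun v => 2 * q v a).
  have E (u : F -> R) : (fun v => h1 v + S v + u v) = (fun v => h1 v + u v + S v).
    by apply/funext => v; rewrite addrAC.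
  rewrite !E; apply => v w.
  by rewrite -!mulrBr !normrM ler_wpM2l.
have step a : Ex p n (fun l => maxover v0 (fun v => h v + \sum_(c <- a :: l)
      ((\sum_b p b * q v b) - q v c))) <=
    G (fun v => h v + ((\sum_b p b * q v b) - q v a)).
  apply: le_trans (IH _); apply: le_Ex => // l _.
  by apply: le_maxover => v; rewrite big_cons addrA.
apply: le_trans (_ : \sum_a p a * G (fun v => h v + ((\sum_b p b * q v b) - q v a)) <= _).
  by apply: ler_sum => a _; rewrite ler_wpM2l.
(* With an independent copy [b], the value [h v + q v b - q v a] is the midpoint of
   [h v + 2 * q v b] and [h v - 2 * q v a]. By convexity the two halves separate; each depends on
   one draw only, so [b] may be renamed [a], and the pair reads as an average over a sign. *)
pose g1 a := G (fun v => h v + 2 * q v a).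
pose g2 a := G (fun v => h v - 2 * q v a).
apply: le_trans (_ : \sum_a p a * ((\sum_b p b * g1 b + g2 a) / 2) <= _).
  apply: ler_sum => a _; rewrite ler_wpM2l//.
  have -> : (\sum_b p b * g1 b + g2 a) / 2 = \sum_b p b * ((g1 b + g2 a) / 2).
    rewrite {1}(_ : g2 a = \sum_b p b * g2 a); last by rewrite -mulr_suml p_sum1 mul1r.
    rewrite -big_split/= mulr_suml; apply: eq_bigr => b _; ring.
  apply: le_trans (_ : _ <= \sum_b p b * G (fun v => ((h v + 2 * q v b) + (h v - 2 * q v a)) / 2)) _; last first.
    by apply: ler_sum => b _; rewrite ler_wpM2l//; exact: GD.
  apply: le_trans (GS _ _ _ p_ge0 p_sum1); apply: leG => v.
  rewrite (_ : h v + _ = \sum_b p b * (h v + (q v b - q v a))); last first.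
    under [RHS]eq_bigr do rewrite mulrDr mulrBr.
    rewrite big_split/= sumrB -!mulr_suml p_sum1 !mul1r.
    by [].
  by apply: ler_sum => b _; rewrite ler_wpM2l//; lra.
have -> : \sum_a p a * ((\sum_b p b * g1 b + g2 a) / 2) = \sum_a p a * ((g1 a + g2 a) / 2).
  have E (c : I -> R) (x : R) : \sum_a p a * ((x + c a) / 2) = (x + \sum_a p a * c a) / 2.
    rewrite mulrDl -[X in X / 2 + _]mul1r -p_sum1 !mulr_suml -big_split/=.
    by apply: eq_bigr => a _; lra.
  rewrite E -big_split/= mulr_suml; apply: eq_bigr => a _; lra.
have := sum_rade (fun ae => Ex (rade p) n (fun l => maxover v0 (fun v => h v +
    \sum_(be <- ae :: l) (-1) ^+ be.2 * (2 * s v be.1)))).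
move=> ->; apply: ler_sum => a _; rewrite ler_wpM2l// ler_pM2r ?invr_gt0//.
apply: le_trans (Gcontr h a) _.
apply: lerD; apply: le_Ex => [|l _]; try exact: rade_ge0.
  by apply: le_maxover => v; rewrite big_cons/= expr0 mul1r addrA.
by apply: le_maxover => v; rewrite big_cons/= expr1 mulN1r addrA.
Qed.

End Symmetrization.

(** * Generic chaining *)

Section AdmissibleSequences.
Context {R : realType} {T : pointedType}.
Implicit Types (S : set T) (d : T -> T -> R) (A : nat -> set (set T)).

Lemma pblock_admissible S A s v : admissible S A -> S v ->
  [/\ A s (pblock (A s) id v), pblock (A s) id v v & pblock (A s) id v `<=` S].
Proof.
move=> [/(_ s)[Acov _ _] _ _ _] Sv.
have [|AP Pv] := @getPex _ [set B : set T | A s B /\ B v].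
  by move: Sv; rewrite -Acov => -[B AB Bv]; exists B.
split => //; rewrite -Acov => w Bw.
by exists (pblock (A s) id v).
Qed.

Lemma pblock_unique S A s v B : admissible S A -> A s B -> B v ->
  pblock (A s) id v = B.
Proof.
move=> adm AB Bv; have [/(_ s)[Acov Atriv _] _ _ _] := adm.
have Sv : S v by rewrite -Acov; exists B.
have [AP Pv _] := pblock_admissible s adm Sv.
by apply: Atriv => //; exists v.
Qed.

Lemma pblock_nested S A s v : admissible S A -> S v ->
  pblock (A s.+1) id v `<=` pblock (A s) id v.
Proof.
move=> adm Sv; have [AP Pv _] := pblock_admissible s.+1 adm Sv.
have [_ /(_ _ _ AP)[B AB PB] _ _] := adm.
by rewrite (pblock_unique adm AB (PB _ Pv)).
Qed.

Lemma admissible_code S A : admissible S A -> exists c : nat -> T -> nat,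
  [/\ forall s v, S v -> (c s v < 2 ^ 2 ^ s)%N,
      forall v, S v -> c 0%N v = 0%N
    & forall s v w, S v -> S w -> c s v = c s w ->
        pblock (A s) id v = pblock (A s) id w].
Proof.
move=> adm; have [_ _ A0 A1] := adm.
have inj s : exists f : set T -> nat, [/\ forall B, A s B -> (f B < 2 ^ 2 ^ s)%N,
    s = 0%N -> forall B, A s B -> f B = 0%N &
    forall B B', A s B -> A s B' -> f B = f B' -> B = B'].
  case: s => [|s].
    have : (A 0%N #<= `I_1)%card by move: A0; rewrite card_eq_le => /andP[].
    case/pcard_leP => f; exists f.
    have f0 B : A 0%N B -> f B = 0%N.
      by move=> AB; have := @funS _ _ _ _ f B AB; rewrite /mkset ltnS leqn0 => /eqP.
    split => [B AB|_ B AB|B B' AB AB']; [by rewrite f0//|exact: f0|].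
    by apply: (@inj _ _ _ f); rewrite inE.
  case/pcard_leP: (A1 s.+1 erefl) => f; exists f.
  split => // [B AB|B B' AB AB']; first exact: (@funS _ _ _ _ f B AB).
  by apply: (@inj _ _ _ f); rewrite inE.
have [f fP] := choice inj.
exists (fun s v => f s (pblock (A s) id v)); split.
- by move=> s v Sv; have [h _ _] := fP s; apply: h; have [] := pblock_admissible s adm Sv.
- by move=> v Sv; have [_ h _] := fP 0%N; apply: h => //; have [] := pblock_admissible 0 adm Sv.
- move=> s v w Sv Sw e; have [_ _ h] := fP s; apply: h => //.
    by have [] := pblock_admissible s adm Sv.
  by have [] := pblock_admissible s adm Sw.
Qed.

Lemma admissible_nonempty S A : admissible S A -> S !=set0.
Proof.
move=> [/(_ 0%N)[Acov _ Ane] _ A0 _].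
have : (`I_1 #<= A 0%N)%card by move: A0; rewrite card_eq_le => /andP[].
case/pcard_leP => f.
have /Ane[v v0] : A 0%N (f 0%N) by exact: (@funS _ _ _ _ f 0%N).
by exists v; rewrite -Acov; exists (f 0%N) => //; exact: (@funS _ _ _ _ f 0%N).
Qed.

Lemma diameter_ge d (B : set T) u v : B u -> B v -> ((d u v)%:E <= diameter d B)%E.
Proof. by move=> Bu Bv; apply: ereal_sup_ubound; exists u => //; exists v. Qed.

Lemma partial_sum_diameter S A d (alpha : nat) (G : R) v (w : nat -> T * T) M :
    (forall u v, 0 <= d u v) -> admissible S A -> S v ->
    (\sum_(0 <= s <oo) (2 `^ (s%:R / alpha%:R))%:E * diameter d (pblock (A s) id v)
       <= G%:E)%E ->
    (forall k, (k < M)%N -> pblock (A k) id v (w k).1 /\ pblock (A k) id v (w k).2) ->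
  \sum_(k < M) 2 `^ (k%:R / alpha%:R) * d (w k).1 (w k).2 <= G.
Proof.
move=> d0 adm Sv HG Hw; rewrite -lee_fin; apply: le_trans HG.
apply: (@le_trans _ _ (\sum_(0 <= s < M) (2 `^ (s%:R / alpha%:R))%:E * diameter d (pblock (A s) id v))%E); last first.
  apply: nneseries_lim_ge => s _ _; rewrite mule_ge0 ?lee_fin ?powR_ge0//.
  have [_ Pv _] := pblock_admissible s adm Sv.
  by apply: le_trans (diameter_ge d Pv Pv); rewrite lee_fin.
rewrite big_mkord -sumEFin; apply: lee_sum => k _.
rewrite EFinM lee_pmul2l ?fin_numE ?lte_fin ?powR_gt0//.
by have [] := Hw k (ltn_ord k) => *; exact: diameter_ge.
Qed.

End AdmissibleSequences.

(* Generic chaining, combinatorial part: every point of a finite subset of [S]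
   is joined to a base point through links that are drawn at level [k] from at
   most [2 ^ (6 * 2 ^ k)] vectors.  The exponent comes from merging two
   sequences of partitions, and from links being pairs of blocks. *)
Lemma chaining_links (R : realType) (p : nat) (S : set 'rV[R]_p)
    (A B : nat -> set (set 'rV[R]_p)) (N1 N2 : 'rV[R]_p -> R) (a1 a2 : nat)
    (G1 G2 : R) (m : nat) (s : 'I_m -> 'rV[R]_p) :
    seminorm N1 -> seminorm N2 -> admissible S A -> admissible S B ->
    (forall v, S v -> (\sum_(0 <= k <oo) (2 `^ (k%:R / a1%:R))%:E *
       diameter (fun u v => N1 (u - v)%R) (pblock (A k) id v) <= G1%:E)%E) ->
    (forall v, S v -> (\sum_(0 <= k <oo) (2 `^ (k%:R / a2%:R))%:E *
       diameter (fun u v => N2 (u - v)%R) (pblock (B k) id v) <= G2%:E)%E) ->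
    (forall j, S (s j)) ->
  exists (M : nat) (s0 : 'rV[R]_p) (L : nat -> seq 'rV[R]_p)
         (w : 'I_m -> nat -> 'rV[R]_p),
  [/\ forall k, (size (L k) <= 2 ^ (6 * 2 ^ k))%N,
      forall j k, (k < M)%N -> w j k \in L k,
      forall j, s j = s0 + \sum_(k < M) w j k,
      forall j, \sum_(k < M) 2 `^ (k%:R / a1%:R) * N1 (w j k) <= G1
    & forall j, \sum_(k < M) 2 `^ (k%:R / a2%:R) * N2 (w j k) <= G2].
Proof.
move=> [N10 _ _] [N20 _ _] admA admB HA HB Ss.
have [c [cb c0 cP]] := admissible_code admA.
have [c' [cb' c0' cP']] := admissible_code admB.
(* One representative per cell of the common refinement of both partitions. An empty cell gets the
   default 0, which only adds spurious vectors to the lists of links. *)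
pose rep k (ij : nat * nat) : 'rV[R]_p :=
  xget 0 [set v | [/\ S v, c k v = ij.1 & c' k v = ij.2]].
pose pi k v := rep k (c k v, c' k v).
have piP k v : S v -> [/\ S (pi k v), c k (pi k v) = c k v & c' k (pi k v) = c' k v].
  by move=> Sv; apply: (@xgetPex _ 0 [set u | [/\ S u, c k u = c k v & c' k u = c' k v]]); exists v.
(* After level [m] the path jumps to the point itself. The last list then holds just [m] links, one
   per point, and [m < 2 ^ m] keeps it within the size bound. *)
pose path j k := if (k <= m)%N then pi k (s j) else s j.
pose w j k := path j k.+1 - path j k.
pose Lk k := [seq rep k.+1 (nat_of_ord q.2.1, nat_of_ord q.2.2) -
    rep k (nat_of_ord q.1.1, nat_of_ord q.1.2) |
    q <- enum {: ('I_(2 ^ 2 ^ k) * 'I_(2 ^ 2 ^ k)) * ('I_(2 ^ 2 ^ k.+1) * 'I_(2 ^ 2 ^ k.+1))}].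
pose L k := if (k < m)%N then Lk k else if k == m then [seq w j k | j <- enum 'I_m] else [::].
have pathA j k : pblock (A k) id (s j) (path j k) /\ pblock (A k) id (s j) (path j k.+1).
  have inA l : pblock (A l) id (s j) (path j l).
    rewrite /path; case: ifP => _; last by have [] := pblock_admissible l admA (Ss j).
    have [Sp e _] := piP l _ (Ss j).
    by rewrite -(cP _ _ _ Sp (Ss j) e); have [] := pblock_admissible l admA Sp.
  by split; [exact: inA | apply: (pblock_nested admA (Ss j)); exact: inA].
have pathB j k : pblock (B k) id (s j) (path j k) /\ pblock (B k) id (s j) (path j k.+1).
  have inB l : pblock (B l) id (s j) (path j l).
    rewrite /path; case: ifP => _; last by have [] := pblock_admissible l admB (Ss j).
    have [Sp _ e] := piP l _ (Ss j).
    by rewrite -(cP' _ _ _ Sp (Ss j) e); have [] := pblock_admissible l admB Sp.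
  by split; [exact: inB | apply: (pblock_nested admB (Ss j)); exact: inB].
exists m.+1, (rep 0%N (0%N, 0%N)), L, w; split.
- move=> k; rewrite /L; case: ltnP => km.
    rewrite size_map -cardE !card_prod !card_ord -!expnD leq_exp2l//.
    by rewrite expnS; lia.
  case: eqP => [->|//]; rewrite size_map size_enum_ord.
  have m2 : (m < 2 ^ m)%N by exact: ltn_expl.
  by apply: leq_trans (ltnW m2) _; rewrite leq_exp2l//; lia.
- move=> j k; rewrite ltnS leq_eqVlt => /orP[/eqP->|km]; rewrite /L.
    by rewrite ltnn eqxx; apply/mapP; exists j; rewrite ?mem_enum.
  rewrite km; apply/mapP.
  exists ((Ordinal (cb k _ (Ss j)), Ordinal (cb' k _ (Ss j))),
          (Ordinal (cb k.+1 _ (Ss j)), Ordinal (cb' k.+1 _ (Ss j)))).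
    by rewrite mem_enum.
  by rewrite /w /path km (ltnW km).
- move=> j; rewrite -(big_mkord xpredT (w j)) telescope_sumr//.
  rewrite /path ltnn leq0n /pi c0 ?c0'; [|exact: Ss..].
  by rewrite addrC subrK.
- move=> j; apply: (@partial_sum_diameter _ _ S A (fun u v => N1 (u - v)) a1 G1 (s j) (fun k => (path j k.+1, path j k))) => //.
    exact: HA.
  by move=> k _; have [] := pathA j k.
- move=> j; apply: (@partial_sum_diameter _ _ S B (fun u v => N2 (u - v)) a2 G2 (s j) (fun k => (path j k.+1, path j k))) => //.
    exact: HB.
  by move=> k _; have [] := pathB j k.
Qed.

Lemma gamma_ge0 (R : realType) (T : pointedType) alpha (S : set T) (d : T -> T -> R) :
  (forall u v, 0 <= d u v) -> (0 <= gamma alpha S d)%E.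
Proof.
move=> d0; apply/le_ereal_inf_tmp => _ [A admA <-].
have [v Sv] := admissible_nonempty admA.
apply: le_trans (ereal_sup_ubound _); last by exists v.
apply: nneseries_ge0 => k _ _; rewrite mule_ge0 ?lee_fin ?powR_ge0//.
have [_ Pv _] := pblock_admissible k admA Sv.
by apply: le_trans (diameter_ge d Pv Pv); rewrite lee_fin.
Qed.

Lemma gamma_witness (R : realType) (T : pointedType) alpha (S : set T)
    (d : T -> T -> R) (G : R) : (gamma alpha S d < G%:E)%E ->
  exists2 A, admissible S A &
    forall v, S v -> (\sum_(0 <= k <oo) (2 `^ (k%:R / alpha%:R))%:E *
       diameter d (pblock (A k) id v) <= G%:E)%E.
Proof.
move=> /ereal_inf_lt[_ [A admA <-] lt]; exists A => // v Sv.
by apply: le_trans (ltW lt); apply: ereal_sup_ubound; exists v.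
Qed.

(** * Samples seen through functions with finite range *)

Lemma Ex_tuple (R : realType) (I : finType) (p : I -> R) n (F : seq I -> R) :
  Ex p n F = \sum_(t : n.-tuple I) (\prod_(a <- t) p a) * F t.
Proof.
elim: n F => [|n IH] F /=.
  rewrite (big_pred1 [tuple]) => [|t]; last by apply/esym/eqP/val_inj; rewrite tuple0.
  by rewrite big_nil mul1r.
transitivity (\sum_a \sum_(t : n.-tuple I) (\prod_(b <- a :: t) p b) * F (a :: t)).
  apply: eq_bigr => a _; rewrite IH mulr_sumr; apply: eq_bigr => t _.
  by rewrite big_cons mulrA.
rewrite pair_bigA/= (reindex (fun q : I * n.-tuple I => [tuple of q.1 :: q.2]))//=.
exists (fun t : n.+1.-tuple I => (thead t, [tuple of behead t])) => [[a t] _|t _] /=.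
  by rewrite theadE; congr pair; apply/val_inj.
by rewrite -tuple_eta.
Qed.

Lemma cvg_prod_seq (R : realType) (I : Type) (r : seq I) (u : I -> nat -> R)
    (l : I -> R) : (forall i, u i @ \oo --> l i) ->
  \prod_(i <- r) u i k @[k --> \oo] --> \prod_(i <- r) l i.
Proof.
move=> ul; elim: r => [|i r IH].
  by under eq_fun do rewrite big_nil; rewrite big_nil; exact: cvg_cst.
by under eq_fun do rewrite big_cons; rewrite big_cons; exact: cvgM.
Qed.

Section FiniteRange.
Import HBNNSimple finmap.
Context {R : realType} {d : measure_display} {Omega : measurableType d}.
Variable P : probability Omega R.

Lemma measurable_finrange (J : finType) (idx : Omega -> J) d'
    (T : measurableType d') (c : J -> T) :
  (forall a, measurable (idx @^-1` [set a])) ->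
  measurable_fun setT (fun w => c (idx w)).
Proof.
move=> midx _ Y _; rewrite setTI.
rewrite (_ : _ @^-1` _ = \bigcup_(a in [set a | Y (c a)]) (idx @^-1` [set a])).
  by apply: fin_bigcup_measurable => [|a _]; [exact: finite_finset|exact: midx].
by apply/seteqP; split => [w /= Yw|w [a /= Ya iw]]; [exists (idx w)|rewrite /= iw].
Qed.

Lemma integral_finrange (J : finType) (idx : Omega -> J) (c : J -> R) :
  (forall a, measurable (idx @^-1` [set a])) -> (forall a, 0 <= c a) ->
  (\int[P]_w (c (idx w))%:E)%E =
  (\sum_a fine (P (idx @^-1` [set a])) * c a)%:E.
Proof.
move=> midx c0.
transitivity (\int[P]_w (\sum_(a <- enum J) (c a)%:E * (\1_(idx @^-1` [set a]) w)%:E))%E.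
  apply: eq_integral => w _; rewrite big_enum/= (bigD1 (idx w))//= big1.
    by rewrite adde0 indicE mem_set// mule1.
  move=> a aw; rewrite indicE memNset ?mule0//= => /esym/eqP.
  by rewrite (negbTE aw).
rewrite ge0_integral_sum//; last first.
- by move=> a w _; rewrite -EFinM lee_fin mulr_ge0// indicE.
- move=> a; apply/measurable_EFinP; apply: measurable_funM => //.
rewrite big_enum/= -sumEFin; apply: eq_bigr => a _.
rewrite ge0_integralZl_EFin//; last first.
  apply/measurable_EFinP; exact: measurable_indic.
by rewrite integral_indic// setIT muleC EFinM fineK// fin_num_measure.
Qed.

Context {d' : measure_display} {T : measurableType d'} {n : nat}.
Variables (Z : 'I_n -> Omega -> T) (z : Omega -> T).
Hypothesis mZ : forall i, measurable_fun setT (Z i).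
Hypothesis mz : measurable_fun setT z.
Hypothesis lawZ : forall i, same_law P (Z i) z.
Hypothesis indZ : mutually_independent P Z.

(** The tuple of indices has finite range, and each of its fibres is an intersection of events about
    single sample points. Independence for events is thus all that is used to reach the product law
    [Ex]. *)
Lemma integral_sample (J : finType) (idx : T -> J) (F : seq J -> R) :
    (forall a, measurable (idx @^-1` [set a])) -> (forall l, 0 <= F l) ->
  (\int[P]_w (F [seq idx (Z i w) | i <- enum 'I_n])%:E)%E =
  (Ex (fun a => fine (P (z @^-1` (idx @^-1` [set a])))) n F)%:E.
Proof.
move=> midx F0.
pose tup w : n.-tuple J := [tuple idx (Z i w) | i < n].
have fiber (t : n.-tuple J) : tup @^-1` [set t] =
    \bigcap_(i in [set: 'I_n]) (Z i @^-1` (idx @^-1` [set tnth t i])).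
  apply/seteqP; split => [w /= tw i _|w /= tw] /=.
    by rewrite -tw tnth_mktuple.
  by apply/eq_from_tnth => i; rewrite tnth_mktuple; exact: tw.
have mZi i a : measurable (Z i @^-1` (idx @^-1` [set a])).
  by rewrite -[X in measurable X]setTI; exact: mZ.
have mtup t : measurable (tup @^-1` [set t]).
  by rewrite fiber; apply: fin_bigcap_measurable => // i _; exact: mZi.
have := @integral_finrange _ tup (fun t => F t) mtup (fun t => F0 t).
rewrite Ex_tuple => ->; congr EFin; apply: eq_bigr => t _; congr (_ * _).
rewrite fiber indZ; last by move=> i; exact: midx.
rewrite big_tuple; apply: EFin_inj; rewrite fineK; last first.
  rewrite -indZ; last by move=> i; exact: midx.
  by rewrite -fiber fin_num_measure.
rewrite -prodEFin; apply: eq_bigr => i _; rewrite fineK.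
  by apply: lawZ; exact: midx.
rewrite fin_num_measure// -[X in measurable X]setTI; exact: mz.
Qed.

Lemma measurable_sample (J : finType) (idx : T -> J) (B : seq J -> bool) :
    (forall a, measurable (idx @^-1` [set a])) ->
  measurable [set w | B [seq idx (Z i w) | i <- enum 'I_n]].
Proof.
move=> midx; pose tup w : n.-tuple J := [tuple idx (Z i w) | i < n].
have := @measurable_finrange _ tup _ _ (fun t : n.-tuple J => B t).
move=> /(_ _)/(_ measurableT [set true]); rewrite setTI; apply => //.
move=> t; rewrite (_ : _ @^-1` _ = \bigcap_(i in [set: 'I_n]) (Z i @^-1` (idx @^-1` [set tnth t i]))).
  by apply: fin_bigcap_measurable => // i _; rewrite -[X in measurable X]setTI; exact: mZ.
apply/seteqP; split => [w /= tw i _|w /= tw] /=.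
  by rewrite -tw tnth_mktuple.
by apply/eq_from_tnth => i; rewrite tnth_mktuple; exact: tw.
Qed.

Lemma probability_sample (J : finType) (idx : T -> J) (B : seq J -> bool) :
    (forall a, measurable (idx @^-1` [set a])) ->
  P [set w | B [seq idx (Z i w) | i <- enum 'I_n]] =
  (Ex (fun a => fine (P (z @^-1` (idx @^-1` [set a])))) n (fun l => (B l)%:R))%:E.
Proof.
move=> midx; rewrite -integral_sample//; have mB := measurable_sample B midx.
rewrite -[X in P X]setIT -integral_indic//; apply: eq_integral => w _.
rewrite indicE; congr ((_ : bool)%:R)%:E; apply/idP/idP.
  exact: set_mem.
exact: mem_set.
Qed.

(** Independence is stated for events. Simple functions approximating [g] from below have finitely
    many values, so the product rule for them is a finite sum, and monotone convergence passes to
    [g]. *)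
Lemma integral_prod_le (g : T -> R) (M : R) :
    (forall t, 0 <= g t) -> measurable_fun setT g ->
    (\int[P]_w (g (z w))%:E <= M%:E)%E ->
  (\int[P]_w (\prod_i g (Z i w))%:E <= (M ^+ n)%:E)%E.
Proof.
move=> g0 mg gM.
have mEg : measurable_fun setT (EFin \o g) by exact/measurable_EFinP.
pose f := nnsfun_approx measurableT mEg.
have f0 k t : 0 <= f k t by [].
have fg t : (EFin \o f^~ t) @ \oo --> (g t)%:E.
  by apply: (@cvg_nnsfun_approx _ _ _ _ measurableT _ mEg) => // s _; rewrite lee_fin.
have fnd t : {homo (f^~ t) : k l / (k <= l)%N >-> k <= l}.
  by move=> k l kl; have /lefP := nd_nnsfun_approx measurableT mEg kl; apply.
have fgr t : f^~ t @ \oo --> g t by have /fine_cvgP[_] := fg t.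
have f_le_g k t : f k t <= g t.
  have /nondecreasing_cvgn_le := fnd t; move=> /(_ _ k) H.
  by rewrite -(cvg_lim _ (fgr t))//; apply: H; apply/cvg_ex; exists (g t).
have step k : (\int[P]_w (\prod_i f k (Z i w))%:E <= (M ^+ n)%:E)%E.
  have fin_range : finite_set (range (f k)) by exact: fimfunP.
  pose J : finType := fset_sub_type (fset_set (range (f k))).
  have idxP t : f k t \in fset_set (range (f k)) by rewrite in_fset_set//; apply: mem_set; exists t.
  pose idx t : J := FSetSub (idxP t).
  have midx a : measurable (idx @^-1` [set a]).
    rewrite (_ : _ @^-1` _ = f k @^-1` [set val a]); first exact: measurable_funPTI.
    by apply/seteqP; split => t /= => [<-//|fa]; apply/val_inj.
  have val0 (a : J) : 0 <= val a.
    by case: a => a /= ar; move: (ar); rewrite in_fset_set// => /set_mem[t _ <-].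
  have := @integral_sample J idx (fun l => \prod_(a <- l) val a) midx.
  move=> /(_ _); rewrite Ex_prod => H.
  have fE w : \prod_i f k (Z i w) = \prod_(a <- [seq idx (Z i w) | i <- enum 'I_n]) val a.
    by rewrite big_map big_enum.
  under eq_integral do rewrite fE.
  rewrite H; last by move=> l; elim: l => [|a l IH]; rewrite ?big_nil// big_cons mulr_ge0.
  have mz' a : measurable ((idx \o z) @^-1` [set a]).
    by rewrite comp_preimage -[X in measurable X]setTI; exact: mz.
  have H2 := @integral_finrange J (idx \o z) (fun a => val a) mz' val0.
  have HM : \sum_a fine (P (z @^-1` (idx @^-1` [set a]))) * val a <= M.
    rewrite -lee_fin -H2//; apply: le_trans gM; apply: ge0_le_integral => //=.
    - by move=> w _; rewrite lee_fin.
    - apply/measurable_EFinP; apply: (@measurable_finrange J (idx \o z) _ _ val) => //.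
    - by apply/measurable_EFinP; exact: measurableT_comp mg mz.
    - by move=> w _; rewrite lee_fin; exact: f_le_g.
  have S0 : 0 <= \sum_a fine (P (z @^-1` (idx @^-1` [set a]))) * val a.
    by apply: sumr_ge0 => a _; rewrite mulr_ge0// fine_ge0.
  by rewrite lee_fin lerXn2r// nnegrE; exact: le_trans HM.
have mf k : measurable_fun setT (fun w => (\prod_i f k (Z i w))%:E).
  apply/measurable_EFinP; apply: measurable_prod => i _.
  by apply: measurableT_comp (mZ i); exact: measurable_funPT.
have := @cvg_monotone_convergence _ _ _ P _ measurableT (fun k w => (\prod_i f k (Z i w))%:E) mf.
have -> // : (fun w => limn (fun k => (\prod_i f k (Z i w))%:E)) = fun w => (\prod_i g (Z i w))%:E.
  apply/funext => w; apply/cvg_lim => //; apply/fine_cvgP; split; first by near=> k.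
  by apply: cvg_prod_seq => i; exact: fgr.
move=> /(_ _)/(_ _) H.
have {}H : (\int[P]_w (\prod_i f k (Z i w))%:E)%E @[k --> \oo] --> (\int[P]_w (\prod_i g (Z i w))%:E)%E.
  apply: H => [k w _|w _ k l kl]; rewrite lee_fin.
    by apply: prodr_ge0 => i _.
  by apply: ler_prod => i _; rewrite f0 fnd.
rewrite -(cvg_lim _ H)//; apply: lime_le; first by apply/cvg_ex; eexists; exact: H.
by near=> k; exact: step.
Unshelve. all: by end_near.
Qed.

End FiniteRange.

(** * Bernstein tails *)

Section BernsteinMoments.
Context {R : realType} {d : measure_display} {Omega : measurableType d}.
Variable P : probability Omega R.

Definition bernstein_gauge (g e z : R) : R := Num.min (z ^+ 2 / g ^+ 2) (`|z| / e).

(* Unlike in [generic_bernstein] both scales are positive, so that no division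
   by zero occurs. *)
Definition bernstein_tail (Z : Omega -> R) (g e : R) : Prop :=
  [/\ measurable_fun setT Z, 0 < g, 0 < e &
   forall s, 0 <= s ->
    (P [set w | (s <= `|Z w|)%R] <= (2 * expR (- bernstein_gauge g e s))%:E)%E].

Lemma bernstein_gauge_ge0 g e z : 0 < e -> 0 <= bernstein_gauge g e z.
Proof. by move=> e0; rewrite le_min !divr_ge0 ?sqr_ge0// ltW. Qed.

Lemma measurable_bernstein_gauge g e :
  measurable_fun setT (bernstein_gauge g e).
Proof.
apply: measurable_minr.
  exact: (measurable_funM (exprn_measurable 2) (measurable_cst _)).
apply: measurable_funM; [exact: normr_measurable|exact: measurable_cst].
Qed.

Lemma measurable_le_cst (f : Omega -> R) t : measurable_fun setT f ->
  measurable [set w | t <= f w].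
Proof.
move=> mf; rewrite -[X in measurable X]setTI.
rewrite (_ : [set w | t <= f w] = f @^-1` `[t, +oo[%classic); first exact: mf.
by apply/seteqP; split => w /=; rewrite in_itv/= andbT.
Qed.

Section Gauge.
Variables (Z : Omega -> R) (g e : R).
Hypothesis ZT : bernstein_tail Z g e.
Let mZ : measurable_fun setT Z. Proof. by case: ZT. Qed.
Let g0 : 0 < g. Proof. by case: ZT. Qed.
Let e0 : 0 < e. Proof. by case: ZT. Qed.
Let m w := bernstein_gauge g e (Z w).

Let mm : measurable_fun setT m.
Proof. exact: measurableT_comp (measurable_bernstein_gauge g e) mZ. Qed.

Let mexp (c : R) : measurable_fun setT (fun w => expR (c * m w)).
Proof.
by apply: measurableT_comp => //; exact: measurable_funM.
Qed.

(** The gauge inverts the tail: its value is at least [t] only if [|Z|] reaches both [g * sqrt t]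
    and [e * t], and at the larger of these levels the exponent is at least [t]. So the gauge has an
    exponential tail free of [g] and [e]. *)
Lemma bernstein_gauge_tail t : 0 <= t -> (P [set w | (t <= m w)%R] <= (2 * expR (- t))%:E)%E.
Proof.
move=> t0; pose s := Num.max (g * Num.sqrt t) (e * t).
have s0 : 0 <= s by rewrite le_max mulr_ge0 ?sqrtr_ge0// ltW.
have [_ _ _ /(_ s s0) tail] := ZT.
apply: (@le_trans _ _ (P [set w | (s <= `|Z w|)%R])).
  apply: le_measure; rewrite ?inE.
  - exact: measurable_le_cst.
  - by apply: measurable_le_cst; exact: measurableT_comp.
  - move=> w /=; rewrite /m le_min => /andP[h1 h2].
    rewrite ge_max; apply/andP; split; last by rewrite mulrC -ler_pdivlMr.
    rewrite -(@ler_pXn2r _ 2)// ?nnegrE ?mulr_ge0 ?sqrtr_ge0 ?(ltW g0)//.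
    rewrite exprMn sqr_sqrtr// real_normK ?num_real// mulrC -ler_pdivlMr//.
    by rewrite exprn_gt0.
apply: le_trans tail _; rewrite lee_fin ler_pM2l// ler_expR lerN2 le_min.
apply/andP; split.
  rewrite ler_pdivlMr ?exprn_gt0//.
  apply: (@le_trans _ _ ((g * Num.sqrt t) ^+ 2)).
    by rewrite exprMn sqr_sqrtr// mulrC.
  by rewrite ler_pXn2r ?nnegrE ?mulr_ge0 ?sqrtr_ge0 ?(ltW g0)// le_max lexx.
by rewrite ger0_norm// ler_pdivlMr// mulrC le_max lexx orbT.
Qed.

(** Slicing by the integer part, [exp (m / 2)] is at most the sum of [exp ((k + 1) / 2)] over the
    [k] with [k <= m]. The [k]-th slice has mean at most [2 exp (1 / 2) exp (- k / 2) <= 4 (2 / 3) ^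
    k], and these sum to 12. *)
Lemma integral_expR_gauge : (\int[P]_w (expR (m w / 2))%:E <= 12%:E)%E.
Proof.
pose c k : R := expR (k.+1%:R / 2).
pose A k := [set w | k%:R <= m w].
have mA k : measurable (A k) by exact: measurable_le_cst.
apply: (@le_trans _ _ (\int[P]_w (\sum_(0 <= k <oo) (c k * \1_(A k) w)%:E))%E).
  apply: ge0_le_integral => //=.
  - apply/measurable_EFinP; have := mexp 2^-1.
    by under eq_fun do rewrite mulrC.
  - apply: ge0_emeasurable_sum => [k w _ _|k _]; first by rewrite lee_fin mulr_ge0// expR_ge0.
    by apply/measurable_EFinP; apply: measurable_funM => //; exact: measurable_indic.
  move=> w _; pose k := Num.truncn (m w).
  have m0 : 0 <= m w by exact: bernstein_gauge_ge0.
  have /andP[k1 k2] := truncn_itv m0.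
  have F0 j : (0 <= (c j * \1_(A j) w)%:E)%E by rewrite lee_fin mulr_ge0// expR_ge0.
  apply: (@le_trans _ _ (\sum_(0 <= j < k.+1) (c j * \1_(A j) w)%:E)%E); last first.
    by apply: nneseries_lim_ge => j _ _.
  rewrite big_nat_recr//= lee_paddl//; first by apply: sume_ge0.
  rewrite lee_fin indicE mem_set// mulr1 ler_expR ler_pM2r//.
  exact: ltW.
rewrite integral_nneseries//; last 2 first.
- by move=> k; apply/measurable_EFinP; apply: measurable_funM => //; exact: measurable_indic.
- by move=> k w _; rewrite lee_fin mulr_ge0// expR_ge0.
have half2 : expR (1 / 2) <= 2 :> R.
  have en := expR_ge1Dx (- (1 / 2) : R).
  have ee := expRxMexpNx_1 (1 / 2 : R).
  have e1 := expR_gt0 (1 / 2 : R).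
  nra.
have half23 : expR (- (1 / 2)) <= 2 / 3 :> R.
  have en := expR_ge1Dx (1 / 2 : R).
  have ee := expRxMexpNx_1 (1 / 2 : R).
  have e1 := expR_gt0 (- (1 / 2) : R).
  nra.
have term k : (\int[P]_w (c k * \1_(A k) w)%:E <= (4 * (2 / 3) ^+ k)%:E)%E.
  under eq_integral do rewrite EFinM.
  rewrite ge0_integralZl_EFin ?expR_ge0//; last first.
    by apply/measurable_EFinP; exact: measurable_indic.
  rewrite integral_indic// setIT.
  apply: (@le_trans _ _ ((c k)%:E * (2 * expR (- k%:R))%:E)%E).
    by rewrite lee_pmul2l ?lte_fin ?expR_gt0//; exact: bernstein_gauge_tail.
  rewrite -EFinM lee_fin mulrCA -expRD.
  have -> : k.+1%:R / 2 - k%:R = 1 / 2 + (- (1 / 2)) * k%:R :> R by rewrite -natr1; lra.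
  rewrite expRD expRM_natr.
  have : expR (- (1 / 2)) ^+ k <= (2 / 3) ^+ k :> R.
    by rewrite lerXn2r// nnegrE// expR_ge0.
  have : 0 <= expR (- (1 / 2)) ^+ k :> R by rewrite exprn_ge0// expR_ge0.
  have := expR_gt0 (1 / 2 : R); nra.
have geo N : \sum_(0 <= k < N) (2 / 3) ^+ k = 3 * (1 - (2 / 3) ^+ N) :> R.
  elim: N => [|N IH]; first by rewrite big_geq// expr0 subrr mulr0.
  by rewrite big_nat_recr//= IH exprS; lra.
apply: lime_le.
  by apply: is_cvg_nneseries => k _ _; apply: integral_ge0 => w _; rewrite lee_fin mulr_ge0// expR_ge0.
near=> N.
apply: (@le_trans _ _ (\sum_(0 <= k < N) (4 * (2 / 3) ^+ k)%:E)%E).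
  by apply: lee_sum => k _; exact: term.
rewrite sumEFin lee_fin -mulr_sumr.
rewrite geo; have : 0 <= (2 / 3) ^+ N :> R by rewrite exprn_ge0//; lra.
lra.
Unshelve. all: by end_near.
Qed.

Section Product.
Variables (xi : Omega -> R) (s : R).
Hypothesis mxi : measurable_fun setT xi.
Hypothesis s0 : 0 < s.
Hypothesis xis : (\int[P]_w (expR (`|xi w| / s))%:E <= 2%:E)%E.

Let E1 w := expR (`|xi w| / s).
Let E2 w := expR (m w / 2).

Let mE1 : measurable_fun setT E1.
Proof.
apply: measurableT_comp => //; apply: measurable_funM => //.
exact: measurableT_comp.
Qed.

Let mE2 : measurable_fun setT E2.
Proof. by have := mexp 2^-1; under eq_fun do rewrite mulrC. Qed.

(** [xi] and [Z] may be dependent, so the product of their exponentials is split by AM-GM into the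
    sum [E1 + E2], each term of which has a known mean. The squares are traded for exponentials at
    costs 8 and 136, and [544 = 8 * 136 / 2]; the spare factor [exp (m / 8)] is left for the
    quadratic expansion. *)
Let dom_pointwise w : (xi w * Z w) ^+ 2 * expR (m w / 8) <=
  544 * (s ^+ 2 * (g + e) ^+ 2) * (E1 w + E2 w).
Proof.
have m0 : 0 <= m w by exact: bernstein_gauge_ge0.
set t := `|xi w| / s.
have t0 : 0 <= t by rewrite divr_ge0// ltW.
have xiE : xi w ^+ 2 = s ^+ 2 * t ^+ 2.
  by rewrite /t expr_div_n real_normK ?num_real// mulrC divfK// gt_eqF// exprn_gt0.
have t2 : t ^+ 2 <= 8 * expR (t / 2).
  by have := @sqr_le_expR R (t / 2); rewrite divr_ge0// => /(_ isT); lra.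
have Z2 : Z w ^+ 2 <= (g + e) ^+ 2 * (m w + m w ^+ 2).
  have ge2 : 0 <= g * e by rewrite mulr_ge0// ltW.
  have mm0 : 0 <= m w ^+ 2 by exact: sqr_ge0.
  have [mE|mE] : m w = Z w ^+ 2 / g ^+ 2 \/ m w = `|Z w| / e.
    by rewrite /m /bernstein_gauge; case: leP => _; [left|right].
  - have -> : Z w ^+ 2 = g ^+ 2 * m w.
      by rewrite mE mulrC divfK// gt_eqF// exprn_gt0.
    have := sqr_ge0 e; have := sqr_ge0 g; nra.
  - have -> : Z w ^+ 2 = e ^+ 2 * m w ^+ 2.
      by rewrite mE expr_div_n real_normK ?num_real// mulrC divfK// gt_eqF// exprn_gt0.
    have := sqr_ge0 e; have := sqr_ge0 g; nra.
have m8 : m w + m w ^+ 2 <= 136 * expR (m w / 8).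
  have := @sqr_le_expR R (m w / 8); rewrite divr_ge0// => /(_ isT).
  have := expR_ge1Dx (m w / 8); lra.
have e4 : expR (m w / 8) * expR (m w / 8) = expR (m w / 4) by rewrite -expRD; congr expR; lra.
have E1E : E1 w = expR (t / 2) ^+ 2 by rewrite -expRM_natr; congr expR; rewrite -/t; lra.
have E2E : E2 w = expR (m w / 4) ^+ 2 by rewrite -expRM_natr; congr expR; lra.
have amgm : expR (t / 2) * expR (m w / 4) <= (E1 w + E2 w) / 2.
  by rewrite E1E E2E; have := sqr_ge0 (expR (t / 2) - expR (m w / 4)); lra.
rewrite exprMn xiE.
apply: (@le_trans _ _ ((s ^+ 2 * (8 * expR (t / 2))) * ((g + e) ^+ 2 * (136 * expR (m w / 8))) * expR (m w / 8))).
  apply: ler_wpM2r; first exact: expR_ge0.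
  apply: ler_pM.
  - by rewrite mulr_ge0 ?sqr_ge0.
  - exact: sqr_ge0.
  - by rewrite ler_wpM2l ?sqr_ge0.
  - by apply: le_trans Z2 _; rewrite ler_wpM2l ?sqr_ge0.
rewrite [leLHS](_ : _ = 1088 * (s ^+ 2 * (g + e) ^+ 2) * (expR (t / 2) * expR (m w / 4))).
  have : 0 <= s ^+ 2 * (g + e) ^+ 2 by rewrite mulr_ge0// sqr_ge0.
  nra.
by rewrite -e4; ring.
Qed.

Let iE1 : P.-integrable setT (EFin \o E1).
Proof.
apply/integrableP; split; first exact/measurable_EFinP.
under eq_integral do rewrite /= ger0_norm ?expR_ge0//.
by apply: le_lt_trans xis _; rewrite ltry.
Qed.

Let iE2 : P.-integrable setT (EFin \o E2).
Proof.
apply/integrableP; split; first exact/measurable_EFinP.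
under eq_integral do rewrite /= ger0_norm ?expR_ge0//.
by apply: le_lt_trans integral_expR_gauge _; rewrite ltry.
Qed.

Let iE12 (c : R) : P.-integrable setT (fun w => (c%:E * (E1 w + E2 w)%:E)%E).
Proof. by apply: integrableZl => //; exact: (integrableD measurableT iE1 iE2). Qed.

Lemma integrable_mul_bernstein : P.-integrable setT (fun w => (xi w * Z w)%:E).
Proof.
pose c := s * (g + e).
have c0 : 0 < c by rewrite mulr_gt0// addr_gt0.
apply: (@le_integrable _ _ _ P _ measurableT _ (fun w => (544 * c + c)%:E * (E1 w + E2 w)%:E)%E).
- by apply/measurable_EFinP; exact: measurable_funM.
- move=> w _; rewrite -EFinM !abse_EFin lee_fin.
  have E12 : 0 <= E1 w + E2 w by apply: addr_ge0; exact: expR_ge0.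
  have cc0 : 0 <= 544 * c + c.
    by apply: addr_ge0 (ltW c0); apply: mulr_ge0 (ltW c0); rewrite ler0n.
  rewrite (ger0_norm (mulr_ge0 cc0 E12)).
  have D := dom_pointwise w.
  have m8 : 1 <= expR (m w / 8).
    have := expR_ge1Dx (m w / 8); have : 0 <= m w by exact: bernstein_gauge_ge0.
    lra.
  have E11 : 1 <= E1 w.
    have := expR_ge1Dx (`|xi w| / s); have : 0 <= `|xi w| / s by rewrite divr_ge0// ltW.
    by rewrite /E1; lra.
  have E20 : 0 <= E2 w by exact: expR_ge0.
  set z := xi w * Z w in D *.
  have zc : z ^+ 2 <= 544 * c ^+ 2 * (E1 w + E2 w).
    rewrite /c [(s * _) ^+ 2]exprMn; apply: (le_trans _ D); have := sqr_ge0 z; nra.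
  rewrite -(ler_pM2l c0); apply: (@le_trans _ _ (c ^+ 2 + z ^+ 2)).
    have := sqr_ge0 (c - `|z|); have := real_normK (num_real z).
    have := sqr_ge0 c; have := sqr_ge0 z; nra.
  have := sqr_ge0 c; nra.
- exact: iE12.
Qed.

Let c := fine (\int[P]_w (xi w * Z w)%:E).

(* The compensator [2 lam^2 xi^2 g^2] absorbs the Gaussian part of the tail of
   [Z] by AM-GM, and the truncation of [xi] absorbs its exponential part. *)
Lemma compensated_mgf (lam B : R) : 0 <= lam -> 8 * lam * B * e <= 1 ->
  (\int[P]_w (if `|xi w| <= B then
       expR (lam * (xi w * Z w) - 2 * lam ^+ 2 * xi w ^+ 2 * g ^+ 2) else 0)%:E
   <= (1 + lam * c + 7616 * lam ^+ 2 * (s ^+ 2 * (g + e) ^+ 2))%:E)%E.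
Proof.
move=> lam0 lamB.
pose K := 544 * lam ^+ 2 * (s ^+ 2 * (g + e) ^+ 2).
have K0 : 0 <= K by apply: mulr_ge0; apply: mulr_ge0; rewrite ?sqr_ge0 ?ler0n.
pose F w : \bar R := ((1%:E + lam%:E * (xi w * Z w)%:E) + K%:E * (E1 w + E2 w)%:E)%E.
have iF1 : P.-integrable setT (fun w => lam%:E * (xi w * Z w)%:E)%E.
  by apply: integrableZl => //; exact: integrable_mul_bernstein.
have i1 : P.-integrable setT (cst 1%:E).
  by apply: (finite_measure_integrable_cst P).
have iF12 : P.-integrable setT (fun w => 1%:E + lam%:E * (xi w * Z w)%:E)%E.
  exact: (integrableD measurableT i1 iF1).
have iF : P.-integrable setT F by exact: (integrableD measurableT iF12 (iE12 K)).
apply: (@le_trans _ _ (\int[P]_w F w)%E); last first.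
  rewrite /F (integralD measurableT iF12 (iE12 K)) (integralD measurableT i1 iF1).
  rewrite (integralZl measurableT integrable_mul_bernstein).
  rewrite (integralZl measurableT (integrableD measurableT iE1 iE2)).
  have -> : (\int[P]_x (E1 x + E2 x)%:E = \int[P]_x (E1 x)%:E + \int[P]_x (E2 x)%:E)%E.
    by rewrite -integralD.
  rewrite integral_cst//= probability_setT mule1.
  have -> : (\int[P]_x (xi x * Z x)%:E = c%:E)%E.
    by rewrite /c fineK// integrable_fin_num//; exact: integrable_mul_bernstein.
  rewrite EFinD; apply: leeD.
    by rewrite -EFinM -EFinD.
  (* [14 = 2 + 12] adds the exponential moments of [xi] and of the gauge, and [7616 = 544 * 14]. *)
  apply: (@le_trans _ _ (K%:E * 14%:E)%E).
    rewrite lee_wpmul2l ?lee_fin// (_ : 14 = 2 + 12); last by lra.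
    by rewrite EFinD leeD// integral_expR_gauge.
  by rewrite -EFinM lee_fin /K; lra.
apply: ge0_le_integral => //=.
- by move=> w _; rewrite lee_fin; case: ifP => // _; exact: expR_ge0.
- apply/measurable_EFinP; apply: measurable_fun_ifT => //.
    by apply: measurable_fun_ler => //; exact: measurableT_comp.
  apply: measurableT_comp => //; apply: measurable_funB.
    by apply: measurable_funM => //; exact: measurable_funM.
  apply: measurable_funM => //; apply: measurable_funM => //.
  exact: measurable_funX.
- by have /integrableP[] := iF.
move=> w _; rewrite /F -!EFinM -!EFinD lee_fin.
have m0 : 0 <= m w by exact: bernstein_gauge_ge0.
have D := dom_pointwise w.
set z := xi w * Z w in D *.
have base : 0 <= 1 + lam * z + (lam * z) ^+ 2.
  by have := sqr_ge0 (lam * z + 1 / 2); lra.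
have up q : q <= expR (m w / 8) -> (lam * z) ^+ 2 * q <= K * (E1 w + E2 w).
  move=> q1; apply: (@le_trans _ _ (lam ^+ 2 * (z ^+ 2 * expR (m w / 8)))).
    rewrite exprMn -mulrA ler_wpM2l ?sqr_ge0// ler_wpM2l ?sqr_ge0//.
  apply: le_trans (ler_wpM2l (sqr_ge0 lam) D) _.
  by rewrite /K; lra.
case: ifP => [xB|_]; last first.
  apply: le_trans base _; rewrite lerD2l -[leLHS]mulr1; apply: up.
  have := expR_ge1Dx (m w / 8); lra.
apply: (le_trans (@expR_sub_le_quadratic _ _ _ (m w / 8) _ _ _)).
- by rewrite mulr_ge0 ?sqr_ge0// mulr_ge0 ?sqr_ge0// mulr_ge0 ?sqr_ge0.
- by rewrite divr_ge0.
- have : lam * z <= (lam * `|xi w|) * `|Z w|.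
    by rewrite -mulrA -normrM ler_wpM2l// ler_norm.
  have l0 : 0 <= lam * `|xi w| by rewrite mulr_ge0.
  have lB : lam * `|xi w| <= lam * B by rewrite ler_wpM2l.
  have [mE|mE] : m w = Z w ^+ 2 / g ^+ 2 \/ m w = `|Z w| / e.
    by rewrite /m /bernstein_gauge; case: leP => _; [left|right].
  + set y := `|Z w| / g.
    have yE : `|Z w| = g * y by rewrite /y mulrC divfK// gt_eqF.
    have -> : m w = y ^+ 2 by rewrite mE /y expr_div_n real_normK ?num_real.
    have -> : 2 * lam ^+ 2 * xi w ^+ 2 * g ^+ 2 = 2 * (lam * `|xi w| * g) ^+ 2.
      by rewrite !exprMn real_normK ?num_real//; ring.
    rewrite yE; have := sqr_ge0 (lam * `|xi w| * g - y / 4); lra.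
  + have -> : m w / 8 = `|Z w| * (8 * e)^-1 by rewrite mE invfM; ring.
    have : lam * `|xi w| <= (8 * e)^-1.
      by rewrite -[leRHS]mul1r ler_pdivlMr ?mulr_gt0//; apply: le_trans lamB; have := ler_wpM2r (ltW e0) lB; lra.
    have := normr_ge0 (Z w).
    have : 0 <= 2 * lam ^+ 2 * xi w ^+ 2 * g ^+ 2.
      by rewrite mulr_ge0 ?sqr_ge0// mulr_ge0 ?sqr_ge0// mulr_ge0 ?sqr_ge0.
    nra.
- by rewrite lerD2l; exact: up.
Qed.

End Product.
End Gauge.
End BernsteinMoments.

Section SampleTails.
Context {R : realType} {d : measure_display} {Omega : measurableType d}.
Variable P : probability Omega R.

Lemma measurable_le_fun (f g : Omega -> R) : measurable_fun setT f ->
  measurable_fun setT g -> measurable [set w | f w <= g w].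
Proof.
move=> mf mg; rewrite (_ : [set _ | _] = (fun w => f w <= g w) @^-1` [set true]).
  by rewrite -[X in measurable X]setTI; exact: measurable_fun_ler.
by apply/seteqP; split.
Qed.

Lemma measurable_lt_fun (f g : Omega -> R) : measurable_fun setT f ->
  measurable_fun setT g -> measurable [set w | f w < g w].
Proof.
move=> mf mg; rewrite (_ : [set _ | _] = (fun w => f w < g w) @^-1` [set true]).
  by rewrite -[X in measurable X]setTI; exact: measurable_fun_ltr.
by apply/seteqP; split.
Qed.

Lemma markov_real (f : Omega -> R) (a M : R) : 0 < a -> (forall w, 0 <= f w) ->
  measurable_fun setT f -> (\int[P]_w (f w)%:E <= M%:E)%E ->
  (P [set w | (a <= f w)%R] <= (M / a)%:E)%E.
Proof.
move=> a0 f0 mf fM.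
have mEf : measurable_fun setT (EFin \o f) by exact/measurable_EFinP.
have := @le_integral_abse _ _ _ P _ measurableT _ a mEf a0.
rewrite setTI; under eq_integral do rewrite /= ger0_norm//.
rewrite (_ : [set x | _] = [set w | a <= f w]); last first.
  by apply/seteqP; split => w /=; rewrite lee_fin ger0_norm.
by move=> H; rewrite mulrC EFinM lee_pdivlMl//; exact: le_trans fM.
Qed.

Context {d' : measure_display} {T : measurableType d'} {n : nat}.
Variables (Z : 'I_n -> Omega -> T) (z : Omega -> T).
Hypothesis n0 : (0 < n)%N.
Hypothesis mZ : forall i, measurable_fun setT (Z i).
Hypothesis mz : measurable_fun setT z.
Hypothesis lawZ : forall i, same_law P (Z i) z.
Hypothesis indZ : mutually_independent P Z.

Variables (f : T -> R) (s : R).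
Hypothesis mf : measurable_fun setT f.
Hypothesis s0 : 0 < s.
Hypothesis fs : (\int[P]_w (expR (`|f (z w)| / s))%:E <= 2%:E)%E.

Let mfZ i : measurable_fun setT (fun w => f (Z i w)).
Proof. exact: measurableT_comp. Qed.

Let nr0 : 0 < n%:R :> R. Proof. by rewrite ltr0n. Qed.
Let sn : R := Num.sqrt n%:R.
Let sn0 : 0 < sn. Proof. by rewrite sqrtr_gt0. Qed.
Let sn2 : sn ^+ 2 = n%:R. Proof. by rewrite sqr_sqrtr// ltW. Qed.

(* [min (t ^ 2 / sqrt n) t] is quadratic for [t <= sqrt n] and has an
   exponential moment of size [1 + O(1 / sqrt n)]. *)
Lemma noise_energy_tail :
  (P [set w | (420 * n%:R * s ^+ 2 < \sum_i f (Z i w) ^+ 2)%R] <= (expR (- sn))%:E)%E.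
Proof.
pose h (t : T) : R := Num.min ((`|f t| / s) ^+ 2 / sn) (`|f t| / s).
have t0 t : 0 <= `|f t| / s by rewrite divr_ge0// ltW.
have h0 t : 0 <= h t by rewrite le_min t0 divr_ge0 ?sqr_ge0// ltW.
have mft : measurable_fun setT (fun t => `|f t| / s).
  by apply: measurable_funM => //; exact: measurableT_comp.
have mh : measurable_fun setT h.
  apply: measurable_minr => //; apply: measurable_funM => //.
  exact: measurable_funX.
pose G t := expR (h t / 4).
have G0 t : 0 <= G t by exact: expR_ge0.
have mG : measurable_fun setT G.
  by apply: measurableT_comp => //; exact: measurable_funM.
have GM : (\int[P]_w (G (z w))%:E <= (1 + 4 / sn)%:E)%E.
  apply: (@le_trans _ _ (\int[P]_w (1%:E + (2 / sn)%:E * (expR (`|f (z w)| / s))%:E))%E).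
    apply: ge0_le_integral => //=.
    - by move=> w _; rewrite lee_fin.
    - by apply/measurable_EFinP; exact: measurableT_comp mG mz.
    - apply: emeasurable_funD => //; apply: measurable_funeM.
      apply/measurable_EFinP; apply: measurableT_comp => //.
      exact: (measurableT_comp mft mz).
    move=> w _; rewrite -EFinM -EFinD lee_fin /G.
    set t := `|f (z w)| / s; have t00 : 0 <= t by exact: t0.
    have h00 := h0 (z w).
    have ht : h (z w) <= t ^+ 2 / sn by rewrite ge_min lexx.
    have ht' : h (z w) <= t by rewrite ge_min lexx orbT.
    have e1 : expR (h (z w) / 4) <= 1 + h (z w) / 4 * expR (h (z w) / 4).
      have := expR_ge1Dx (- (h (z w) / 4)); have := expRxMexpNx_1 (h (z w) / 4).
      have := expR_gt0 (h (z w) / 4); nra.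
    apply: le_trans e1 _; rewrite lerD2l.
    have e2 : expR (h (z w) / 4) <= expR (t / 4) by rewrite ler_expR; lra.
    have e3 : t ^+ 2 * expR (t / 4) <= 8 * expR t.
      have := @sqr_le_expR R (t / 2); rewrite divr_ge0// => /(_ isT) t2.
      have e4 : expR (t / 2) * expR (t / 4) <= expR t by rewrite -expRD ler_expR; lra.
      have := expR_gt0 (t / 4); nra.
    apply: (@le_trans _ _ (t ^+ 2 / sn / 4 * expR (t / 4))).
      apply: ler_pM; rewrite ?expR_ge0//; lra.
    have isn : 0 < sn^-1 by rewrite invr_gt0.
    nra.
  rewrite ge0_integralD//; last 2 first.
  - by move=> w _; rewrite -EFinM lee_fin mulr_ge0 ?expR_ge0// divr_ge0// ltW.
  - apply: measurable_funeM; apply/measurable_EFinP.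
    by apply: measurableT_comp => //; exact: (measurableT_comp mft mz).
  rewrite integral_cst//= probability_setT mule1 EFinD leeD2l//.
  rewrite ge0_integralZl_EFin//; last 2 first.
  - by apply/measurable_EFinP; apply: measurableT_comp => //; exact: (measurableT_comp mft mz).
  - by rewrite divr_ge0// ltW.
  apply: (@le_trans _ _ ((2 / sn)%:E * 2%:E)%E).
    by rewrite lee_wpmul2l// lee_fin divr_ge0// ltW.
  by rewrite -EFinM lee_fin; lra.
have := integral_prod_le mZ mz lawZ indZ G0 mG GM; rewrite -/G => prodG.
have prodG' : (\int[P]_w (\prod_i G (Z i w))%:E <= (expR (4 * sn))%:E)%E.
  apply: le_trans prodG _; rewrite lee_fin.
  apply: (@le_trans _ _ (expR (4 / sn) ^+ n)).
    apply: lerXn2r; rewrite ?nnegrE ?expR_ge0 ?expR_ge1Dx//.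
    by rewrite addr_ge0// divr_ge0// ltW.
  by rewrite -expRM_natr ler_expR -sn2 expr2 mulrA divfK ?gt_eqF.
have mprod : measurable_fun setT (fun w => \prod_i G (Z i w)).
  by apply: measurable_prod => i _; exact: (measurableT_comp mG (mZ i)).
(* The mean is at most [exp (4 sn)]; the level [exp (5 sn)] leaves exactly [exp (- sn)], and off the
   exceptional event the sum of the [h (Z i w)] is below [20 sn]. *)
have := @markov_real (fun w => \prod_i G (Z i w)) (expR (5 * sn)) _ (expR_gt0 _) _ mprod prodG'.
rewrite -expRB (_ : 4 * sn - 5 * sn = - sn); last by lra.
move=> /(_ _) H; apply: le_trans (H _); last by move=> w; exact: prodr_ge0.
apply: le_measure; rewrite ?inE.
- apply: measurable_lt_fun => //.
  by apply: measurable_sum => i; exact: measurable_funX.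
- exact: measurable_le_cst.
move=> w /=; apply: contraTT; rewrite -!ltNge -leNgt => lt5.
have sumh : \sum_i h (Z i w) <= 20 * sn.
  move: lt5; rewrite -expR_sum ltr_expR -mulr_suml; lra.
have hle i : h (Z i w) <= 20 * sn.
  apply: le_trans sumh; rewrite (bigD1 i)//= lerDl; exact: sumr_ge0.
(* In the quadratic regime [t ^ 2 = sn * h]. In the linear regime [t = h], and the bound on a single
   summand gives [t ^ 2 <= 20 sn * h]. Summation yields [400 n s ^ 2]. *)
have term i : f (Z i w) ^+ 2 <= s ^+ 2 * (20 * sn * h (Z i w)).
  have -> : f (Z i w) ^+ 2 = s ^+ 2 * (`|f (Z i w)| / s) ^+ 2.
    by rewrite expr_div_n real_normK ?num_real// mulrC divfK// gt_eqF// exprn_gt0.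
  rewrite ler_wpM2l ?sqr_ge0//; move: (hle i) (h0 (Z i w)) (t0 (Z i w)); rewrite /h.
  set t := `|f (Z i w)| / s; case: (leP (t ^+ 2 / sn) t) => ht H1 H2 H3.
    have -> : 20 * sn * (t ^+ 2 / sn) = 20 * t ^+ 2.
      by rewrite -mulrA; congr (_ * _); rewrite mulrC divfK ?gt_eqF.
    by have := sqr_ge0 t; lra.
  by nra.
apply: le_trans (ler_sum _ (fun i _ => term i)) _.
rewrite -!mulr_sumr; have s2 : 0 <= s ^+ 2 by exact: sqr_ge0.
have : sn * \sum_i h (Z i w) <= 20 * n%:R by rewrite -sn2; have := sn0; nra.
move=> /(ler_wpM2l s2); have : 0 <= s ^+ 2 * n%:R by rewrite mulr_ge0.
lra.
Qed.

Variables (k : T -> R) (g e : R).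
Hypothesis mk : measurable_fun setT k.
Hypothesis kT : bernstein_tail P (k \o z) g e.

Let c := fine (\int[P]_w (f (z w) * k (z w))%:E).

(** Chernoff's method for the product of the compensated factors. On the energy event no term is
    truncated and the compensators sum to at most [840 n lam^2 g^2 s^2]. With [lam * theta = 2 r]
    this and the second-order remainder together stay below [r], since
    [n lam^2 s^2 (g + e)^2 <= 4 r / 336^2], so [exp (- r)] remains. *)
Lemma multiplier_tail (r : R) : 0 <= r ->
  (P [set w | \sum_i f (Z i w) ^+ 2 <= 420 * n%:R * s ^+ 2 /\
     336 * s * sn * (Num.sqrt r * (g + e) + r * e) <=
       \sum_i f (Z i w) * k (Z i w) - n%:R * c]%R <= (expR (- r))%:E)%E.
Proof.
set Ev := [set w | _].
have mE : measurable Ev.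
  apply: measurableI.
    apply: measurable_le_fun => //.
    by apply: measurable_sum => i; exact: measurable_funX.
  apply: measurable_le_fun => //; apply: measurable_funB => //.
  apply: measurable_sum => i; apply: measurable_funM => //.
  exact: (measurableT_comp mk (mZ i)).
rewrite le_eqVlt => /orP[/eqP<-|r0].
  by rewrite oppr0 expR0 probability_le1.
have [_ g0 e0 _] := kT.
set D := Num.sqrt r * (g + e) + r * e; set theta := 336 * s * sn * D.
have D0 : 0 < D.
  rewrite addr_gt0// mulr_gt0// ?sqrtr_gt0//; exact: addr_gt0.
have th0 : 0 < theta by apply: mulr_gt0 D0; apply: mulr_gt0 sn0; apply: mulr_gt0 s0; rewrite ltr0n.
pose lam := 2 * r / theta.
have lam0 : 0 < lam by rewrite divr_gt0// mulr_gt0.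
(* [21 ^ 2] exceeds 420, so the energy event alone keeps every [|f (Z i w)|] below [B]. The constant
   336 is [2 * 8 * 21], which makes [8 * lam * B * e <= 1] hold for this [lam]. *)
pose B := 21 * sn * s.
have lamth : lam * theta = 2 * r by rewrite /lam divfK// gt_eqF.
have lamB : 8 * lam * B * e <= 1.
  have : lam * s * sn * D = r / 168 by move: lamth; rewrite /theta; lra.
  rewrite -(ler_pM2r D0) mul1r /B => E.
  have -> : 8 * lam * (21 * sn * s) * e * D = r * e by rewrite (_ : 8 * lam * (21 * sn * s) * e * D = 168 * e * (lam * s * sn * D)); [rewrite E; lra|ring].
  by rewrite /D lerDr mulr_ge0 ?sqrtr_ge0// ltW// addr_gt0.
pose G t := if `|f t| <= B then
       expR (lam * (f t * k t) - 2 * lam ^+ 2 * f t ^+ 2 * g ^+ 2) else 0.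
have G0 t : 0 <= G t by rewrite /G; case: ifP => // _; exact: expR_ge0.
have mG : measurable_fun setT G.
  apply: measurable_fun_ifT => //.
    by apply: measurable_fun_ler => //; exact: measurableT_comp.
  apply: measurableT_comp => //; apply: measurable_funB.
    by apply: measurable_funM => //; exact: measurable_funM.
  apply: measurable_funM => //; apply: measurable_funM => //.
  exact: measurable_funX.
pose M : R := 1 + lam * c + 7616 * lam ^+ 2 * (s ^+ 2 * (g + e) ^+ 2).
have GM : (\int[P]_w (G (z w))%:E <= M%:E)%E.
  exact: (compensated_mgf kT (measurableT_comp mf mz) s0 fs (ltW lam0) lamB).
have prodG := integral_prod_le mZ mz lawZ indZ G0 mG GM.
pose q := lam ^+ 2 * (s ^+ 2 * (g + e) ^+ 2).
have nq : n%:R * q <= 4 * r / 336 ^+ 2.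
  have : (lam * theta) ^+ 2 = 4 * r ^+ 2 by rewrite lamth; ring.
  have -> : (lam * theta) ^+ 2 = 336 ^+ 2 * (n%:R * (lam ^+ 2 * s ^+ 2)) * D ^+ 2.
    by rewrite -sn2 /theta; ring.
  have D2 : r * (g + e) ^+ 2 <= D ^+ 2.
    rewrite /D -{1}(sqr_sqrtr (ltW r0)) -exprMn lerXn2r ?nnegrE ?lerDl ?mulr_ge0 ?addr_ge0 ?mulr_ge0 ?sqrtr_ge0// ltW//.
    by rewrite addr_gt0.
  set L := n%:R * (lam ^+ 2 * s ^+ 2).
  have L0 : 0 <= L by rewrite mulr_ge0 ?ler0n// mulr_ge0 ?sqr_ge0.
  have -> : n%:R * q = L * (g + e) ^+ 2 by rewrite /q /L; ring.
  move=> E; rewrite -(ler_pM2l r0).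
  have := ler_wpM2l L0 D2; nra.
have prodG' : (\int[P]_w (\prod_i G (Z i w))%:E <=
    (expR (n%:R * (lam * c + 7616 * q)))%:E)%E.
  apply: le_trans prodG _; rewrite lee_fin mulrC expRM_natr.
  rewrite lerXn2r ?nnegrE ?expR_ge0//.
    rewrite -lee_fin; apply: le_trans GM; apply: integral_ge0 => w _.
    by rewrite lee_fin; exact: G0.
  apply: le_trans (expR_ge1Dx _); rewrite /M /q; lra.
have mprod : measurable_fun setT (fun w => \prod_i G (Z i w)).
  by apply: measurable_prod => i _; exact: (measurableT_comp mG (mZ i)).
pose a := lam * (theta + n%:R * c) - 2 * lam ^+ 2 * g ^+ 2 * (420 * n%:R * s ^+ 2).
have prod0 w : 0 <= \prod_i G (Z i w) by exact: prodr_ge0.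
have := @markov_real (fun w => \prod_i G (Z i w)) (expR a) _ (expR_gt0 _) prod0 mprod prodG'.
rewrite -expRB => H.
apply: (@le_trans _ _ (P [set w | (expR a <= \prod_i G (Z i w))%R])); last first.
  apply: le_trans H _; rewrite lee_fin ler_expR /a.
  have g2 : n%:R * (lam ^+ 2 * (s ^+ 2 * g ^+ 2)) <= n%:R * q.
    rewrite ler_wpM2l ?ler0n// ler_wpM2l ?sqr_ge0// ler_wpM2l ?sqr_ge0//.
    by rewrite lerXn2r ?nnegrE ?lerDl ?addr_ge0 ?(ltW g0) ?(ltW e0).
  move: lamth nq g2; lra.
apply: le_measure; rewrite ?inE.
- exact: mE.
- exact: measurable_le_cst.
move=> w /= [energy dev].
have small i : `|f (Z i w)| <= B.
  rewrite -(@ler_pXn2r _ 2)// ?nnegrE ?mulr_ge0 ?(ltW sn0) ?(ltW s0)//.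
  rewrite real_normK ?num_real//; apply: (@le_trans _ _ (\sum_i f (Z i w) ^+ 2)).
    by rewrite (bigD1 i)//= lerDl sumr_ge0// => j _; exact: sqr_ge0.
  apply: le_trans energy _; rewrite /B !exprMn sn2.
  have ns0 : 0 <= n%:R * s ^+ 2 by rewrite mulr_ge0 ?sqr_ge0.
  by rewrite -mulrA -[leRHS]mulrA ler_wpM2r// -natrX ler_nat.
rewrite (eq_bigr (fun i => expR (lam * (f (Z i w) * k (Z i w)) -
    2 * lam ^+ 2 * f (Z i w) ^+ 2 * g ^+ 2))); last by move=> i _; rewrite /G small.
rewrite -expR_sum ler_expR sumrB -mulr_sumr.
have -> : \sum_i 2 * lam ^+ 2 * f (Z i w) ^+ 2 * g ^+ 2 =
    2 * lam ^+ 2 * g ^+ 2 * \sum_i f (Z i w) ^+ 2.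
  by rewrite mulr_sumr; apply: eq_bigr => i _; ring.
rewrite /a; apply: lerB; first by rewrite ler_wpM2l ?(ltW lam0)// -lerBrDr; exact: dev.
by apply: ler_wpM2l => //; rewrite mulr_ge0 ?sqr_ge0// mulr_ge0 ?sqr_ge0.
Qed.

End SampleTails.

(** * Linear functionals and union bounds *)

Section Dot.
Context {R : realType} {p : nat}.
Implicit Types u v w : 'rV[R]_p.

Lemma dotDr u v w : dot u (v + w) = dot u v + dot u w.
Proof. by rewrite /dot -big_split/=; apply: eq_bigr => j _; rewrite mxE mulrDr. Qed.

Lemma dotZr u a v : dot u (a *: v) = a * dot u v.
Proof. by rewrite /dot mulr_sumr; apply: eq_bigr => j _; rewrite mxE mulrCA. Qed.

Lemma dotC u v : dot u v = dot v u.
Proof. by apply: eq_bigr => j _; rewrite mulrC. Qed.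

Lemma measurable_coord (j : 'I_p) :
  measurable_fun setT (fun x : borel_rV R p => (x : 'rV[R]_p) 0 j).
Proof.
apply: (measurability _ (RGenOpens.measurableE R)) => _ [_ [a [b ->] <-]].
rewrite setTI; apply: sub_sigma_algebra.
have /continuousP := @coord_continuous R 1 p 0 j.
by apply; exact: interval_open.
Qed.

Lemma measurable_dot v : measurable_fun setT (fun x : borel_rV R p => dot x v).
Proof.
apply: measurable_sum => j; apply: measurable_funM => //.
exact: measurable_coord.
Qed.

End Dot.

Section LinearFunctional.
Context {R : realType} {p : nat} (D : 'rV[R]_p -> R).
Hypothesis DD : forall u v, D (u + v) = D u + D v.
Hypothesis DZ : forall a v, D (a *: v) = a * D v.

Lemma linear_fun0 : D 0 = 0.
Proof. by rewrite -(scale0r 0) DZ mul0r. Qed.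

Lemma linear_fun_sum (I : Type) (r : seq I) (f : I -> 'rV[R]_p) :
  D (\sum_(i <- r) f i) = \sum_(i <- r) D (f i).
Proof.
elim: r => [|i r IH]; first by rewrite !big_nil linear_fun0.
by rewrite !big_cons DD IH.
Qed.

Lemma linear_fun_hull_le (S : set 'rV[R]_p) (M : R) v :
  (forall q, S q -> D q <= M) -> convex_hull S v -> D v <= M.
Proof.
move=> SM [m [a [s [Ss a0 a1 ->]]]]; rewrite linear_fun_sum.
apply: (@le_trans _ _ (\sum_(i < m) a i * M)); last by rewrite -mulr_suml a1 mul1r.
by apply: ler_sum => i _; rewrite DZ ler_wpM2l//; exact: SM.
Qed.

End LinearFunctional.

(** Finitely many members of a convex hull involve only finitely many points of [S]. Chaining those
    points is enough, because a linear functional on their hull is controlled by its values on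
    them. *)
Lemma finite_hull_points (R : realType) (p : nat) (S : set 'rV[R]_p)
    (vs : seq 'rV[R]_p) : (forall v, v \in vs -> convex_hull S v) ->
  exists2 pts : seq 'rV[R]_p, forall q, q \in pts -> S q &
    forall v, v \in vs -> convex_hull [set q | q \in pts] v.
Proof.
elim: vs => [|v vs IH] H; first by exists [::].
have [|pts Spts Hpts] := IH; first by move=> u uvs; apply: H; rewrite inE uvs orbT.
have [|m [a [s [Ss a0 a1 vE]]]] := H v; first by rewrite inE eqxx.
exists ([seq s i | i <- enum 'I_m] ++ pts).
  by move=> q; rewrite mem_cat => /orP[/mapP[i _ ->]//|/Spts].
move=> u; rewrite inE => /orP[/eqP->|/Hpts[k [c [r [rS c0 c1 uE]]]]].
  by exists m, a, s; split => // i /=; rewrite mem_cat map_f ?mem_enum.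
by exists k, c, r; split => // i /=; rewrite mem_cat; apply/orP; right; exact: rS.
Qed.

Section GaugeTail.
Context {R : realType} {d : measure_display} {Omega : measurableType d}.
Variable P : probability Omega R.
Context {p : nat} (x : {RV P >-> borel_rV R p}) (Ng Ne : 'rV[R]_p -> R).

Lemma measurable_dot_rv (v : 'rV[R]_p) : measurable_fun setT (fun w => dot (x w) v).
Proof. exact: (measurableT_comp (measurable_dot v) (measurable_funPT x)). Qed.

(** Enlarging both scales by [eta] only weakens the tail, and it removes the division by zero at
    vectors where a semi-norm vanishes. *)
Lemma generic_bernstein_tail (v : 'rV[R]_p) (eta : R) :
    seminorm Ng -> seminorm Ne -> generic_bernstein P x Ng Ne -> 0 < eta ->
  bernstein_tail P (fun w => dot (x w) v) (Ng v + eta) (Ne v + eta).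
Proof.
move=> [Ng0 _ _] [Ne0 _ _] HB eta0.
have g0 : 0 < Ng v + eta by rewrite ltr_wpDl.
have e0 : 0 < Ne v + eta by rewrite ltr_wpDl.
split => //; first exact: measurable_dot_rv.
move=> s s0; apply: le_trans (HB v s s0) _.
rewrite -[(2 * _)%:E]/(2%:E * (expR _)%:E)%E lee_pmul2l//.
rewrite -[(expR _)%:E]/(expeR (- bernstein_gauge _ _ s)%:E) lee_expeR EFinN leeN2.
have div_le (a r r' : R) : 0 <= a -> 0 <= r -> 0 < r' -> r <= r' ->
    ((a / r')%:E <= a%:E / r%:E)%E.
  move=> a0 r0 r'0 rr'; rewrite inver; case: eqP => [_|/eqP rn0].
    move: a0; rewrite le_eqVlt => /orP[/eqP<-|a0].
      by rewrite mul0r mul0e.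
    by rewrite gt0_muley ?leey.
  rewrite -EFinM lee_fin ler_wpM2l// lef_pV2 ?posrE//.
  by rewrite lt_neqAle eq_sym rn0.
case: (leP ((s ^+ 2)%:E / (Ng v ^+ 2)%:E)%E (s%:E / (Ne v)%:E)%E) => _.
  apply: le_trans (div_le _ _ ((Ng v + eta) ^+ 2) _ _ _ _) => //.
  - by rewrite lee_fin /bernstein_gauge ge_min lexx.
  - exact: sqr_ge0.
  - exact: sqr_ge0.
  - by rewrite exprn_gt0.
  - by rewrite lerXn2r ?nnegrE ?lerDl ?(ltW eta0)// ltW.
apply: le_trans (div_le _ _ (Ne v + eta) _ _ _ _) => //.
  by rewrite lee_fin /bernstein_gauge ge_min ger0_norm// lexx orbT.
by rewrite lerDl ltW.
Qed.

End GaugeTail.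

Section UnionBound.
Context {R : realType} {d : measure_display} {Omega : measurableType d}.
Variable P : probability Omega R.

Lemma union_bound_seq (I : eqType) (r : seq I) (A : I -> set Omega) (c : R) :
    (forall i, i \in r -> measurable (A i)) ->
    (forall i, i \in r -> (P (A i) <= c%:E)%E) ->
  measurable [set w | exists2 i, i \in r & A i w] /\
  (P [set w | exists2 i, i \in r & A i w] <= ((size r)%:R * c)%:E)%E.
Proof.
elim: r => [|i r IH] mA PA.
  rewrite (_ : [set w | _] = set0); first by rewrite mul0r measure0.
  by apply/seteqP; split => // w [].
have [mr Pr] : measurable [set w | exists2 i, i \in r & A i w] /\
    (P [set w | exists2 i, i \in r & A i w] <= ((size r)%:R * c)%:E)%E.
  by apply: IH => j jr; [apply: mA|apply: PA]; rewrite inE jr orbT.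
have ii : i \in i :: r by rewrite inE eqxx.
rewrite (_ : [set w | _] = A i `|` [set w | exists2 i, i \in r & A i w]); last first.
  apply/seteqP; split => w /=.
    by move=> [j]; rewrite inE => /orP[/eqP->|jr Aj]; [left|right; exists j].
  by move=> [Ai|[j jr Aj]]; [exists i|exists j => //; rewrite inE jr orbT].
split; first by apply: measurableU => //; exact: mA.
rewrite -[(size _)]/((size r).+1) -natr1 mulrDl mul1r addrC EFinD.
have mi : measurable (A i) by exact: mA.
by apply: (le_trans (measureU2 P mi mr)); apply: leeD => //; exact: PA.
Qed.

Lemma union_bound_ord (M : nat) (A : nat -> set Omega) (c : nat -> R) :
    (forall k, (k < M)%N -> measurable (A k)) ->
    (forall k, (k < M)%N -> (P (A k) <= (c k)%:E)%E) ->
  measurable [set w | exists2 k, (k < M)%N & A k w] /\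
  (P [set w | exists2 k, (k < M)%N & A k w] <= (\sum_(k < M) c k)%:E)%E.
Proof.
elim: M => [|M IH] mA PA.
  rewrite (_ : [set w | _] = set0); first by rewrite big_ord0 measure0.
  by apply/seteqP; split => // w [].
have [|k kM|mr Pr] := IH; [by move=> k kM; apply: mA; exact: ltnW|
  by apply: PA; exact: ltnW|].
rewrite (_ : [set w | _] = [set w | exists2 k, (k < M)%N & A k w] `|` A M); last first.
  apply/seteqP; split => w /=.
    by move=> [j]; rewrite ltnS leq_eqVlt => /orP[/eqP->|jr Aj]; [right|left; exists j].
  by move=> [[j jr Aj]|Ai]; [exists j => //; exact: ltnW|exists M].
split; first by apply: measurableU => //; exact: mA.
rewrite big_ord_recr/= EFinD.
have mM : measurable (A M) by exact: mA.
by apply: (le_trans (measureU2 P mr mM)); apply: leeD => //; exact: PA.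
Qed.

(** [2 ^ k >= k + 1] leaves a geometric series of ratio [exp (- 1) <= 1 / 2]. *)
Lemma doubly_exponential_sum (a : R) M : 1 <= a ->
  \sum_(k < M) expR (- (a * 2 ^+ k)) <= 2 * expR (- a).
Proof.
move=> a1.
have term k : expR (- (a * 2 ^+ k)) <= expR (- a) * (1 / 2) ^+ k.
  have k2 : k%:R + 1 <= 2 ^+ k :> R.
    by rewrite natr1 -natrX ler_nat ltn_expl.
  apply: (@le_trans _ _ (expR (- a) * expR (- 1) ^+ k)).
    rewrite -expRM_natr -expRD ler_expR.
    have : 0 <= k%:R :> R by rewrite ler0n.
    nra.
  rewrite ler_wpM2l ?expR_ge0// lerXn2r ?nnegrE ?expR_ge0//.
  have := expR_ge1Dx (1 : R); have := expRxMexpNx_1 (1 : R).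
  have := expR_gt0 (- 1 : R); nra.
apply: (@le_trans _ _ (\sum_(k < M) expR (- a) * (1 / 2) ^+ k)).
  by apply: ler_sum => k _; exact: term.
rewrite -mulr_sumr.
rewrite mulrC ler_wpM2r ?expR_ge0//.
have -> : \sum_(k < M) (1 / 2) ^+ k = 2 * (1 - (1 / 2) ^+ M) :> R.
  elim: M => [|M IH]; first by rewrite big_ord0 expr0 subrr mulr0.
  by rewrite big_ord_recr/= IH exprS; lra.
have : 0 <= (1 / 2) ^+ M :> R by rewrite exprn_ge0// divr_ge0.
lra.
Qed.

Lemma link_count_le (k : nat) : (2 ^ (6 * 2 ^ k))%:R <= expR (6 * 2 ^+ k) :> R.
Proof.
have -> : 6 * 2 ^+ k = 1 * (6 * 2 ^ k)%:R :> R by rewrite natrM natrX mul1r.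
rewrite expRM_natr natrX; apply: lerXn2r; rewrite ?nnegrE ?expR_ge0//.
by have := expR_ge1Dx (1 : R); lra.
Qed.

End UnionBound.

(** * The multiplier process *)

Lemma powR2_half (R : realType) (k : nat) : Num.sqrt (2 ^+ k) = 2 `^ (k%:R / 2%:R) :> R.
Proof. by rewrite powRrM powR12_sqrt ?powR_ge0// powR_mulrn. Qed.

Section Multiplier.
Context {R : realType} {d : measure_display} {Omega : measurableType d}.
Variable P : probability Omega R.
Context {p n : nat} (x : {RV P >-> borel_rV R p}) (y : {RV P >-> R}).
Variables (X : 'I_n -> {RV P >-> borel_rV R p}) (Y : 'I_n -> {RV P >-> R}).
Variables (Ng Ne : 'rV[R]_p -> R) (b : 'rV[R]_p) (s : R).
Hypothesis n0 : (0 < n)%N.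
Hypothesis sNg : seminorm Ng.
Hypothesis sNe : seminorm Ne.
Hypothesis HB : generic_bernstein P x Ng Ne.
Hypothesis lawXY : forall i, same_law P (fun w => (X i w, Y i w)) (fun w => (x w, y w)).
Hypothesis indXY : mutually_independent P (fun i w => (X i w, Y i w)).
Hypothesis s0 : 0 < s.
Hypothesis ys : (\int[P]_w (expR (`|y w - dot (x w) b| / s))%:E <= 2%:E)%E.

Let T : measurableType _ := (borel_rV R p * R)%type.
Let z w : T := (x w, y w).
Let Z i w : T := (X i w, Y i w).

Let mz : measurable_fun setT z.
Proof. by apply: measurable_fun_pair; exact: measurable_funPT. Qed.

Let mZ i : measurable_fun setT (Z i).
Proof. by apply: measurable_fun_pair; exact: measurable_funPT. Qed.

Definition resid (t : borel_rV R p * R) : R := t.2 - dot t.1 b.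

Lemma measurable_lin v : measurable_fun setT (fun t : borel_rV R p * R => dot t.1 v).
Proof. exact: measurableT_comp (measurable_dot v) measurable_fst. Qed.

Lemma measurable_resid : measurable_fun setT resid.
Proof. by apply: measurable_funB; [exact: measurable_snd|exact: measurable_lin]. Qed.

Definition energy w : R := \sum_i (Y i w - dot (X i w) b) ^+ 2.

Definition covar v : R := fine (\int[P]_w ((y w - dot (x w) b) * dot (x w) v)%:E).

Definition dev v w : R :=
  \sum_i (Y i w - dot (X i w) b) * dot (X i w) v - n%:R * covar v.

Lemma integrable_resid_dot v :
  P.-integrable setT (fun w => ((y w - dot (x w) b) * dot (x w) v)%:E).
Proof.
apply: integrable_mul_bernstein s0 ys.
- exact: generic_bernstein_tail v 1 sNg sNe HB ltr01.
- exact: measurableT_comp measurable_resid mz.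
Qed.

Lemma covarD u v : covar (u + v) = covar u + covar v.
Proof.
rewrite /covar.
under eq_integral do rewrite dotDr mulrDr EFinD.
rewrite integralD//; try exact: integrable_resid_dot.
by rewrite fineD// integrable_fin_num//; exact: integrable_resid_dot.
Qed.

Lemma covarZ a v : covar (a *: v) = a * covar v.
Proof.
rewrite /covar.
under eq_integral do rewrite dotZr mulrCA EFinM.
rewrite integralZl//; last exact: integrable_resid_dot.
by rewrite fineM// integrable_fin_num//; exact: integrable_resid_dot.
Qed.

Lemma devD w u v : dev (u + v) w = dev u w + dev v w.
Proof.
rewrite /dev covarD; under eq_bigr do rewrite dotDr mulrDr.
by rewrite big_split/=; ring.
Qed.

Lemma devZ w a v : dev (a *: v) w = a * dev v w.
Proof.
rewrite /dev covarZ mulrBr mulr_sumr.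
by under eq_bigr do rewrite dotZr mulrCA; congr (_ - _); ring.
Qed.

Lemma measurable_energy : measurable_fun setT energy.
Proof.
apply: measurable_sum => i; apply: measurable_funX.
exact: measurableT_comp measurable_resid (mZ i).
Qed.

Lemma measurable_dev v : measurable_fun setT (dev v).
Proof.
apply: measurable_funB => //; apply: measurable_sum => i; apply: measurable_funM.
  exact: measurableT_comp measurable_resid (mZ i).
exact: measurableT_comp (measurable_lin v) (mZ i).
Qed.

Lemma energy_tail :
  (P [set w | (420 * n%:R * s ^+ 2 < energy w)%R] <= (expR (- Num.sqrt n%:R))%:E)%E.
Proof. exact: (noise_energy_tail n0 mZ mz lawXY indXY measurable_resid s0 ys). Qed.

Let sn : R := Num.sqrt n%:R.
Let sn0 : 0 < sn. Proof. by rewrite sqrtr_gt0 ltr0n. Qed.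

Let theta (eta r : R) l := 336 * s * sn *
  (Num.sqrt r * ((Ng l + eta) + (Ne l + eta)) + r * (Ne l + eta)).

Lemma dev_tail l eta r : 0 < eta -> 0 <= r ->
  (P [set w | energy w <= 420 * n%:R * s ^+ 2 /\ theta eta r l <= dev l w]%R <=
   (expR (- r))%:E)%E.
Proof.
move=> eta0 r0.
exact: (multiplier_tail n0 mZ mz lawXY indXY measurable_resid s0 ys
  (measurable_lin l) (generic_bernstein_tail l sNg sNe HB eta0) r0).
Qed.

(** Links of level [k] are tested at confidence [r = v * 2 ^ k], which beats their number
    [exp (6 * 2 ^ k)] once [7 <= v]. If all tests succeed, every point is within half the claimed
    bound of the base point, and so is 0; this doubling turns 336 into 672. *)
Lemma multiplier_sup (S : set 'rV[R]_p) (A B : nat -> set (set 'rV[R]_p))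
    (G1 G2 v eps : R) (vs : seq 'rV[R]_p) :
    admissible S A -> admissible S B ->
    (forall q, S q -> (\sum_(0 <= k <oo) (2 `^ (k%:R / 1%:R))%:E *
       diameter (fun u v => Ne (u - v)%R) (pblock (A k) id q) <= G1%:E)%E) ->
    (forall q, S q -> (\sum_(0 <= k <oo) (2 `^ (k%:R / 2%:R))%:E *
       diameter (fun u v => Ng (u - v)%R) (pblock (B k) id q) <= G2%:E)%E) ->
    7 <= v -> 0 < eps -> convex_hull S 0 ->
    (forall q, q \in vs -> convex_hull S q) ->
  (P [set w | (energy w <= 420 * n%:R * s ^+ 2)%R /\ exists2 q, q \in vs &
      (672 * s * sn * v * (2 * G1 + G2) + eps < dev q w)%R] <=
    (4 * expR (6 - v))%:E)%E.
Proof.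
move=> admA admB HA HB' v7 eps0 S0 Svs.
have [|pts Spts Hpts] := @finite_hull_points _ _ S (0 :: vs).
  by move=> q; rewrite inE => /orP[/eqP->//|]; exact: Svs.
pose pt (j : 'I_(size pts)) := nth 0 pts j.
have Spt j : S (pt j) by apply: Spts; exact: mem_nth.
have [M [s1 [L [w [Lsize wL ptE sum1 sum2]]]]] :=
  chaining_links sNe sNg admA admB HA HB' Spt.
have [Ng0 NgZ NgT] := sNg; have [Ne0 NeZ NeT] := sNe.
pose rk k : R := v * 2 ^+ k.
have v0 : 0 < v by lra.
have rk0 k : 0 <= rk k by rewrite mulr_ge0 ?(ltW v0)// exprn_ge0.
pose Kc := \sum_(k < M) (2 * Num.sqrt (rk k) + rk k).
have Kc0 : 0 <= Kc by apply: sumr_ge0 => k _; rewrite addr_ge0// mulr_ge0 ?sqrtr_ge0.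
have [cc cc0 [cE cE']] : exists2 cc, 0 < cc & 336 * s * sn = cc /\ 672 * s * sn = 2 * cc.
  exists (336 * s * sn); last by split => //; ring.
  by apply: mulr_gt0 sn0; apply: mulr_gt0 s0; rewrite ltr0n.
rewrite cE'.
have Kc1 : 0 < Kc + 1 by lra.
(* Chosen after the links: [Kc] is the total weight with which [eta] enters along a chain, so
   regularizing the scales costs at most [eps / 2] per chain. *)
pose eta := eps / (2 * cc * (Kc + 1)).
have eta0 : 0 < eta by apply: divr_gt0 => //; apply: mulr_gt0 => //; apply: mulr_gt0.
(* Both signs of a link are tested, so that by linearity the absolute value of the increment is
   bounded. *)
pose LL k := L k ++ [seq - l | l <- L k].
pose bad k l := [set w | (energy w <= 420 * n%:R * s ^+ 2)%R /\
  (theta eta (rk k) l <= dev l w)%R].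
have mbad k l : measurable (bad k l).
  apply: measurableI; first by apply: measurable_le_fun => //; exact: measurable_energy.
  by apply: measurable_le_fun => //; exact: measurable_dev.
pose badk k := [set w | exists2 l, l \in LL k & bad k l w].
have Pbad k l : (P (bad k l) <= (expR (- rk k))%:E)%E by exact: dev_tail.
have LLsize k : (size (LL k))%:R <= 2 * expR (6 * 2 ^+ k) :> R.
  rewrite size_cat size_map addnn -mul2n natrM ler_pM2l//.
  by apply: (@le_trans _ _ (2 ^ (6 * 2 ^ k))%:R); [rewrite ler_nat|exact: link_count_le].
have mbadk k : measurable (badk k).
  by have [] := union_bound_seq (fun l _ => mbad k l) (fun l (_ : l \in LL k) => Pbad k l).
have Pbadk k : (P (badk k) <= (2 * expR (- ((v - 6) * 2 ^+ k)))%:E)%E.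
  have [_ h] := union_bound_seq (fun l _ => mbad k l) (fun l (_ : l \in LL k) => Pbad k l).
  apply: le_trans h _; rewrite lee_fin.
  apply: (@le_trans _ _ (2 * expR (6 * 2 ^+ k) * expR (- rk k))).
    by rewrite ler_wpM2r ?expR_ge0.
  rewrite -mulrA -expRD /rk (_ : 6 * _ - _ = - ((v - 6) * 2 ^+ k))//.
  ring.
have [mU PU] := union_bound_ord (fun k (_ : (k < M)%N) => mbadk k) (fun k _ => Pbadk k).
have tail : \sum_(k < M) 2 * expR (- ((v - 6) * 2 ^+ k)) <= 4 * expR (6 - v).
  rewrite -mulr_sumr; apply: (@le_trans _ _ (2 * (2 * expR (- (v - 6))))).
    by rewrite ler_wpM2l// doubly_exponential_sum//; lra.
  by rewrite opprB; lra.
apply: (@le_trans _ _ (P [set w | exists2 k, (k < M)%N & badk k w])); last first.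
  by apply: le_trans PU _; rewrite lee_fin.
apply: le_measure; rewrite ?inE//.
  apply: measurableI; first by apply: measurable_le_fun => //; exact: measurable_energy.
  have mlt q : measurable [set w | (2 * cc * v * (2 * G1 + G2) + eps < dev q w)%R].
    by apply: measurable_lt_fun => //; exact: measurable_dev.
  by have [] := union_bound_seq (fun q (_ : q \in vs) => mlt q)
    (fun q _ => probability_le1 P (mlt q)).
move=> w0 [en [q qvs qdev]]; apply: contrapT => good.
have link k l : (k < M)%N -> l \in LL k -> dev l w0 <= theta eta (rk k) l.
  move=> kM lL; rewrite leNgt; apply/negP => lt; apply: good; exists k => //; exists l => //.
  by split => //; exact: ltW.
clear en.
pose D l := dev l w0.
have DD u1 u2 : D (u1 + u2) = D u1 + D u2 by exact: devD.
have DZ a u1 : D (a *: u1) = a * D u1 by exact: devZ.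
have D0 : D 0 = 0 by exact: linear_fun0.
have DN l : D (- l) = - D l by rewrite -scaleN1r DZ mulN1r.
pose TT := cc * v * (2 * G1 + G2) + eps / 2.
have sumtheta j : \sum_(k < M) theta eta (rk k) (w j k) <= TT.
  have th k : theta eta (rk k) (w j k) = cc *
      (Num.sqrt v * (2 `^ (k%:R / 2%:R) * Ng (w j k)) +
       Num.sqrt v * (2 `^ (k%:R / 2%:R) * Ne (w j k)) +
       v * (2 `^ (k%:R / 1%:R) * Ne (w j k)) +
       eta * (2 * Num.sqrt (rk k) + rk k)).
    rewrite /theta cE divr1 powR_mulrn// /rk sqrtrM ?(ltW v0)// powR2_half; ring.
  under eq_bigr do rewrite th.
  clear th cE cE'.
  rewrite -mulr_sumr !big_split/= -!mulr_sumr -/Kc.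
  have sv : Num.sqrt v <= v.
    have := sqr_sqrtr (ltW v0); have : 1 <= Num.sqrt v.
      by rewrite -sqrtr1 ler_wsqrtr//; lra.
    nra.
  have sv0 : 0 <= Num.sqrt v by exact: sqrtr_ge0.
  set a1 := \sum_(k < M) 2 `^ (k%:R / 2%:R) * Ng (w j k).
  set a2 := \sum_(k < M) 2 `^ (k%:R / 2%:R) * Ne (w j k).
  set a3 := \sum_(k < M) 2 `^ (k%:R / 1%:R) * Ne (w j k).
  have a10 : 0 <= a1 by apply: sumr_ge0 => k _; rewrite mulr_ge0 ?powR_ge0.
  have a20 : 0 <= a2 by apply: sumr_ge0 => k _; rewrite mulr_ge0 ?powR_ge0.
  have a30 : 0 <= a3 by apply: sumr_ge0 => k _; rewrite mulr_ge0 ?powR_ge0.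
  have a1G : a1 <= G2 by exact: sum2.
  have a3G : a3 <= G1 by exact: sum1.
  (* The Gaussian contribution of [Ne] carries the weight [2 ^ (k / 2)], which the exponential
     weight [2 ^ k] dominates; hence no [gamma_2] of [Ne] is required. *)
  have a23 : a2 <= a3.
    apply: ler_sum => k _; rewrite ler_wpM2r// ler_powR ?ler1n// ler_wpM2l//.
    by rewrite lef_pV2 ?posrE// ler_nat.
  have etaK : cc * (eta * Kc) <= eps / 2.
    have -> : cc * (eta * Kc) = eps / 2 * (Kc / (Kc + 1)).
      by rewrite /eta; field; rewrite !gt_eqF.
    by rewrite ger_pMr ?divr_gt0// ler_pdivrMr// mul1r lerDl.
  have c1 : 0 <= cc by exact: ltW.
  rewrite /TT.
  rewrite mulrDr; apply: lerD => //; rewrite -mulrA ler_wpM2l//.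
  have : Num.sqrt v * a1 <= v * G2 by exact: ler_pM.
  have : Num.sqrt v * a2 <= v * G1 by apply: ler_pM => //; exact: le_trans a3G.
  have : v * a3 <= v * G1 by rewrite ler_wpM2l// ltW.
  lra.
clear cE cE'.
have ptle j : `|D (pt j - s1)| <= TT.
  have -> : pt j - s1 = \sum_(k < M) w j k by rewrite ptE addrC addKr.
  rewrite (linear_fun_sum DD DZ); apply: le_trans (ler_norm_sum _ _ _) _.
  apply: le_trans (sumtheta j); apply: ler_sum => k _.
  have wk := wL j k (ltn_ord k).
  rewrite ler_norml; apply/andP; split.
    rewrite lerNl -DN (_ : theta _ _ _ = theta eta (rk k) (- w j k)).
      by apply: link => //; rewrite mem_cat map_f ?orbT.
    by rewrite /theta -scaleN1r NgZ NeZ normrN1 !mul1r.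
  by apply: link => //; rewrite mem_cat wk.
have ptP r0 : r0 \in pts -> exists j, r0 = pt j.
  move=> /(nthP 0)[i isz <-]; by exists (Ordinal isz).
have Dq : D q <= D s1 + TT.
  apply: (linear_fun_hull_le DD DZ) (Hpts q _); last by rewrite inE qvs orbT.
  move=> r0 /ptP[j ->]; have /ler_normlP[_] := ptle j.
  by rewrite DD DN lerBlDl.
(* The base point has no bound of its own. It is compared with 0, a point of the hull at which [D]
   vanishes. *)
have Ds1 : D s1 <= TT.
  have : - D 0 <= TT - D s1.
    apply: (@linear_fun_hull_le R p (fun l => - D l) _ _ _ _ 0 _ (Hpts 0 _)).
    - by move=> u1 u2; rewrite DD opprD.
    - by move=> a u1; rewrite DZ mulrN.
    - move=> r0 /ptP[j ->]; have /ler_normlP[+ _] := ptle j.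
      by rewrite DD DN opprB lerBrDr [- _ + _]addrC.
    - by rewrite inE eqxx.
  by rewrite D0 oppr0 subr_ge0.
have : 2 * cc * v * (2 * G1 + G2) + eps < D q by exact: qdev.
by rewrite /TT in Dq Ds1; lra.
Qed.

End Multiplier.

(** * The small-ball method *)

Section SmallBallFinite.
Context {R : realType} {I : finType} (law : I -> R) {p : nat} (a : I -> 'rV[R]_p).
Hypothesis law_ge0 : forall c, 0 <= law c.
Hypothesis law_sum1 : \sum_c law c = 1.
Context {F : finType} (v0 : F) (vv : F -> 'rV[R]_p).

Let D (l : seq (I * bool)) (v : 'rV[R]_p) : R :=
  \sum_(ae <- l) (-1) ^+ ae.2 * dot (a ae.1) v.

Let DD l u v : D l (u + v) = D l u + D l v.
Proof. by rewrite /D -big_split/=; apply: eq_bigr => ae _; rewrite dotDr mulrDr. Qed.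

Let DZ l c v : D l (c *: v) = c * D l v.
Proof. by rewrite /D mulr_sumr; apply: eq_bigr => ae _; rewrite dotZr mulrCA. Qed.

Lemma rademacher_mgf n (lam : R) v :
  Ex (rade law) n (fun l => expR (lam * D l v)) =
  (\sum_c law c * ((expR (lam * dot (a c) v) + expR (- (lam * dot (a c) v))) / 2)) ^+ n.
Proof.
transitivity (Ex (rade law) n (fun l => \prod_(ae <- l)
    expR (lam * ((-1) ^+ ae.2 * dot (a ae.1) v)))).
  by apply: eq_Ex => l _; rewrite /D mulr_sumr expR_sum.
rewrite Ex_prod sum_rade; congr (_ ^+ n); apply: eq_bigr => c _.
by rewrite /= expr0 mul1r expr1 mulN1r mulrN.
Qed.

Context (n M : nat) (pts : seq 'rV[R]_p) (s1 : 'rV[R]_p) (L : nat -> seq 'rV[R]_p).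
Context (w : 'I_(size pts) -> nat -> 'rV[R]_p) (theta : nat -> 'rV[R]_p -> R) (Theta : R).
Hypothesis vv_hull : forall v, convex_hull [set q | q \in pts] (vv v).
Hypothesis L_size : forall k, (size (L k) <= 2 ^ (6 * 2 ^ k))%N.
Hypothesis wL : forall j k, (k < M)%N -> w j k \in L k.
Hypothesis ptsE : forall j : 'I_(size pts), nth 0 pts j = s1 + \sum_(k < M) w j k.
Hypothesis theta_gt0 : forall k q, 0 < theta k q.
Hypothesis theta_sum : forall j, \sum_(k < M) theta k (w j k) <= Theta.
Hypothesis link_mgf : forall k q, (k < M)%N -> q \in L k ->
  let lam := 2 ^+ k / theta k q in
  (\sum_c law c * ((expR (lam * dot (a c) q) + expR (- (lam * dot (a c) q))) / 2)) ^+ n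
    <= expR (2 * 2 ^+ k).

Let excess l : R := \sum_(k < M) \sum_(q <- L k)
  expR (2 ^+ k / theta k q * D l q - 10 * 2 ^+ k).

Let pts_nonempty : (0 < size pts)%N.
Proof.
have [m [c [s [Ss c0 c1 _]]]] := vv_hull v0.
case: m c s Ss c0 c1 => [|m] c s Ss _ c1; first by move: c1; rewrite big_ord0 => /esym/eqP; rewrite oner_eq0.
by have := Ss ord0; rewrite /mkset; case: (pts).
Qed.

Let Theta_ge0 : 0 <= Theta.
Proof.
apply: le_trans (theta_sum (Ordinal pts_nonempty)).
by apply: sumr_ge0 => k _; exact: ltW.
Qed.

(** [y + 1 <= exp y] at [y = 2 ^ k (D / theta - 10)] bounds a normalized link by 10 plus its own
    exponential excess. Adding the excesses of all listed links gives a random bound whose mean is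
    computed directly, so no tail has to be integrated. *)
Lemma chaining_pathwise l v : D l (vv v) <= D l s1 + Theta * (10 + excess l).
Proof.
apply: (linear_fun_hull_le (DD l) (DZ l)) (vv_hull v) => q /(nthP 0)[i isz <-].
pose j := Ordinal isz.
rewrite (ptsE j) DD lerD2l (linear_fun_sum (DD l) (DZ l)).
apply: (@le_trans _ _ (\sum_(k < M) (theta k (w j k) * 10 + Theta *
    \sum_(r <- L k) expR (2 ^+ k / theta k r * D l r - 10 * 2 ^+ k)))); last first.
  rewrite big_split/= mulrDr; apply: lerD; first by rewrite -mulr_suml ler_wpM2r.
  by rewrite -mulr_sumr.
apply: ler_sum => k _; set r := w j k.
have rL : r \in L k := wL j (ltn_ord k).
have th0 := theta_gt0 k r.
have thT : theta k r <= Theta.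
  apply: le_trans (theta_sum j); rewrite (bigD1 k)//= lerDl.
  by apply: sumr_ge0 => i0 _; exact: ltW.
have two1 : 1 <= 2 ^+ k :> R by rewrite exprn_ege1// ler1n.
set E := expR (2 ^+ k / theta k r * D l r - 10 * 2 ^+ k).
have E0 : 0 < E by exact: expR_gt0.
have ErL : E <= \sum_(q <- L k) expR (2 ^+ k / theta k q * D l q - 10 * 2 ^+ k).
  rewrite (big_rem r)//= lerDl; apply: sumr_ge0 => q0 _; exact: expR_ge0.
have rat : D l r / theta k r <= 10 + E.
  have : 2 ^+ k * (D l r / theta k r - 10) <= E.
    rewrite (_ : _ * _ = 2 ^+ k / theta k r * D l r - 10 * 2 ^+ k); last by ring.
    by have := expR_ge1Dx (2 ^+ k / theta k r * D l r - 10 * 2 ^+ k); rewrite -/E; lra.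
  case: (leP (D l r / theta k r) 10) => h; first by lra.
  nra.
move: rat; rewrite ler_pdivrMr// => rat; apply: le_trans rat _.
rewrite mulrDl lerD//; first by rewrite mulrC.
by rewrite mulrC; apply: ler_pM => //; exact: ltW.
Qed.

(** The base point averages to zero by symmetry of the signs. Level [k] contributes at most
    [exp ((6 + 2 - 10) * 2 ^ k)] to the mean excess: link count, moment bound, centering. The total
    is below 2, whence [2 K * (10 + 2) * Theta]. *)
Lemma chaining_expectation (K : R) : 0 <= K ->
  Ex (rade law) n (fun l => maxover v0 (fun v => 0 +
    \sum_(ae <- l) (-1) ^+ ae.2 * (2 * (K * dot (a ae.1) (vv v))))) <= 24 * K * Theta.
Proof.
move=> K0.
have rp := rade_ge0 law_ge0; have r1 := rade_sum1 law_sum1.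
apply: (@le_trans _ _ (Ex (rade law) n (fun l => (2 * K) * (D l s1 + Theta * (10 + excess l))))).
  apply: le_Ex => // l _; apply: maxover_le => v.
  rewrite add0r (_ : \sum_(_ <- _) _ = 2 * K * D l (vv v)); last first.
    by rewrite /D mulr_sumr; apply: eq_bigr => ae _; ring.
  by rewrite ler_wpM2l ?mulr_ge0//; exact: chaining_pathwise.
rewrite ExZ ExD ExZ ExD (Ex_cst r1).
have -> : Ex (rade law) n (fun l => D l s1) = 0.
  apply: (@Ex_centered _ _ _ r1 n (fun ae => (-1) ^+ ae.2 * dot (a ae.1) s1)).
  by rewrite sum_rade big1// => c _; rewrite /= expr0 expr1; lra.
have Eexc : Ex (rade law) n excess <= 2.
  rewrite /excess (Ex_sum r1).
  apply: (@le_trans _ _ (\sum_(k < M) expR (- (2 * 2 ^+ k)))); last first.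
    apply: le_trans (doubly_exponential_sum M _) _; first by lra.
    have e2 : expR (- 2) <= 1 :> R by rewrite expR_le1; lra.
    lra.
  apply: ler_sum => k _; rewrite (Ex_sum r1).
  apply: (@le_trans _ _ (\sum_(q <- L k) expR (- (8 * 2 ^+ k)))).
    rewrite [leLHS]big_seq [leRHS]big_seq; apply: ler_sum => q qL.
    under eq_Ex do rewrite expRD mulrC.
    rewrite ExZ rademacher_mgf.
    apply: le_trans (ler_wpM2l (expR_ge0 _) (link_mgf (ltn_ord k) qL)) _.
    by rewrite -expRD ler_expR; lra.
  rewrite big_const_seq count_predT iter_addr_0 -[leLHS]mulr_natl.
  apply: (@le_trans _ _ (expR (6 * 2 ^+ k) * expR (- (8 * 2 ^+ k)))).
    rewrite ler_wpM2r ?expR_ge0//.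
    by apply: (@le_trans _ _ (2 ^ (6 * 2 ^ k))%:R); [rewrite ler_nat|exact: link_count_le].
  by rewrite -expRD ler_expR; lra.
rewrite add0r (_ : 24 * K * Theta = 2 * K * (Theta * 12)); last by ring.
rewrite ler_wpM2l ?mulr_ge0// ler_wpM2l//; lra.
Qed.

Variables (tau Q : R).
Hypothesis tau_gt0 : 0 < tau.
Hypothesis Q01 : 0 < Q <= 1.

(* Piecewise linear, between the indicators of [|t| >= 3 tau / 2] and
   [|t| > tau]. *)
Definition soft_threshold (t : R) : R :=
  Num.max 0 (Num.min 1 (2 * (`|t| / tau - 1))).

Lemma soft_threshold01 t : 0 <= soft_threshold t <= 1.
Proof. by rewrite /soft_threshold le_max lexx/= ge_max ler01 ge_min lexx. Qed.

Lemma soft_threshold_lipschitz t u :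
  `|soft_threshold t - soft_threshold u| <= `|2 / tau * t - 2 / tau * u|.
Proof.
rewrite -mulrBr normrM [`|2 / tau|]ger0_norm ?divr_ge0 ?(ltW tau_gt0)//.
have clamp (x y : R) : `|Num.max 0 (Num.min 1 x) - Num.max 0 (Num.min 1 y)| <= `|x - y|.
  have : x - y <= `|x - y| by exact: ler_norm.
  have : y - x <= `|x - y| by rewrite distrC ler_norm.
  have := normr_ge0 (x - y).
  rewrite ler_norml !maxEle !minEle.
  by case: (leP 1 x); case: (leP 1 y) => h1 h2; rewrite ?ler01; repeat case: ifP; lra.
apply: le_trans (clamp _ _) _.
rewrite (_ : 2 * (`|t| / tau - 1) - 2 * (`|u| / tau - 1) = 2 / tau * (`|t| - `|u|)); last by ring.
rewrite normrM ger0_norm ?divr_ge0 ?(ltW tau_gt0)// ler_wpM2l ?divr_ge0 ?(ltW tau_gt0)//.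
exact: ler_dist_dist.
Qed.

Hypothesis small_ball_law : forall v, 3 / 4 * Q <= \sum_c law c * soft_threshold (dot (a c) (vv v)).
Hypothesis Theta_small : 384 * Theta <= n%:R * Q * tau.

(** The mean of the largest deficit is at most [n Q / 8]; here [384 = 8 * 24 * 2], where the last 2
    comes from the Lipschitz constant [2 / tau]. Falling to [n Q / 2] from a mean of [3 n Q / 4] is
    a deficit of [n Q / 4], and the bounded differences inequality with [lam = Q / 64] gives the
    exponent. *)
Lemma small_ball_count :
  Ex law n (fun l => [exists v, \sum_(c <- l) soft_threshold (dot (a c) (vv v)) <= n%:R * Q / 2]%:R)
  <= expR (- (n%:R * Q ^+ 2 / 1024)).
Proof.
pose q v c := soft_threshold (dot (a c) (vv v)).
pose f l := maxover v0 (fun v => 0 + \sum_(c <- l) ((\sum_b law b * q v b) - q v c)).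
have Ef : Ex law n f <= n%:R * Q / 8.
  apply: le_trans (symmetrization law_ge0 law_sum1 v0 (q := q)
    (s := fun v c => 2 / tau * dot (a c) (vv v)) n (fun=> 0) _) _.
    by move=> u v c; exact: soft_threshold_lipschitz.
  apply: le_trans (chaining_expectation _) _; first by rewrite divr_ge0// ltW.
  have -> : 24 * (2 / tau) * Theta = (48 * Theta) / tau by ring.
  rewrite ler_pdivrMr// (_ : n%:R * Q / 8 * tau = n%:R * Q * tau / 8); last by ring.
  by move: Theta_small; set A := n%:R * Q * tau; lra.
have [Q0 Q1] := andP Q01.
have lam01 : 0 <= Q / 64 <= 1 by apply/andP; split; lra.
have psid v c c' : ((\sum_b law b * q v b) - q v c) - ((\sum_b law b * q v b) - q v c') <= 1.
  by have := soft_threshold01 (dot (a c) (vv v)); have := soft_threshold01 (dot (a c') (vv v));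
    rewrite /q => /andP[? ?] /andP[? ?]; lra.
have tail := maxover_tail law_ge0 law_sum1 v0 psid n (n%:R * Q / 4) lam01.
apply: le_trans (le_trans _ tail) _.
  apply: le_Ex => // l ln; case: existsP => [[v vP]|_]; last by rewrite ler0n.
  rewrite (_ : (n%:R * Q / 4 <= _) = true)//.
  apply: le_trans (maxover_ge _ _ v); rewrite add0r sumrB.
  rewrite big_const_seq count_predT iter_addr_0 ln -mulr_natl.
  have := ler_wpM2l (ler0n R n) (small_ball_law v).
  by move: vP; rewrite -/(q v _); lra.
rewrite ler_expR -/f.
have : Q / 64 * (Ex law n f - n%:R * Q / 4) <= Q / 64 * (n%:R * Q / 8 - n%:R * Q / 4).
  by rewrite ler_wpM2l ?lerD2r//; lra.
lra.
Qed.

End SmallBallFinite.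

(** * Discretization of the law of the covariates *)

Section Quantization.
Context {R : realType} {d : measure_display} {Omega : measurableType d}.
Variable P : probability Omega R.
Context {p : nat} (x : {RV P >-> borel_rV R p}).

Let mx (j : 'I_p) : measurable_fun setT (fun w => (x w : 'rV[R]_p) 0 j).
Proof. exact: measurableT_comp (measurable_coord j) (measurable_funPT x). Qed.

Lemma bounded_with_high_probability (delta : R) : 0 < delta ->
  exists2 k : nat, measurable [set w | exists j, k%:R <= `|(x w : 'rV[R]_p) 0 j|] &
   (P [set w | exists j, (k%:R <= `|(x w : 'rV[R]_p) 0 j|)%R] <= delta%:E)%E.
Proof.
move=> delta0.
pose A k := [set w | exists j, k%:R <= `|(x w : 'rV[R]_p) 0 j|].
have mA k : measurable (A k).
  rewrite (_ : A k = \bigcup_(j in [set: 'I_p]) [set w | k%:R <= `|(x w : 'rV[R]_p) 0 j|]).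
    apply: fin_bigcup_measurable => // j _; apply: measurable_le_cst.
    exact: measurableT_comp.
  by apply/seteqP; split => w /= [j]; [exists j|move=> _; exists j].
have A0 : \bigcap_k A k = set0.
  apply/seteqP; split => // w Aw.
  pose B := \sum_j `|(x w : 'rV[R]_p) 0 j|.
  have [j] := Aw (Num.truncn B).+1 I.
  apply/negP; rewrite -ltNge; apply: (@le_lt_trans _ _ B).
    by rewrite /B (bigD1 j)//= lerDl sumr_ge0.
  have B0 : 0 <= B by apply: sumr_ge0.
  by have /andP[_] := truncn_itv B0.
have := @nonincreasing_cvg_mu _ _ _ P A.
rewrite A0 measure0 => /(_ _ _ _ _) cvgA.
have {}cvgA : P (A k) @[k --> \oo] --> 0%E.
  apply: cvgA => //; first by rewrite ltey_eq fin_num_measure.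
  move=> i j ij; apply/subsetPset => w [l wl]; exists l; apply: le_trans wl.
  by rewrite ler_nat.
have /fine_cvgP[_ /cvgrPdist_le /(_ _ delta0)[k _ Hk]] := cvgA.
exists k; first exact: mA.
have := Hk k (leqnn k); rewrite /= sub0r normrN ger0_norm ?fine_ge0//.
by rewrite -lee_fin fineK// fin_num_measure.
Qed.

(* Points are told apart by their comparisons with a grid; a cell of the grid
   that lies in the box is represented by one of its points, and everything
   outside of the box is sent to [0]. *)
Lemma quantization (eps delta : R) : 0 < eps -> 0 < delta ->
  exists (J : finType) (idx : borel_rV R p -> J) (a : J -> 'rV[R]_p) (bad : set Omega),
  [/\ forall c, measurable (idx @^-1` [set c]),
      forall t, a (idx t) = 0 \/ forall j, `|(t : 'rV[R]_p) 0 j - a (idx t) 0 j| <= eps,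
      measurable bad, (P bad <= delta%:E)%E
    & forall w, ~ bad w -> forall j, `|(x w : 'rV[R]_p) 0 j - a (idx (x w)) 0 j| <= eps].
Proof.
move=> eps0 delta0.
have [k mk Pk] := bounded_with_high_probability delta0.
pose m := (Num.truncn eps^-1).+1.
have m0 : 0 < m%:R :> R by rewrite ltr0n.
have meps : m%:R^-1 <= eps.
  rewrite -[leRHS]invrK lef_pV2 ?posrE ?invr_gt0// ltW//.
  have ie0 : 0 <= eps^-1 by rewrite invr_ge0 ltW.
  by have /andP[] := truncn_itv ie0.
(* The grid runs from [- k] to [k] inclusive. Its two extreme comparisons decide membership in the
   box, so a cell that meets the box is contained in it. *)
pose N := (2 * k * m).+1.
pose grid (i : nat) : R := i%:R / m%:R - k%:R.
pose J : finType := {ffun 'I_p * 'I_N -> bool}.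
pose idx (t : borel_rV R p) : J := [ffun q : 'I_p * 'I_N => grid q.2 <= (t : 'rV[R]_p) 0 q.1].
pose box (t : borel_rV R p) := forall j, - k%:R <= (t : 'rV[R]_p) 0 j < k%:R.
pose a (c : J) : 'rV[R]_p := xget 0 [set t | box t /\ idx t = c].
have cell t t' : box t -> box t' -> idx t = idx t' -> forall j,
    (t : 'rV[R]_p) 0 j - (t' : 'rV[R]_p) 0 j <= eps.
  move=> bt bt' tt' j; apply: le_trans meps.
  have /andP[b1 b2] := bt j; have /andP[b1' b2'] := bt' j.
  pose i := Num.truncn ((t 0 j + k%:R) * m%:R).
  have tk : 0 <= (t 0 j + k%:R) * m%:R by rewrite mulr_ge0//; lra.
  have /andP[i1 i2] := truncn_itv tk.
  have iN : (i < N)%N.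
    rewrite ltnS -(@ler_nat R); apply: le_trans i1 _.
    rewrite !natrM ler_wpM2r//; lra.
  have : idx t (j, Ordinal iN) by rewrite ffunE/= /grid lerBlDr ler_pdivrMr.
  rewrite tt' ffunE/= /grid => git'.
  have i2' : t 0 j + k%:R < i.+1%:R / m%:R by rewrite ltr_pdivlMr.
  move: i2'; rewrite -natr1 mulrDl mul1r; lra.
have closeP t : box t -> forall j, `|(t : 'rV[R]_p) 0 j - a (idx t) 0 j| <= eps.
  move=> bt j.
  have [ba ia] : box (a (idx t)) /\ idx (a (idx t)) = idx t.
    by apply: (@xgetPex _ 0 [set u | box u /\ idx u = idx t]); exists t.
  rewrite ler_norml; apply/andP; split.
    by rewrite lerNl opprB; exact: cell.
  by apply: cell.
exists J, idx, a, [set w | exists j, k%:R <= `|(x w : 'rV[R]_p) 0 j|]; split => //.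
- move=> c; rewrite (_ : _ @^-1` _ = \bigcap_(q in [set: 'I_p * 'I_N])
      ((fun t : borel_rV R p => grid q.2 <= (t : 'rV[R]_p) 0 q.1) @^-1` [set c q])).
    apply: fin_bigcap_measurable => // q _; rewrite -[X in measurable X]setTI.
    apply: measurable_fun_ler => //; exact: measurable_coord.
  apply/seteqP; split => [t /= <- q _|t /= H]; first by rewrite /= ffunE.
  by apply/ffunP => q; rewrite ffunE; exact: H.
- move=> t; have [[u [bu iu]]|none] := pselect (exists u, box u /\ idx u = idx t); last first.
    by left; apply: xgetPN => u hu; apply: none; exists u.
  right; apply: closeP => j; have /andP[b1 b2] := bu j.
  have lo : idx u (j, ord0) by rewrite ffunE/= /grid mul0r sub0r.
  have hi : ~~ idx u (j, ord_max).
    by rewrite ffunE/= /grid natrM mulfK ?gt_eqF// -ltNge mul2n -addnn natrD addrK.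
  move: lo hi; rewrite iu !ffunE/= /grid mul0r sub0r => ->.
  by rewrite natrM mulfK ?gt_eqF// -ltNge mul2n -addnn natrD addrK.
- move=> w nbad; apply: closeP => j.
  have : `|(x w : 'rV[R]_p) 0 j| < k%:R.
    by rewrite ltNge; apply/negP => h; apply: nbad; exists j.
  by move=> /ltr_normlP[h1 h2]; apply/andP; split => //; lra.
Qed.

End Quantization.

(** * Symmetrized exponential moments of a marginal *)

Section CoshMoment.
Context {R : realType} {d : measure_display} {Omega : measurableType d}.
Variable P : probability Omega R.

Lemma bernstein_tailN (Z : Omega -> R) (g e : R) : bernstein_tail P Z g e ->
  bernstein_tail P (fun w => - Z w) g e.
Proof.
move=> [mZ g0 e0 H]; split => //; first exact: measurableT_comp.
by move=> t t0; under eq_set do rewrite normrN; exact: H.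
Qed.

Let one2 : (\int[P]_w (expR (`|(cst 1 : Omega -> R) w| / 2))%:E <= 2%:E)%E.
Proof.
under eq_integral do rewrite /= normr1.
rewrite integral_cst//= probability_setT mule1 lee_fin.
have := expR_ge1Dx (- (1 / 2) : R); have := expRxMexpNx_1 (1 / 2 : R).
have := expR_gt0 (1 / 2 : R); nra.
Qed.

(** The case of constant multiplier [xi = 1], with truncation level 1 and sub-exponential scale 2;
    the factor 4 is the square of that scale. *)
Lemma compensated_mgf1 (Z : Omega -> R) (g e lam : R) : bernstein_tail P Z g e ->
    0 <= lam -> 8 * lam * e <= 1 ->
  (\int[P]_w (expR (lam * Z w - 2 * lam ^+ 2 * g ^+ 2))%:E <=
   (1 + lam * fine (\int[P]_w (Z w)%:E) + 4 * 7616 * (lam ^+ 2 * (g + e) ^+ 2))%:E)%E.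
Proof.
move=> ZT lam0 lame.
have lam1 : 8 * lam * 1 * e <= 1 by rewrite mulr1.
have := compensated_mgf ZT (measurable_cst (1 : R)) (ltr0n R 2) one2 lam0 lam1.
under eq_integral do rewrite /= normr1 lexx expr1n mulr1 mul1r.
under [X in (_ <= (1 + lam * fine X + _)%:E)%E -> _]eq_integral do rewrite /= mul1r.
by move=> H; apply: le_trans H _; rewrite lee_fin lerD2l; lra.
Qed.

(** Averaging the bounds for [Z] and [- Z] cancels the mean, so only second-order terms remain
    although [Z] need not be centered. Restoring the compensator multiplies by at most [exp (2 q)],
    and [4 * 7616 + 2 <= 4 * 7617]. *)
Lemma cosh_mgf (Z : Omega -> R) (g e lam : R) : bernstein_tail P Z g e ->
    0 <= lam -> 8 * lam * e <= 1 ->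
  (\int[P]_w ((expR (lam * Z w) + expR (- (lam * Z w))) / 2)%:E <=
   (expR (4 * 7617 * (lam ^+ 2 * (g + e) ^+ 2)))%:E)%E.
Proof.
move=> ZT lam0 lame; have [mZ g0 e0 _] := ZT.
pose k := 2 * lam ^+ 2 * g ^+ 2.
have iZ : P.-integrable setT (EFin \o Z).
  have := integrable_mul_bernstein ZT (measurable_cst (1 : R)) (ltr0n R 2) one2.
  by under eq_fun do rewrite /= mul1r.
have H1 := compensated_mgf1 ZT lam0 lame.
have := compensated_mgf1 (bernstein_tailN ZT) lam0 lame.
have -> : (\int[P]_w (- Z w)%:E = - \int[P]_w (Z w)%:E)%E.
  under eq_integral do rewrite -mulN1r EFinM.
  by rewrite (integralZl measurableT iZ) EFinN mulN1e.
rewrite fineN mulrN -/k => H2; rewrite -/k in H1.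
pose E1 w := expR (lam * Z w - k); pose E2 w := expR (lam * - Z w - k).
have mE1 : measurable_fun setT (EFin \o E1).
  apply/measurable_EFinP; apply: measurableT_comp => //.
  by apply: measurable_funB => //; exact: measurable_funM.
have mE2 : measurable_fun setT (EFin \o E2).
  apply/measurable_EFinP; apply: measurableT_comp => //.
  apply: measurable_funB => //; apply: measurable_funM => //.
  exact: measurableT_comp.
have E10 w : (0 <= (EFin \o E1) w)%E by rewrite lee_fin expR_ge0.
have E20 w : (0 <= (EFin \o E2) w)%E by rewrite lee_fin expR_ge0.
have ek0 : 0 <= expR k / 2 by rewrite divr_ge0 ?expR_ge0.
have -> : (\int[P]_w ((expR (lam * Z w) + expR (- (lam * Z w))) / 2)%:E =
    \int[P]_w ((expR k / 2)%:E * ((EFin \o E1) w + (EFin \o E2) w)))%E.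
  apply: eq_integral => w _; rewrite /= -EFinD -EFinM; congr EFin.
  rewrite /E1 /E2 mulrN !expRD !expRN.
  by field; rewrite !lt0r_neq0 ?expR_gt0.
rewrite ge0_integralZl_EFin//; last 2 first.
- by move=> w _; rewrite adde_ge0.
- exact: emeasurable_funD.
rewrite ge0_integralD//.
apply: le_trans (lee_wpmul2l _ (leeD H1 H2)) _; first by rewrite lee_fin.
rewrite -EFinD -EFinM lee_fin.
set q := lam ^+ 2 * (g + e) ^+ 2; set c := lam * fine _.
rewrite [leLHS](_ : _ = expR k * (1 + 4 * 7616 * q)); last by field.
have kq : k <= 2 * q.
  rewrite /k /q -mulrA ler_wpM2l// ler_wpM2l ?sqr_ge0//.
  by rewrite lerXn2r ?nnegrE ?lerDl ?addr_ge0// ltW.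
have q0 : 0 <= q by rewrite mulr_ge0 ?sqr_ge0.
apply: (@le_trans _ _ (expR k * expR (4 * 7616 * q))).
  by rewrite ler_wpM2l ?expR_ge0// expR_ge1Dx.
by rewrite -expRD ler_expR; lra.
Qed.

End CoshMoment.

(** * The small-ball bound for the original sample *)

Section SmallBallInf.
Context {R : realType} {d : measure_display} {Omega : measurableType d}.
Variable P : probability Omega R.
Context {p n : nat} (x : {RV P >-> borel_rV R p}).
Variables (X : 'I_n -> {RV P >-> borel_rV R p}) (Ng Ne : 'rV[R]_p -> R).
Hypothesis n0 : (0 < n)%N.
Hypothesis sNg : seminorm Ng.
Hypothesis sNe : seminorm Ne.
Hypothesis HB : generic_bernstein P x Ng Ne.
Hypothesis lawX : forall i, same_law P (X i) x.
Hypothesis indX : mutually_independent P (fun i => X i : Omega -> borel_rV R p).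

Let sn : R := Num.sqrt n%:R.
Let nr0 : 0 < n%:R :> R. Proof. by rewrite ltr0n. Qed.
Let sn0 : 0 < sn. Proof. by rewrite sqrtr_gt0. Qed.
Let sn2 : sn ^+ 2 = n%:R. Proof. by rewrite sqr_sqrtr// ltW. Qed.

Let theta (eta : R) (k : nat) l := 175 *
  (sn * Num.sqrt (2 ^+ k) * ((Ng l + eta) + (Ne l + eta)) + 2 ^+ k * (Ne l + eta)).

(** The two parts of [theta] serve two purposes: the exponential part keeps [8 * lam * e <= 1], and
    the Gaussian part bounds the variance term. The constant 175 is chosen so that
    [175 ^ 2 >= 4 * 7617]. *)
Lemma link_cosh_mgf eta k l : 0 < eta ->
  let lam := 2 ^+ k / theta eta k l in
  0 < theta eta k l /\
  (\int[P]_w ((expR (lam * dot (x w) l) + expR (- (lam * dot (x w) l))) / 2)%:E <=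
   (expR (2 ^+ k / n%:R))%:E)%E.
Proof.
move=> eta0 lam.
have T := generic_bernstein_tail l sNg sNe HB eta0.
have [_ g0 e0 _] := T; rewrite /lam {lam} /theta.
set g := Ng l + eta in T g0 *; set e := Ne l + eta in T e0 *.
have k0 : 0 < 2 ^+ k :> R by rewrite exprn_gt0.
have sk0 : 0 < Num.sqrt (2 ^+ k) :> R by rewrite sqrtr_gt0.
have sk2 : Num.sqrt (2 ^+ k) ^+ 2 = 2 ^+ k :> R by rewrite sqr_sqrtr// ltW.
move: k0 sk0 sk2; set K := (2 ^+ k : R); set sk := Num.sqrt K => k0 sk0 sk2.
set D := sn * sk * (g + e) + K * e.
have ge0 : 0 < g + e by exact: addr_gt0.
have skge : 0 < sn * sk * (g + e) by rewrite mulr_gt0// mulr_gt0.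
have Ke : 0 < K * e by exact: mulr_gt0.
have D0 : 0 < D by exact: addr_gt0.
have th0 : 0 < 175 * D by apply: mulr_gt0 D0; rewrite ltr0n.
split=> //.
have lam0 : 0 <= K / (175 * D) by exact: divr_ge0 (ltW k0) (ltW th0).
have lamth : K / (175 * D) * (175 * D) = K := divfK (lt0r_neq0 th0) K.
move: lam0 lamth; set lam := K / (175 * D) => lam0 lamth.
apply: le_trans (cosh_mgf T lam0 _) _.
  have : 8 * lam * (K * e) <= K.
    have : lam * (K * e) <= lam * D by rewrite ler_wpM2l// lerDr ltW.
    have : 0 <= lam * (K * e) by rewrite mulr_ge0// ltW.
    lra.
  rewrite (_ : 8 * lam * (K * e) = K * (8 * lam * e)); last by ring.
  by rewrite ger_pMr.
rewrite lee_fin ler_expR ler_pdivlMr// -sn2.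
have H : (lam * (sn * sk * (g + e))) ^+ 2 <= (K / 175) ^+ 2.
  have u0 : 0 <= lam * (sn * sk * (g + e)) by apply: mulr_ge0 => //; exact: ltW.
  have uD : lam * (sn * sk * (g + e)) <= lam * D by rewrite ler_wpM2l// lerDl ltW.
  by apply: lerXn2r; rewrite ?nnegrE//; lra.
have : (lam * (sn * sk * (g + e))) ^+ 2 = K * (lam ^+ 2 * (g + e) ^+ 2 * sn ^+ 2).
  by rewrite -sk2; ring.
move=> E; rewrite E in H.
move: H; set q := lam ^+ 2 * (g + e) ^+ 2 * sn ^+ 2 => H.
have q1 : q * (175 ^+ 2) <= K.
  rewrite -(ler_pM2l k0) mulrA -ler_pdivlMr ?exprn_gt0 ?ltr0n//.
  by apply: le_trans H _; rewrite expr_div_n expr2.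
have q0 : 0 <= q by rewrite mulr_ge0 ?sqr_ge0// mulr_ge0 ?sqr_ge0.
have -> : 4 * 7617 * (lam ^+ 2 * (g + e) ^+ 2) * sn ^+ 2 = 4 * 7617 * q by rewrite /q; ring.
lra.
Qed.

Let norm1 (v : 'rV[R]_p) : R := \sum_j `|v 0 j|.

Let norm1_ge0 v : 0 <= norm1 v. Proof. exact: sumr_ge0. Qed.

Let dot_close (t u v : 'rV[R]_p) (eps : R) :
  (forall j, `|t 0 j - u 0 j| <= eps) -> `|dot t v - dot u v| <= eps * norm1 v.
Proof.
move=> H; rewrite /dot -sumrB /norm1 mulr_sumr; apply: le_trans (ler_norm_sum _ _ _) _.
by apply: ler_sum => j _; rewrite -mulrBl normrM ler_wpM2r.
Qed.

(** Points that the quantization sends to 0 do no harm, because cosh is smallest there. *)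
Let cosh_close (u v del : R) : 0 <= del -> u = 0 \/ `|v - u| <= del ->
  (expR u + expR (- u)) / 2 <= expR del * ((expR v + expR (- v)) / 2).
Proof.
move=> del0 H.
have e1 : 1 <= expR del by have := expR_ge1Dx del; lra.
case: H => [->|/ler_normlP[h1 h2]].
  rewrite oppr0 expR0; have : 1 <= (expR v + expR (- v)) / 2.
    by have := expR_ge1Dx v; have := expR_ge1Dx (- v); lra.
  nra.
have : expR u <= expR del * expR v by rewrite -expRD ler_expR; lra.
have : expR (- u) <= expR del * expR (- v) by rewrite -expRD ler_expR; lra.
lra.
Qed.

Let chaining_scale (S : set 'rV[R]_p) (A B : nat -> set (set 'rV[R]_p)) (G1 G2 gap : R)
    (pts : seq 'rV[R]_p) :
    admissible S A -> admissible S B ->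
    (forall q, S q -> (\sum_(0 <= k <oo) (2 `^ (k%:R / 1%:R))%:E *
       diameter (fun u v => Ne (u - v)%R) (pblock (A k) id q) <= G1%:E)%E) ->
    (forall q, S q -> (\sum_(0 <= k <oo) (2 `^ (k%:R / 2%:R))%:E *
       diameter (fun u v => Ng (u - v) + Ne (u - v))%R (pblock (B k) id q) <= G2%:E)%E) ->
    (forall q, q \in pts -> S q) -> 0 < gap ->
  exists (M : nat) (s1 : 'rV[R]_p) (L : nat -> seq 'rV[R]_p)
         (w : 'I_(size pts) -> nat -> 'rV[R]_p) (eta : R),
  [/\ 0 < eta, forall k, (size (L k) <= 2 ^ (6 * 2 ^ k))%N,
      forall j k, (k < M)%N -> w j k \in L k,
      forall j : 'I_(size pts), nth 0 pts j = s1 + \sum_(k < M) w j k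
    & forall j, \sum_(k < M) theta eta k (w j k) <= 175 * (sn * G2 + G1) + gap].
Proof.
move=> admA admB HA HB' Spts gap0.
have [Ng0 NgZ NgT] := sNg; have [Ne0 NeZ NeT] := sNe.
have sN2 : seminorm (fun v => Ng v + Ne v).
  split=> [v|c v|u v]; [exact: addr_ge0|by rewrite NgZ NeZ mulrDr|].
  by have := NgT u v; have := NeT u v; lra.
have Spt (j : 'I_(size pts)) : S (nth 0 pts j) by apply: Spts; exact: mem_nth.
have [M [s1 [L [w [Lsize wL ptE sum1 sum2]]]]] :=
  chaining_links sNe sN2 admA admB HA HB' Spt.
pose Kc : R := \sum_(k < M) (2 * sn * Num.sqrt (2 ^+ k) + 2 ^+ k).
have Kc0 : 0 <= Kc.
  apply: sumr_ge0 => k _; rewrite addr_ge0 ?exprn_ge0//.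
  by rewrite mulr_ge0 ?sqrtr_ge0// mulr_ge0// ltW.
have Kc1 : 0 < Kc + 1 by lra.
pose eta := gap / (175 * (Kc + 1)).
have den0 : 0 < 175 * (Kc + 1) by apply: mulr_gt0 Kc1; rewrite ltr0n.
have eta0 : 0 < eta by exact: divr_gt0.
exists M, s1, L, w, eta; split => // j.
have th k : theta eta k (w j k) = 175 *
    (sn * (2 `^ (k%:R / 2%:R) * (Ng (w j k) + Ne (w j k))) +
     2 `^ (k%:R / 1%:R) * Ne (w j k) +
     eta * (2 * sn * Num.sqrt (2 ^+ k) + 2 ^+ k)).
  by rewrite /theta divr1 powR_mulrn// -powR2_half; ring.
under eq_bigr do rewrite th.
rewrite -mulr_sumr !big_split/= -!mulr_sumr -/Kc.
have s1' := sum1 j; have s2' : sn * \sum_(k < M) 2 `^ (k%:R / 2%:R) *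
    (Ng (w j k) + Ne (w j k)) <= sn * G2 by rewrite ler_wpM2l ?(ltW sn0).
have etaK : 175 * (eta * Kc) <= gap.
  have -> : 175 * (eta * Kc) = gap * (Kc / (Kc + 1)).
    by rewrite /eta; field; rewrite !gt_eqF.
  by rewrite ger_pMr// ler_pdivrMr// mul1r; lra.
move: s1' s2' etaK; lra.
Qed.

(** The mesh is fixed after the links and directions, so that it shifts the logarithm of each
    [n]-fold moment by at most 1, which turns [exp (2 ^ k)] into [exp (2 * 2 ^ k)], and each
    marginal of a good point by at most [tau / 2]. The level [2 tau] drops to [3 tau / 2], where the
    threshold function is 1, and its mean to [Q - Q / 4]. Conversely, a quantized marginal above
    [tau] comes from a marginal of at least [tau / 2], so each unit of the count contributes at
    least [tau ^ 2 / 4]. *)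
Lemma small_ball_inf (S : set 'rV[R]_p) (A B : nat -> set (set 'rV[R]_p))
    (G1 G2 tau Q : R) (vs : seq 'rV[R]_p) :
    admissible S A -> admissible S B ->
    (forall q, S q -> (\sum_(0 <= k <oo) (2 `^ (k%:R / 1%:R))%:E *
       diameter (fun u v => Ne (u - v)%R) (pblock (A k) id q) <= G1%:E)%E) ->
    (forall q, S q -> (\sum_(0 <= k <oo) (2 `^ (k%:R / 2%:R))%:E *
       diameter (fun u v => Ng (u - v) + Ne (u - v))%R (pblock (B k) id q) <= G2%:E)%E) ->
    0 < tau -> 0 < Q <= 1 ->
    (forall v, v \in vs -> convex_hull S v) ->
    (forall v, v \in vs -> (Q%:E <= P [set w | (2 * tau <= `|dot (x w) v|)%R])%E) ->
    384 * (175 * (sn * G2 + G1)) < n%:R * Q * tau ->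
  (P [set w | exists2 v, v \in vs &
      (\sum_i dot (X i w) v ^+ 2 < n%:R * tau ^+ 2 * Q / 8)%R] <=
    (expR (- (n%:R * Q ^+ 2 / 1024)))%:E)%E.
Proof.
move=> admA admB HA HB' tau0 Q01 vsS vsQ small.
case: vs vsS vsQ => [|v1 vs] vsS vsQ.
  rewrite (_ : [set w | _] = set0); first by rewrite measure0 lee_fin expR_ge0.
  by apply/seteqP; split => // w [].
move: vsS vsQ; set V := v1 :: vs => vsS vsQ.
have [pts Spts Hpts] := finite_hull_points vsS.
pose gap := n%:R * Q * tau / 384 - 175 * (sn * G2 + G1).
have gap0 : 0 < gap.
  by rewrite /gap subr_gt0 ltr_pdivlMr ?ltr0n// mulrC.
clear small.
have [M [s1 [L [w [eta [eta0 Lsize wL ptE thsum]]]]]] :=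
  chaining_scale admA admB HA HB' Spts gap0.
pose lam k q := 2 ^+ k / theta eta k q.
have th0 k q : 0 < theta eta k q by have [] := link_cosh_mgf k q eta0.
have lam0 k q : 0 <= lam k q by rewrite divr_ge0 ?exprn_ge0// ltW.
pose eW := \sum_(k < M) \sum_(q <- L k) n%:R * lam k q * norm1 q.
pose eV := \sum_(v <- V) norm1 v * (2 / tau).
have tt0 : 0 < 2 / tau by rewrite divr_gt0.
have term0 k q : 0 <= n%:R * lam k q * norm1 q by rewrite mulr_ge0// mulr_ge0.
have eW0 : 0 <= eW by apply: sumr_ge0 => k _; exact: sumr_ge0.
have eV0 : 0 <= eV by apply: sumr_ge0 => v _; rewrite mulr_ge0// ltW.
pose eps := (1 + eW + eV)^-1.
have den0 : 0 < 1 + eW + eV by lra.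
have eps0 : 0 < eps by rewrite invr_gt0.
have epsW k q : (k < M)%N -> q \in L k -> n%:R * (lam k q * (eps * norm1 q)) <= 1.
  move=> kM qL; rewrite (_ : _ * _ = (n%:R * lam k q * norm1 q) * eps); last by ring.
  rewrite ler_pdivrMr// mul1r; apply: (@le_trans _ _ eW); last by lra.
  rewrite /eW (bigD1 (Ordinal kM))//=; apply: ler_wpDr.
    by apply: sumr_ge0 => i _; exact: sumr_ge0.
  by rewrite (big_rem q)//=; apply: ler_wpDr => //; exact: sumr_ge0.
have epsV v : v \in V -> eps * norm1 v <= tau / 2.
  move=> vV; have : norm1 v * (2 / tau) * eps <= 1.
    rewrite ler_pdivrMr// mul1r; apply: (@le_trans _ _ eV); last by lra.
    rewrite /eV (big_rem v)//=; apply: ler_wpDr => //.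
    by apply: sumr_ge0 => i _; rewrite mulr_ge0// ltW.
  rewrite (_ : norm1 v * (2 / tau) * eps = eps * norm1 v / (tau / 2)); last first.
    by field; rewrite gt_eqF.
  by rewrite ler_pdivrMr ?mul1r// divr_gt0.
have [Q0 Q1] := andP Q01.
have Q4 : 0 < Q / 4 by rewrite divr_gt0.
have [J [idx [a [bad [midx aP mbad Pbad goodP]]]]] := quantization x eps0 Q4.
pose law c := fine (P (x @^-1` (idx @^-1` [set c]))).
have mx : measurable_fun setT (x : Omega -> borel_rV R p) by exact: measurable_funPT.
have midx' c : measurable ((idx \o x) @^-1` [set c]).
  by rewrite comp_preimage -[X in measurable X]setTI; exact: mx.
have intJ (h : J -> R) : (forall c, 0 <= h c) ->
    (\int[P]_w (h (idx (x w)))%:E)%E = (\sum_c law c * h c)%:E.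
  by move=> h0; exact: (integral_finrange P (idx := idx \o x) midx' h0).
have law0 c : 0 <= law c by exact: fine_ge0.
have law1 : \sum_c law c = 1.
  have := intJ (fun=> 1) (fun=> ler01); rewrite integral_cst//= probability_setT mule1.
  by move=> [->]; apply: eq_bigr => c _; rewrite mulr1.
pose vv (i : 'I_(size V)) := nth 0 V i.
have vvV i : vv i \in V by exact: mem_nth.
have linkm k q : (k < M)%N -> q \in L k ->
    let lam := 2 ^+ k / theta eta k q in
    (\sum_c law c * ((expR (lam * dot (a c) q) + expR (- (lam * dot (a c) q))) / 2)) ^+ n
      <= expR (2 * 2 ^+ k).
  move=> kM qL; rewrite -/(lam k q) /=.
  pose del := lam k q * (eps * norm1 q).
  have del0 : 0 <= del by rewrite mulr_ge0// mulr_ge0// ltW.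
  pose h c := (expR (lam k q * dot (a c) q) + expR (- (lam k q * dot (a c) q))) / 2.
  have h0 c : 0 <= h c by rewrite divr_ge0// addr_ge0 ?expR_ge0.
  have hle : \sum_c law c * h c <= expR (del + 2 ^+ k / n%:R).
    rewrite -lee_fin -intJ//.
    have [_ Hl] := link_cosh_mgf k q eta0.
    have mdot : measurable_fun setT (fun w => lam k q * dot (x w) q).
      by apply: measurable_funM => //; exact: measurable_dot_rv.
    have mcosh : measurable_fun setT (fun w => ((expR (lam k q * dot (x w) q) +
        expR (- (lam k q * dot (x w) q))) / 2)%:E).
      apply/measurable_EFinP; apply: measurable_funM => //.
      apply: measurable_funD; apply: measurableT_comp => //.
      exact: measurableT_comp.
    apply: (@le_trans _ _ (\int[P]_w ((expR del)%:E * ((expR (lam k q * dot (x w) q) +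
        expR (- (lam k q * dot (x w) q))) / 2)%:E))%E).
      apply: ge0_le_integral => //.
      - by move=> w1 _; rewrite lee_fin.
      - apply/measurable_EFinP.
        exact: (@measurable_finrange _ _ J (idx \o x) _ _ h midx').
      - exact: measurable_funeM.
      move=> w1 _; rewrite -EFinM lee_fin; apply: cosh_close => //.
      case: (aP (x w1)) => [->|close]; [left|right].
        by rewrite /dot big1 ?mulr0// => j _; rewrite mxE mul0r.
      rewrite -mulrBr normrM ger0_norm// ler_wpM2l//; exact: dot_close.
    rewrite ge0_integralZl_EFin ?expR_ge0//.
    by rewrite expRD EFinM lee_wpmul2l// lee_fin expR_ge0.
  apply: (@le_trans _ _ (expR (del + 2 ^+ k / n%:R) ^+ n)).
    apply: lerXn2r; rewrite ?nnegrE ?expR_ge0//.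
    by apply: sumr_ge0 => c _; exact: mulr_ge0.
  rewrite -expRM_natl ler_expR.
  rewrite (_ : n%:R * (del + 2 ^+ k / n%:R) = n%:R * del + 2 ^+ k); last first.
    by rewrite mulrDr; congr (_ + _); rewrite mulrC divfK// gt_eqF.
  have two1 : 1 <= 2 ^+ k :> R by rewrite exprn_ege1// ler1n.
  by rewrite [leRHS]mulr_natl mulr2n lerD2r; exact: le_trans (epsW k q kM qL) two1.
have sbl i : 3 / 4 * Q <= \sum_c law c * soft_threshold tau (dot (a c) (vv i)).
  have soft0 c : 0 <= soft_threshold tau (dot (a c) (vv i)).
    by have /andP[] := soft_threshold01 tau (dot (a c) (vv i)).
  rewrite -lee_fin -intJ//.
  pose Ai := [set w | 2 * tau <= `|dot (x w) (vv i)|].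
  have mAi : measurable Ai.
    by apply: measurable_le_cst; apply: measurableT_comp => //; exact: measurable_dot_rv.
  have mD : measurable (Ai `\` bad) by exact: measurableD.
  apply: (@le_trans _ _ (P (Ai `\` bad))).
    have PA : (P Ai <= P (Ai `\` bad) + P bad)%E.
      apply: le_trans (measureU2 P mD mbad); apply: le_measure; rewrite ?inE//.
        exact: measurableU.
      by move=> w1 Aw; have [|] := pselect (bad w1); [right|left].
    have := le_trans (vsQ _ (vvV i)) (le_trans PA (leeD2l _ Pbad)).
    have fD : P (Ai `\` bad) \is a fin_num by exact: fin_num_measure.
    by rewrite -(fineK fD) -EFinD !lee_fin; lra.
  rewrite -[Ai `\` bad]setIT -integral_indic//.
  apply: ge0_le_integral => //.
  - by apply/measurable_EFinP; exact: measurable_indic.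
  - apply/measurable_EFinP.
    exact: (@measurable_finrange _ _ J (idx \o x) _ _
      (fun c => soft_threshold tau (dot (a c) (vv i))) midx').
  move=> w1 _; rewrite lee_fin indicE; case: (boolP (w1 \in Ai `\` bad)) => [|_]; last exact: soft0.
  rewrite inE => -[Aw nbad].
  have := dot_close (vv i) (goodP _ nbad); have := epsV _ (vvV i).
  move=> h1 h2; have {}h2 := le_trans h2 h1.
  have dist : `|dot (x w1) (vv i)| - `|dot (a (idx (x w1))) (vv i)| <= tau / 2.
    by apply: le_trans h2; exact: lerB_dist.
  rewrite /soft_threshold le_max; apply/orP; right; rewrite le_min lexx/=.
  have : 3 / 2 <= `|dot (a (idx (x w1))) (vv i)| / tau.
    rewrite ler_pdivlMr// (_ : 3 / 2 * tau = 2 * tau - tau / 2); last by field.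
    by rewrite lerBlDr; apply: le_trans Aw _; rewrite -lerBlDl.
  move=> h32; rewrite [leLHS](_ : _ = 2 * (3 / 2 - 1)); last by field.
  by rewrite ler_pM2l// lerB.
have Tsmall : 384 * (175 * (sn * G2 + G1) + gap) <= n%:R * Q * tau.
  by rewrite /gap addrC subrK mulrC divfK ?pnatr_eq0.
have := @small_ball_count R J law p a law0 law1 _ (ord0 : 'I_(size V)) vv n M pts s1 L w
  (theta eta) _ (fun i => Hpts _ (vvV i)) Lsize wL ptE th0 thsum linkm tau Q tau0 Q01 sbl Tsmall.
move=> count; clear Tsmall.
have mXi i : measurable_fun setT (X i : Omega -> borel_rV R p) by exact: measurable_funPT.
pose few (l : seq J) := [exists i : 'I_(size V),
  \sum_(c <- l) soft_threshold tau (dot (a c) (vv i)) <= n%:R * Q / 2].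
apply: (@le_trans _ _ (P [set w | few [seq idx (X i w) | i <- enum 'I_n]])); last first.
  by rewrite (probability_sample mXi mx lawX indX few midx) lee_fin.
have mlt v : measurable [set w | (\sum_i dot (X i w) v ^+ 2 < n%:R * tau ^+ 2 * Q / 8)%R].
  apply: measurable_lt_fun => //; apply: measurable_sum => i.
  by apply: measurable_funX; exact: measurable_dot_rv.
apply: le_measure; rewrite ?inE//.
- by have [] := union_bound_seq (fun v (_ : v \in V) => mlt v)
    (fun v _ => probability_le1 P (mlt v)).
- exact: (measurable_sample mXi few midx).
move=> w1 /= [v vV vlt]; apply/existsP.
have iV : (index v V < size V)%N by rewrite index_mem.
exists (Ordinal iV); rewrite /vv/= nth_index// big_map big_enum/=.
have term i : tau ^+ 2 / 4 * soft_threshold tau (dot (a (idx (X i w1))) v) <=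
    dot (X i w1) v ^+ 2.
  have /andP[f0 f1] := soft_threshold01 tau (dot (a (idx (X i w1))) v).
  have t2 : 0 < tau ^+ 2 by rewrite exprn_gt0.
  have sq := sqr_ge0 (dot (X i w1) v).
  have [|big] := leP `|dot (a (idx (X i w1))) v| tau.
    move=> small1; rewrite (_ : soft_threshold _ _ = 0) ?mulr0//.
    rewrite /soft_threshold; apply/max_idPl; rewrite ge_min; apply/orP; right.
    have : `|dot (a (idx (X i w1))) v| / tau <= 1 by rewrite ler_pdivrMr// mul1r.
    by move=> le1; rewrite mulr_ge0_le0// subr_le0.
  case: (aP (X i w1)) => [a0|close].
    have d0 : dot (a (idx (X i w1))) v = 0.
      by rewrite a0 /dot big1// => j _; rewrite mxE mul0r.
    by move: big; rewrite d0 normr0 ltNge ltW.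
  have h := le_trans (dot_close v close) (epsV v vV).
  have dist : `|dot (a (idx (X i w1))) v| - `|dot (X i w1) v| <= tau / 2.
    by apply: le_trans h; rewrite distrC; exact: lerB_dist.
  have : (tau / 2) ^+ 2 <= dot (X i w1) v ^+ 2.
    rewrite -(real_normK (num_real (dot (X i w1) v))).
    apply: lerXn2r; rewrite ?nnegrE ?divr_ge0 ?(ltW tau0)//.
    apply: (@le_trans _ _ (`|dot (a (idx (X i w1))) v| - tau / 2)).
      by rewrite lerBrDr -splitr ltW.
    by rewrite lerBlDr -lerBlDl.
  apply: le_trans; rewrite (_ : tau ^+ 2 / 4 = (tau / 2) ^+ 2); last first.
    by rewrite expr_div_n -natrX.
  by rewrite ler_piMr ?sqr_ge0.
have : tau ^+ 2 / 4 * \sum_i soft_threshold tau (dot (a (idx (X i w1))) v) <=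
    n%:R * tau ^+ 2 * Q / 8.
  apply: le_trans (ltW vlt); rewrite mulr_sumr; apply: ler_sum => i _; exact: term.
set s := \sum_i _ => H.
have t4 : 0 < tau ^+ 2 / 4 by rewrite divr_gt0// exprn_gt0.
rewrite -(ler_pM2l t4); apply: le_trans H _.
by rewrite [leRHS](_ : _ = n%:R * tau ^+ 2 * Q / 8)//; field.
Qed.

End SmallBallInf.

(** * Approximation by countably many directions *)

Section DenseSequence.
Context {R : realType} {p : nat}.

(** [L] may contain no rational point, so a point of [L] is chosen near each rational centre, for
    each radius at which [L] comes that close. *)
Lemma dense_sequence (L : set 'rV[R]_p) : L !=set0 ->
  exists2 v : nat -> 'rV[R]_p, forall j, L (v j) &
    forall u, L u -> forall eps, 0 < eps ->
      exists j, forall i, `|u 0 i - v j 0 i| <= eps.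
Proof.
move=> [l0 Ll0].
pose near (q : 'rV[rat]_p * nat) : set 'rV[R]_p :=
  [set u | L u /\ forall i, `|u 0 i - ratr (q.1 0 i)| <= q.2.+1%:R^-1].
pose f q := if pselect (near q !=set0) is left _ then xget l0 (near q) else l0.
have fL q : L (f q).
  by rewrite /f; case: pselect => // h; have [] := xgetPex l0 h.
pose v j := if unpickle j is Some q then f q else l0.
exists v => [j|u Lu eps eps0]; first by rewrite /v; case: unpickle.
pose k := Num.truncn (2 / eps).
have e2 : 0 <= 2 / eps by rewrite divr_ge0// ltW.
have /andP[_ kP] := truncn_itv e2.
have k1 : 0 < k.+1%:R^-1 :> R by rewrite invr_gt0 ltr0n.
have kE : 2 * k.+1%:R^-1 <= eps.
  rewrite -ler_pdivlMr ?invr_gt0 ?ltr0n// invrK mulrC -ler_pdivrMr//.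
  exact: ltW.
have approx i : exists r : rat, `|u 0 i - ratr r| <= k.+1%:R^-1.
  have [|r] := @rat_in_itvoo R (u 0 i) (u 0 i + k.+1%:R^-1); first by rewrite ltrDl.
  rewrite in_itv/= => /andP[r1 r2]; exists r; move: r1 r2; set z := ratr r => r1 r2.
  by move: k1 r1 r2; set e := k.+1%:R^-1 => k1 r1 r2; rewrite ler_norml; apply/andP; split; lra.
have [q qP] := choice approx.
pose Q : 'rV[rat]_p * nat := (\row_i q i, k).
have nQ : near Q u by split => // i; rewrite mxE; exact: qP.
exists (pickle Q) => i; rewrite /v pickleK /f.
case: pselect => [h|]; last by move=> h; exfalso; apply: h; exists u.
have [_ /(_ i)] := xgetPex l0 h.
set w := xget l0 (near Q) => wP.
have [_ /(_ i) uP] := nQ.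
apply: le_trans kE.
rewrite (_ : u 0 i - w 0 i = (u 0 i - ratr (Q.1 0 i)) - (w 0 i - ratr (Q.1 0 i))); last by ring.
apply: le_trans (ler_normB _ _) _; rewrite mulr2n mulrDl mul1r.
exact: lerD.
Qed.

Lemma linear_fun_small (D : 'rV[R]_p -> R) (eps : R) (w : 'rV[R]_p) :
  (forall u v, D (u + v) = D u + D v) -> (forall a v, D (a *: v) = a * D v) ->
  (forall i, `|w 0 i| <= eps) -> `|D w| <= eps * \sum_i `|D (delta_mx 0 i)|.
Proof.
move=> DD DZ weps; rewrite {1}(row_sum_delta w) (linear_fun_sum DD DZ).
rewrite mulr_sumr; apply: le_trans (ler_norm_sum _ _ _) _.
by apply: ler_sum => i _; rewrite DZ normrM ler_wpM2r.
Qed.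

Lemma linear_fun_le_dense (D : 'rV[R]_p -> R) (v : nat -> 'rV[R]_p) (u : 'rV[R]_p) (T : R) :
  (forall u v, D (u + v) = D u + D v) -> (forall a v, D (a *: v) = a * D v) ->
  (forall eps, 0 < eps -> exists j, forall i, `|u 0 i - v j 0 i| <= eps) ->
  (forall j, D (v j) <= T) -> D u <= T.
Proof.
move=> DD DZ dense DT; apply/ler_addgt0Pr => eps eps0.
pose A := \sum_i `|D (delta_mx 0 i)|.
have A0 : 0 <= A by apply: sumr_ge0.
have A1 : 0 < A + 1 by lra.
have [j jP] := dense (eps / (A + 1)) (divr_gt0 eps0 A1).
have : `|D (u - v j)| <= eps / (A + 1) * A.
  by apply: linear_fun_small => // i; rewrite !mxE; exact: jP.
have : eps / (A + 1) * A <= eps.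
  by rewrite mulrAC ler_pdivrMr// ler_wpM2l ?(ltW eps0)//; lra.
have -> : D (u - v j) = D u - D (v j) by rewrite DD -scaleN1r DZ mulN1r.
have := DT j; move=> h1 h2 /ler_normlP[_ h3]; lra.
Qed.

Lemma sum_sqr_dense (n : nat) (D : 'I_n -> 'rV[R]_p -> R) (v : nat -> 'rV[R]_p) (u : 'rV[R]_p) (c : R) :
  (forall i u v, D i (u + v) = D i u + D i v) ->
  (forall i a v, D i (a *: v) = a * D i v) ->
  (forall eps, 0 < eps -> exists j, forall i, `|u 0 i - v j 0 i| <= eps) ->
  (forall j, c <= \sum_i D i (v j) ^+ 2) -> c <= \sum_i D i u ^+ 2.
Proof.
move=> DD DZ dense Dc.
(* [a ^ 2 + b ^ 2 >= 2 a b] turns the claim into a linear one in [v j]. *)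
pose E w := \sum_i (2 * D i u * D i w) - \sum_i D i u ^+ 2.
apply/ler_addgt0Pr => eps eps0.
pose B := \sum_i (2 * `|D i u| + 1) * \sum_k `|D i (delta_mx 0 k)|.
pose M := \sum_i \sum_k `|D i (delta_mx 0 k)|.
have M0 : 0 <= M by apply: sumr_ge0 => i _; exact: sumr_ge0.
have B0 : 0 <= B by apply: sumr_ge0 => i _; rewrite mulr_ge0 ?addr_ge0 ?mulr_ge0// sumr_ge0.
(* The second bound keeps every [|D i (v j - u)|] at most 1, hence its square at most itself, so
   that the perturbation is linear in [del]. *)
pose del := Num.min (eps / (B + 1)) (1 / (M + 1)).
have B1 : 0 < B + 1 by lra.
have M1 : 0 < M + 1 by lra.
have del0 : 0 < del by rewrite lt_min !divr_gt0.
have [j jP] := dense del del0.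
have wi i : `|D i (v j - u)| <= del * \sum_k `|D i (delta_mx 0 k)|.
  apply: linear_fun_small => // k; rewrite !mxE distrC; exact: jP.
have w1 i : `|D i (v j - u)| <= 1.
  apply: le_trans (wi i) _; apply: (@le_trans _ _ (1 / (M + 1) * M)).
    apply: ler_pM => //; [exact: ltW|exact: sumr_ge0|by rewrite ge_min lexx orbT|].
    by rewrite /M (bigD1 i)//= lerDl; apply: sumr_ge0 => k _; exact: sumr_ge0.
  by rewrite mulrAC ler_pdivrMr//; lra.
apply: le_trans (Dc j) _; rewrite -lerBlDl -sumrB.
apply: (@le_trans _ _ (del * B)).
  rewrite mulr_sumr; apply: ler_sum => i _.
  have -> : D i (v j) = D i u + D i (v j - u) by rewrite -DD addrC subrK.
  set w := D i (v j - u) in w1 wi *.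
  have w1i := w1 i; have wii := wi i.
  set m := \sum_k _ in wii *.
  have : (D i u + w) ^+ 2 - D i u ^+ 2 <= (2 * `|D i u| + 1) * `|w|.
    have : D i u * w <= `|D i u| * `|w| by rewrite -normrM ler_norm.
    have : w ^+ 2 <= `|w| * 1.
      by rewrite -(real_normK (num_real w)) expr2 ler_wpM2l.
    lra.
  have f0 : 0 <= 2 * `|D i u| + 1 by rewrite addr_ge0 ?mulr_ge0.
  by move=> h; apply: le_trans h _; rewrite [leRHS]mulrCA; exact: ler_wpM2l.
apply: (@le_trans _ _ (eps / (B + 1) * B)); first by rewrite ler_wpM2r// ge_min lexx.
by rewrite mulrAC ler_pdivrMr// ler_wpM2l ?(ltW eps0)//; lra.
Qed.

End DenseSequence.

(** * Continuity from below and the sub-exponential norm *)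

Section Probability.
Context {R : realType} {d : measure_display} {Omega : measurableType d}.
Variable P : probability Omega R.

Lemma probability_bigcup_le (A : nat -> set Omega) (c : R) :
  (forall m, measurable (A m)) -> (forall m, A m `<=` A m.+1) ->
  (forall m, (P (A m) <= c%:E)%E) -> (P (\bigcup_m A m) <= c%:E)%E.
Proof.
move=> mA ndA PA.
have ndA' : nondecreasing_seq A by apply/nondecreasing_seqP => m; apply/subsetPset; exact: ndA.
have mU : measurable (\bigcup_m A m) by exact: bigcupT_measurable.
have cv := nondecreasing_cvg_mu mA mU ndA' : P \o A @ \oo --> P (\bigcup_m A m).
rewrite -(cvg_lim _ cv)//; apply: lime_le; first by apply/cvg_ex; eexists; exact: cv.
by near=> m; exact: PA.
Unshelve. all: by end_near.
Qed.

Lemma expectation_int (Z : Omega -> R) : ('E_P[Z] = \int[P]_w (Z w)%:E)%E.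
Proof. by rewrite unlock. Qed.

(** Any level strictly above the infimum is admissible, by monotonicity in the level; attainment of
    the infimum is thereby avoided. *)
Lemma psi1_norm_lt (Z : Omega -> R) (s : R) : measurable_fun setT Z ->
  (psi1_norm P Z < s%:E)%E ->
  0 < s /\ (\int[P]_w (expR (`|Z w| / s))%:E <= 2%:E)%E.
Proof.
move=> mZ /ereal_inf_lt[_ [r [r0 Er] <-]]; rewrite lte_fin => rs.
have s0 := lt_trans r0 rs; split => //.
rewrite expectation_int in Er; apply: le_trans Er.
have m c : measurable_fun setT (fun w => (expR (`|Z w| / c))%:E).
  apply/measurable_EFinP; apply: measurableT_comp => //.
  by apply: measurable_funM => //; exact: measurableT_comp.
apply: ge0_le_integral => //; try by move=> w _; rewrite lee_fin expR_ge0.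
move=> w _; rewrite lee_fin ler_expR ler_wpM2l// lef_pV2 ?posrE//.
exact: ltW.
Qed.

Lemma psi1_norm_le (Z : Omega -> R) (s : R) : 0 < s ->
  (\int[P]_w (expR (`|Z w| / s))%:E <= 2%:E)%E -> (psi1_norm P Z <= s%:E)%E.
Proof.
by move=> s0 Zs; apply: ereal_inf_lbound; exists s => //; rewrite /= expectation_int.
Qed.

Lemma psi1_norm_ge0 (Z : Omega -> R) : (0 <= psi1_norm P Z)%E.
Proof. by apply/le_ereal_inf_tmp => _ [s [s0 _] <-]; rewrite lee_fin ltW. Qed.

Lemma psi1_norm_sub (Y Z : Omega -> R) : measurable_fun setT Y -> measurable_fun setT Z ->
  (psi1_norm P Y < +oo)%E -> (psi1_norm P Z < +oo)%E ->
  (psi1_norm P (fun w => Y w - Z w)%R < +oo)%E.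
Proof.
have pick (W : Omega -> R) : measurable_fun setT W -> (psi1_norm P W < +oo)%E ->
    exists2 s, 0 < s & (\int[P]_w (expR (`|W w| / s))%:E <= 2%:E)%E.
  move=> mW /ereal_inf_lt[_ [r [r0 Er] <-] _]; exists r => //.
  by rewrite -expectation_int.
move=> mY mZ /(pick _ mY)[r r0 Yr] /(pick _ mZ)[s s0 Zs].
pose t := 2 * (r + s).
have t0 : 0 < t by rewrite mulr_gt0// addr_gt0.
have m (W : Omega -> R) (c : R) : measurable_fun setT W -> measurable_fun setT (fun w => (expR (`|W w| / c))%:E).
  move=> mW; apply/measurable_EFinP; apply: measurableT_comp => //.
  by apply: measurable_funM => //; exact: measurableT_comp.
apply: le_lt_trans (ltry t); apply: (psi1_norm_le t0).
apply: (@le_trans _ _ (\int[P]_w (2^-1%:E * ((expR (`|Y w| / r))%:E + (expR (`|Z w| / s))%:E)))%E).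
  apply: ge0_le_integral => //.
  - by apply: m; exact: measurable_funB.
  - by apply: measurable_funeM; apply: emeasurable_funD; exact: m.
  move=> w _; rewrite -EFinD -EFinM lee_fin.
  pose A := expR (`|Y w| / r / 2); pose B := expR (`|Z w| / s / 2).
  have -> : expR (`|Y w| / r) = A ^+ 2 by rewrite /A -expRM_natr; congr expR; lra.
  have -> : expR (`|Z w| / s) = B ^+ 2 by rewrite /B -expRM_natr; congr expR; lra.
  apply: (@le_trans _ _ (A * B)); last by have := sqr_ge0 (A - B); lra.
  rewrite /A /B -expRD ler_expR ler_pdivrMr//.
  apply: le_trans (ler_normB _ _) _.
  have a0 : 0 <= `|Y w| / r by rewrite divr_ge0// ltW.
  have b0 : 0 <= `|Z w| / s by rewrite divr_ge0// ltW.
  have aE : `|Y w| = `|Y w| / r * r by rewrite divfK// gt_eqF.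
  have bE : `|Z w| = `|Z w| / s * s by rewrite divfK// gt_eqF.
  rewrite {1}aE {1}bE /t; move: a0 b0; set a := `|Y w| / r; set b := `|Z w| / s.
  nra.
rewrite ge0_integralZl_EFin//; last 2 first.
- by move=> w _; rewrite adde_ge0// lee_fin expR_ge0.
- by apply: emeasurable_funD; exact: m.
rewrite ge0_integralD//; try exact: m; try by move=> w _; rewrite lee_fin expR_ge0.
apply: le_trans (lee_wpmul2l _ (leeD Yr Zs)) _; first by rewrite lee_fin.
by rewrite -EFinD -EFinM lee_fin; lra.
Qed.

(** [|Z| <= (g + e) * (1 + m)] for the gauge [m]. At scale [100 * (g + e)] the exponential is at
    most [6 / 5 + exp (m / 2) / 20], whose mean is at most [6 / 5 + 12 / 20 < 2]. *)
Lemma psi1_norm_bernstein (Z : Omega -> R) (g e : R) : bernstein_tail P Z g e ->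
  (psi1_norm P Z < +oo)%E.
Proof.
move=> ZT; have [mZ g0 e0 _] := ZT.
have gauge := integral_expR_gauge ZT.
pose s := 100 * (g + e).
have ge0 : 0 < g + e by exact: addr_gt0.
have s0 : 0 < s by apply: mulr_gt0 => //; rewrite ltr0n.
apply: le_lt_trans (ltry s); apply: (psi1_norm_le s0).
pose m w := bernstein_gauge g e (Z w).
have mm : measurable_fun setT (fun w => (expR (m w / 2))%:E).
  apply/measurable_EFinP; apply: measurableT_comp => //; apply: measurable_funM => //.
  exact: measurableT_comp (measurable_bernstein_gauge g e) mZ.
apply: (@le_trans _ _ (\int[P]_w ((6 / 5)%:E + (1 / 20)%:E * (expR (m w / 2))%:E))%E).
  apply: ge0_le_integral => //.
  - apply/measurable_EFinP; apply: measurableT_comp => //.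
    by apply: measurable_funM => //; exact: measurableT_comp.
  - by apply: emeasurable_funD => //; exact: measurable_funeM.
  move=> w _; rewrite -EFinM -EFinD lee_fin.
  have m0 : 0 <= m w by exact: bernstein_gauge_ge0.
  have Zm : `|Z w| <= (g + e) * (1 + m w).
    have [mE|mE] : m w = Z w ^+ 2 / g ^+ 2 \/ m w = `|Z w| / e.
      by rewrite /m /bernstein_gauge; case: (leP (Z w ^+ 2 / g ^+ 2)) => _; [left|right].
    - set t := `|Z w| / g.
      have tE : `|Z w| = g * t by rewrite /t mulrC divfK// gt_eqF.
      have t0 : 0 <= t by rewrite divr_ge0// ltW.
      have mt : m w = t ^+ 2 by rewrite mE /t expr_div_n real_normK ?num_real.
      rewrite mt tE; have : t <= 1 + t ^+ 2 by have := sqr_ge0 (t - 1 / 2); lra.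
      have := sqr_ge0 t; nra.
    - have -> : `|Z w| = e * m w by rewrite mE mulrC divfK// gt_eqF.
      nra.
  have rat : `|Z w| / s <= 1 / 100 + m w / 100.
    rewrite ler_pdivrMr// /s; lra.
  have e1 : expR (`|Z w| / s) <= expR (1 / 100) * expR (m w / 100).
    by rewrite -expRD ler_expR.
  have e2 : expR (1 / 100) <= 11 / 10 :> R.
    have := expR_ge1Dx (- (1 / 100) : R); have := expRxMexpNx_1 (1 / 100 : R).
    have := expR_gt0 (1 / 100 : R); nra.
  have e3 : expR (m w / 100) <= 1 + m w / 100 * expR (m w / 100).
    have := expR_ge1Dx (- (m w / 100)); have := expRxMexpNx_1 (m w / 100).
    have := expR_gt0 (m w / 100); nra.
  have e4 : expR (m w / 100) <= expR (m w / 4) by rewrite ler_expR; lra.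
  have e5 : m w / 4 <= expR (m w / 4) by have := expR_ge1Dx (m w / 4); lra.
  have e6 : expR (m w / 4) * expR (m w / 4) = expR (m w / 2) by rewrite -expRD; congr expR; lra.
  have E0 := expR_gt0 (m w / 4); have E1 := expR_gt0 (m w / 100).
  have e7 : m w / 100 * expR (m w / 100) <= (1 / 25) * expR (m w / 2).
    rewrite -e6; have : m w / 4 * expR (m w / 100) <= expR (m w / 4) * expR (m w / 4).
      by apply: ler_pM => //; lra.
    lra.
  have y0 := expR_gt0 (m w / 2).
  apply: le_trans e1 _.
  apply: (@le_trans _ _ (11 / 10 * (1 + 1 / 25 * expR (m w / 2)))); last by lra.
  by apply: ler_pM => //; lra.
rewrite ge0_integralD//; last exact: measurable_funeM.
rewrite integral_cst//= probability_setT mule1 ge0_integralZl_EFin//.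
apply: le_trans (leeD2l _ (lee_wpmul2l _ gauge)) _; first by rewrite lee_fin divr_ge0.
by rewrite -EFinM -EFinD lee_fin; lra.
Qed.

(** When the norm is zero every scale is admissible. Markov's inequality at scale [eps * del / 2]
    bounds the probability of [|Z| >= eps] by [2 exp (- 2 / del) <= del]. *)
Lemma psi1_norm_eq0 (Z : Omega -> R) : measurable_fun setT Z ->
  psi1_norm P Z = 0%E -> P [set w | Z w != 0] = 0%E.
Proof.
move=> mZ Z0; apply/eqP; rewrite eq_le measure_ge0 andbT.
pose A m := [set w | m.+1%:R^-1 <= `|Z w|].
rewrite (_ : [set w | Z w != 0] = \bigcup_m A m); last first.
  apply/seteqP; split => w /=.
    rewrite -normr_gt0 => z0; exists (Num.truncn `|Z w|^-1) => //=.
    have iz : 0 <= `|Z w|^-1 by rewrite invr_ge0.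
    have /andP[_ h] := truncn_itv iz.
    by rewrite /A/= -[leRHS]invrK lef_pV2 ?posrE ?invr_gt0// ltW.
  by move=> [m _ h]; rewrite -normr_gt0; apply: lt_le_trans h; rewrite invr_gt0.
have mA m : measurable (A m) by apply: measurable_le_cst; exact: measurableT_comp.
apply: probability_bigcup_le => // m.
  by move=> w; apply: le_trans; rewrite lef_pV2 ?posrE// ler_nat.
apply/lee_addgt0Pr => del del0; rewrite add0e.
set eps : R := m.+1%:R^-1; have eps0 : 0 < eps by rewrite invr_gt0.
pose s := eps * del / 2.
have s0 : 0 < s by rewrite divr_gt0// mulr_gt0.
have [|_ Zs] := psi1_norm_lt (s := s) mZ; first by rewrite Z0 lte_fin.
have mE : measurable_fun setT (fun w => expR (`|Z w| / s)).
  apply: measurableT_comp => //.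
  by apply: measurable_funM => //; exact: measurableT_comp.
have := @markov_real _ _ _ P (fun w => expR (`|Z w| / s)) (expR (eps / s)) 2
  (expR_gt0 _) (fun w => expR_ge0 _) mE Zs.
rewrite (_ : [set w | _] = A m); last first.
  by apply/seteqP; split => w /=; rewrite ler_expR ler_pM2r ?invr_gt0.
move=> H; apply: le_trans H _; rewrite lee_fin ler_pdivrMr ?expR_gt0//.
have : 1 + eps / s <= expR (eps / s) by exact: expR_ge1Dx.
have -> : eps / s = 2 / del by rewrite /s; field; rewrite !gt_eqF.
move=> h; apply: (@le_trans _ _ (del * (1 + 2 / del))); last by rewrite ler_wpM2l// ltW.
by rewrite mulrDr mulrCA divff ?gt_eqF//; lra.
Qed.

End Probability.

(** * The deterministic argument and its two events *)

Section Deterministic.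
Context {R : realType} {p : nat}.
Implicit Types (K : set 'rV[R]_p) (b : 'rV[R]_p).

Lemma conic_sphere_subset K b : K b ->
  conic_hull (diff_set K [set b]) `&` sphere `<=`
  linear_hull (diff_set K K) `&` sphere.
Proof.
move=> Kb v [[m [a [s [Ks _ vE]]]] v1]; split => //.
exists m, a, s; split => // i.
by have [k Kk [_ -> <-]] := Ks i; exists k => //; exists b.
Qed.

(* Comparing the risks at [bhat] and [b] gives
   [|h| ^ 2 Q v <= 2 |h| M v] with [h := bhat - b = |h| v]. *)
Lemma minimizer_bound n (X : 'I_n -> 'rV[R]_p) (Y : 'I_n -> R) K b bhat (kappa W : R) :
  (0 < n)%N -> K b -> minimizer K (empirical_risk X Y) bhat ->
  (forall v, (conic_hull (diff_set K [set b]) `&` sphere) v ->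
     n%:R * kappa <= \sum_i dot (X i) v ^+ 2) ->
  (forall v, (conic_hull (diff_set K [set b]) `&` sphere) v ->
     \sum_i (Y i - dot (X i) b) * dot (X i) v <= n%:R * W) ->
  0 < norm2 (bhat - b) -> norm2 (bhat - b) * kappa <= 2 * W.
Proof.
move=> n0 Kb [Kbhat /(_ b Kb)]; rewrite /empirical_risk.
have nr0 : 0 < n%:R :> R by rewrite ltr0n.
rewrite ler_pM2l ?invr_gt0// => risk lower upper.
set h := bhat - b; set r := norm2 h => r0.
pose v := r^-1 *: h.
have hE : h = r *: v by rewrite /v scalerA mulfV ?scale1r ?gt_eqF.
have vL : (conic_hull (diff_set K [set b]) `&` sphere) v.
  split.
    exists 1%N, (fun=> r^-1), (fun=> h); split.
    - by move=> _; exists bhat => //; exists b.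
    - by move=> _; rewrite invr_ge0 ltW.
    - by rewrite big_ord1.
  have vv : dot v v = r^-1 ^+ 2 * dot h h by rewrite /v dotZr dotC dotZr; ring.
  change (Num.sqrt (dot v v) = 1); rewrite vv.
  rewrite sqrtrM ?sqr_ge0// sqrtr_sqr ger0_norm ?invr_ge0 ?(ltW r0)//.
  by rewrite -/(norm2 h) mulVf// gt_eqF.
have lo := lower v vL; have up := upper v vL.
have E : \sum_i (Y i - dot (X i) bhat) ^+ 2 = \sum_i (Y i - dot (X i) b) ^+ 2 -
    2 * r * \sum_i (Y i - dot (X i) b) * dot (X i) v + r ^+ 2 * \sum_i dot (X i) v ^+ 2.
  rewrite !mulr_sumr -sumrB -big_split/=; apply: eq_bigr => i _.
  have -> : dot (X i) bhat = dot (X i) b + r * dot (X i) v.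
    by rewrite -dotZr -hE -dotDr /h addrC subrK.
  ring.
rewrite E in risk.
set A := \sum_i dot (X i) v ^+ 2 in lo risk *.
set M := \sum_i _ * dot (X i) v in up risk *.
have rA : r * (r * A) <= r * (2 * M) by lra.
rewrite ler_pM2l// in rA.
rewrite -(ler_pM2l nr0).
have : r * (n%:R * kappa) <= r * A by rewrite ler_pM2l.
lra.
Qed.

End Deterministic.

Section Events.
Context {R : realType} {d : measure_display} {Omega : measurableType d}.
Variable P : probability Omega R.
Context {p n : nat} (x : {RV P >-> borel_rV R p}) (y : {RV P >-> R}).
Variables (X : 'I_n -> {RV P >-> borel_rV R p}) (Y : 'I_n -> {RV P >-> R}).
Variables (Ng Ne : 'rV[R]_p -> R) (b : 'rV[R]_p) (Lb : set 'rV[R]_p).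
Hypothesis n0 : (0 < n)%N.
Hypothesis sNg : seminorm Ng.
Hypothesis sNe : seminorm Ne.
Hypothesis HB : generic_bernstein P x Ng Ne.
Hypothesis lawXY : forall i, same_law P (fun w => (X i w, Y i w)) (fun w => (x w, y w)).
Hypothesis indXY : mutually_independent P (fun i w => (X i w, Y i w)).

Let L := conic_hull Lb `&` sphere.
Hypothesis L_nonempty : L !=set0.

Let sn : R := Num.sqrt n%:R.
Let nr0 : 0 < n%:R :> R. Proof. by rewrite ltr0n. Qed.
Let sn0 : 0 < sn. Proof. by rewrite sqrtr_gt0. Qed.
Let sn2 : sn ^+ 2 = n%:R. Proof. by rewrite sqr_sqrtr// ltW. Qed.

Let lawX i : same_law P (X i : Omega -> borel_rV R p) x.
Proof.
have pre (U : Omega -> borel_rV R p) (V : Omega -> R) B :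
    (fun w => (U w, V w)) @^-1` (B `*` setT) = U @^-1` B.
  by apply/seteqP; split => w /=; [case|split].
move=> B mB; have := @lawXY i (B `*` setT).
by rewrite !pre; apply; exact: measurableX.
Qed.

Let indX : mutually_independent P (fun i => X i : Omega -> borel_rV R p).
Proof.
have pre (U : Omega -> borel_rV R p) (V : Omega -> R) B :
    (fun w => (U w, V w)) @^-1` (B `*` setT) = U @^-1` B.
  by apply/seteqP; split => w /=; [case|split].
move=> B mB; have := @indXY (fun i => B i `*` setT).
under eq_bigcapr do rewrite pre.
under eq_bigr do rewrite pre.
by apply => i; exact: measurableX.
Qed.

Lemma q0_ge0 : (0 <= q0 n Ng Ne Lb)%E.
Proof.
have [Ng0 _ _] := sNg; have [Ne0 _ _] := sNe.
apply/le_ereal_inf_tmp => _ [S _ <-]; apply: adde_ge0.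
  rewrite inver (gt_eqF sn0); apply: mule_ge0; last by rewrite lee_fin invr_ge0 ltW.
  by apply: gamma_ge0 => u v; exact: Ne0.
by apply: gamma_ge0 => u v; rewrite addr_ge0.
Qed.

Lemma m0_ge0 : (0 <= m0 Ng Ne Lb)%E.
Proof.
have [Ng0 _ _] := sNg; have [Ne0 _ _] := sNe.
by apply/le_ereal_inf_tmp => _ [S _ <-]; apply: adde_ge0;
  apply: gamma_ge0 => u v.
Qed.

(** The sample-size condition amounts to [384 * 175 * (q0 + tau u) <= tau Q sqrt n]. Here [q0] pays
    for the chaining, and [tau u] plays two parts: it is the strict slack for choosing [S] and the
    partitions near their infima, and it gives [32 u <= Q sqrt n], which turns [n Q ^ 2 / 1024] into
    at least [u ^ 2]. *)
Lemma event_small_ball (tau Q u : R) : 0 < tau -> 0 < Q <= 1 -> 0 <= u ->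
    (forall v, L v -> (Q%:E <= P [set w | (2 * tau <= `|dot (x w) v|)%R])%E) ->
    (((384 * 175) ^+ 2)%:E * ((q0 n Ng Ne Lb + (tau * u)%:E)
                / (tau%:E * Q%:E)) ^+ 2 <= n%:R%:E)%E -> 0 < u ->
  exists bad : set Omega, [/\ measurable bad, (P bad <= (expR (- u ^+ 2))%:E)%E
    & forall w, ~ bad w -> forall v, L v ->
        n%:R * (tau ^+ 2 * Q / 8) <= \sum_i dot (X i w) v ^+ 2].
Proof.
move=> tau0 Q01 _ LQ cond u0; have [Q0 Q1] := andP Q01.
have tQ0 : 0 < tau * Q by exact: mulr_gt0.
have tu0 : 0 < tau * u by exact: mulr_gt0.
have [kk kkE big0] : exists2 kk : R, 384 * 175 = kk & 0 < kk.
  by exists (384 * 175); [reflexivity|apply: mulr_gt0; rewrite ltr0n].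
rewrite kkE in cond.
have q0ge := q0_ge0.
(* An infinite complexity would make the left side of the sample-size condition infinite. *)
have [q qE] : exists q, q0 n Ng Ne Lb = q%:E.
  move: q0ge cond; case: (q0 n Ng Ne Lb) => [q|_|//]; first by exists q.
  rewrite -EFinM inver gt_eqF// addye// gt0_mulye ?lte_fin ?invr_gt0//.
  by rewrite expe2 mulyy gt0_muley ?lte_fin ?exprn_gt0// leye_eq.
rewrite qE lee_fin in q0ge.
have qu : kk * (q + tau * u) <= tau * Q * sn.
  move: cond; rewrite qE -EFinM inver gt_eqF// -EFinD -EFinM -expr2 lee_fin.
  have qt0 : 0 <= q + tau * u by rewrite addr_ge0// ltW.
  rewrite -exprMn -sn2 ler_pXn2r ?nnegrE ?(ltW sn0)//; last first.
    by rewrite mulr_ge0 ?(ltW big0)// divr_ge0// ltW.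
  by rewrite mulrA ler_pdivrMr// [leRHS]mulrC.
have [S LS Slt] : exists2 S, L `<=` convex_hull S &
    (gammaN 1 S Ne / sn%:E + gammaN 2 S (fun v => Ng v + Ne v)%R < (q + tau * u)%:E)%E.
  have /ereal_inf_lt[_ [S LS <-] h] : (q0 n Ng Ne Lb < (q + tau * u)%:E)%E.
    by rewrite qE lte_fin ltrDl.
  by exists S.
have [Ng0 _ _] := sNg; have [Ne0 _ _] := sNe.
have g1 : (0 <= gammaN 1 S Ne)%E by apply: gamma_ge0 => a c.
have g2 : (0 <= gammaN 2 S (fun v => Ng v + Ne v)%R)%E.
  by apply: gamma_ge0 => a c; rewrite addr_ge0.
have [a [c [aE cE ac]]] : exists a c, [/\ gammaN 1 S Ne = a%:E,
    gammaN 2 S (fun v => Ng v + Ne v)%R = c%:E & a / sn + c < q + tau * u].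
  move: Slt g1 g2; rewrite inver (gt_eqF sn0).
  case: (gammaN 1 S Ne) => [a| |] //; case: (gammaN 2 S _) => [c| |] //.
  - by rewrite -EFinM -EFinD lte_fin => h _ _; exists a, c.
  - by rewrite gt0_mulye ?lte_fin ?invr_gt0.
  - by rewrite gt0_mulye ?lte_fin ?invr_gt0.
pose eps := (q + tau * u - (a / sn + c)) / (2 * (sn^-1 + 1)).
have den0 : 0 < sn^-1 + 1 by rewrite addr_gt0// invr_gt0.
have eps0 : 0 < eps by rewrite divr_gt0 ?subr_gt0// mulr_gt0.
have [|A admA HA] := @gamma_witness R _ 1 S (fun u v => Ne (u - v)) (a + eps).
  by have := aE; rewrite /gammaN => ->; rewrite lte_fin ltrDl.
have [|B admB HB'] := @gamma_witness R _ 2 S (fun u v => Ng (u - v) + Ne (u - v)) (c + eps).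
  by have := cE; rewrite /gammaN => ->; rewrite lte_fin ltrDl.
have small : 384 * (175 * (sn * (c + eps) + (a + eps))) < n%:R * Q * tau.
  have e1 : (a + eps) / sn + (c + eps) < q + tau * u.
    have : eps * (sn^-1 + 1) < q + tau * u - (a / sn + c).
      rewrite /eps invfM mulrA mulfVK ?gt_eqF// ltr_pdivrMr// ltr_pMr ?subr_gt0//.
      by rewrite ltr1n.
    rewrite mulrDl; lra.
  have e2 : sn * ((a + eps) / sn + (c + eps)) < sn * (q + tau * u) by rewrite ltr_pM2l.
  have e3 : sn * ((a + eps) / sn + (c + eps)) = sn * (c + eps) + (a + eps).
    by rewrite mulrDr mulrCA divff ?gt_eqF// mulr1 addrC.
  rewrite e3 in e2.
  have : sn * (kk * (q + tau * u)) <= sn * (tau * Q * sn) by rewrite ler_pM2l.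
  rewrite (_ : sn * (tau * Q * sn) = n%:R * Q * tau); last by rewrite -sn2; ring.
  by rewrite -kkE => h; move: e2; rewrite (mulrC sn (q + tau * u)); lra.
have [v vL vdense] := dense_sequence L_nonempty.
pose badv j := [set w | (\sum_i dot (X i w) (v j) ^+ 2 < n%:R * tau ^+ 2 * Q / 8)%R].
pose A_ m := [set w | exists2 q, q \in [seq v j | j <- iota 0 m] &
   (\sum_i dot (X i w) q ^+ 2 < n%:R * tau ^+ 2 * Q / 8)%R].
have mlt q' : measurable [set w | (\sum_i dot (X i w) q' ^+ 2 < n%:R * tau ^+ 2 * Q / 8)%R].
  apply: measurable_lt_fun => //; apply: measurable_sum => i.
  by apply: measurable_funX; exact: measurable_dot_rv.
have mA_ m : measurable (A_ m).
  by have [] := union_bound_seq (fun q' (_ : q' \in [seq v j | j <- iota 0 m]) => mlt q')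
    (fun q' _ => probability_le1 P (mlt q')).
exists (\bigcup_m A_ m); split.
- exact: bigcupT_measurable.
- apply: probability_bigcup_le => // m.
    move=> w [q' /mapP[j jm ->] h]; exists (v j) => //; apply/mapP; exists j => //.
    by move: jm; rewrite !mem_iota/= !add0n => /ltnW.
  have vs q' : q' \in [seq v j | j <- iota 0 m] -> L q' by move=> /mapP[j _ ->].
  apply: le_trans (small_ball_inf n0 sNg sNe HB lawX indX admA admB HA HB' tau0 Q01
    (fun q' h => LS _ (vs q' h)) (fun q' h => LQ _ (vs q' h)) small) _.
  rewrite lee_fin ler_expR lerN2 ler_pdivlMr ?ltr0n//.
  have h1 : 32 * u <= Q * sn.
    rewrite -(ler_pM2l tau0) [leRHS]mulrA; apply: le_trans qu; rewrite -kkE.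
    have tu1 : 0 <= tau * u by exact: ltW.
    by lra.
  rewrite (_ : u ^+ 2 * 1024 = (32 * u) ^+ 2); last by ring.
  rewrite (_ : n%:R * Q ^+ 2 = (Q * sn) ^+ 2); last by rewrite -sn2; ring.
  have u32 : 0 <= 32 * u by rewrite mulr_ge0// ltW.
  have Qsn : 0 <= Q * sn by rewrite mulr_ge0// ltW.
  exact: lerXn2r.
move=> w good; move=> v' Lv'.
apply: (@sum_sqr_dense R p n (fun i => dot (X i w)) v v' _ _ _ (vdense v' Lv')).
- by move=> i a' c'; exact: dotDr.
- by move=> i a' c'; exact: dotZr.
move=> j; rewrite leNgt; apply/negP => h; apply: good; exists j.+1 => //.
exists (v j); first by apply/mapP; exists j => //; rewrite mem_iota/= add0n ltnS.
by rewrite (_ : _ * _ / 8 = n%:R * (tau ^+ 2 * Q / 8))//; ring.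
Qed.

(** Enlarging [k] adds directions and lowers the level [T + 1 / (k + 1)], so the events [A_ k]
    increase and their union obeys the same bound. The vanishing slack is there because [m0] is an
    infimum, and the hull is chosen anew for each [k]. *)
Lemma event_multiplier (s v : R) (m : R) : 0 < s ->
    (\int[P]_w (expR (`|y w - dot (x w) b| / s))%:E <= 2%:E)%E ->
    m0 Ng Ne Lb = m%:E -> 7 <= v ->
  exists bad : set Omega, [/\ measurable bad,
    (P bad <= (expR (- sn) + 4 * expR (6 - v))%:E)%E
    & forall w, ~ bad w -> forall q, L q ->
        \sum_i (Y i w - dot (X i w) b) * dot (X i w) q <=
        n%:R * covar x y b q + 1344 * s * sn * v * m].
Proof.
move=> s0 ys mE v7.
have [pts ptsL dense] := dense_sequence L_nonempty.
have [Ng0 _ _] := sNg; have [Ne0 _ _] := sNe.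
have v0 : 0 < v by lra.
have c0 : 0 < s * sn * v by apply: mulr_gt0 => //; exact: mulr_gt0.
pose T := 1344 * s * sn * v * m.
pose en w := energy X Y b w.
pose A_ k := [set w | (en w <= 420 * n%:R * s ^+ 2)%R /\
  exists2 q, q \in [seq pts j | j <- iota 0 k] & (T + k.+1%:R^-1 < dev x y X Y b q w)%R].
have mlt c q : measurable [set w | (c < dev x y X Y b q w)%R].
  by apply: measurable_lt_fun => //; exact: measurable_dev.
have men : measurable [set w | (en w <= 420 * n%:R * s ^+ 2)%R].
  by apply: measurable_le_fun => //; exact: measurable_energy.
have mA_ k : measurable (A_ k).
  apply: measurableI => //.
  by have [] := union_bound_seq (fun q (_ : q \in [seq pts j | j <- iota 0 k]) => mlt (T + k.+1%:R^-1) q)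
    (fun q _ => probability_le1 P (mlt (T + k.+1%:R^-1) q)).
have PA_ k : (P (A_ k) <= (4 * expR (6 - v))%:E)%E.
  (* Half of the slack goes to the chaining, the other half to the choice of a nearly optimal
     [S]. *)
  pose e := k.+1%:R^-1 / 2 : R.
  have e0 : 0 < e by rewrite divr_gt0// invr_gt0.
  pose del := e / (2688 * (s * sn * v)).
  have d0 : 0 < 2688 * (s * sn * v) by apply: mulr_gt0 c0; rewrite ltr0n.
  have del0 : 0 < del by exact: divr_gt0.
  have [S LS Slt] : exists2 S, L `|` [set 0] `<=` convex_hull S &
      (gammaN 1 S Ne + gammaN 2 S Ng < (m + del)%:E)%E.
    have /ereal_inf_lt[_ [S LS <-] h] : (m0 Ng Ne Lb < (m + del)%:E)%E.
      by rewrite mE lte_fin ltrDl.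
    by exists S.
  have g1 : (0 <= gammaN 1 S Ne)%E by apply: gamma_ge0 => a c.
  have g2 : (0 <= gammaN 2 S Ng)%E by apply: gamma_ge0 => a c.
  have [a [c [aE cE ac c1]]] : exists a c, [/\ gammaN 1 S Ne = a%:E,
      gammaN 2 S Ng = c%:E, a + c < m + del & 0 <= c].
    move: Slt g1 g2; case: (gammaN 1 S Ne) => [a||//]; last by case: (gammaN 2 S _).
    case: (gammaN 2 S _) => [c||//] //.
    by rewrite -EFinD lte_fin lee_fin => h _ h2; exists a, c.
  pose eps := (m + del - (a + c)) / 2.
  have eps0 : 0 < eps by rewrite divr_gt0// subr_gt0.
  have [|A admA HA] := @gamma_witness R _ 1 S (fun u v => Ne (u - v)) (a + eps).
    by have := aE; rewrite /gammaN => ->; rewrite lte_fin ltrDl.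
  have [|B admB HB'] := @gamma_witness R _ 2 S (fun u v => Ng (u - v)) (c + eps).
    by have := cE; rewrite /gammaN => ->; rewrite lte_fin ltrDl.
  have S0 : convex_hull S 0 by apply: LS; right.
  have Svs q : q \in [seq pts j | j <- iota 0 k] -> convex_hull S q.
    by move=> /mapP[j _ ->]; apply: LS; left.
  have msup := multiplier_sup n0 sNg sNe HB lawXY indXY s0 ys admA admB HA HB' v7 e0 S0 Svs.
  apply: le_trans msup; apply: le_measure; rewrite ?inE//.
    apply: measurableI => //.
    set cc := (672 * _ * _ * _ * _ + e).
    by have [] := union_bound_seq (fun q (_ : q \in [seq pts j | j <- iota 0 k]) => mlt cc q)
      (fun q _ => probability_le1 P (mlt cc q)).
  move=> w [enw [q qvs h]]; split => //; exists q => //; apply: le_lt_trans h.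
  have Gm : 2 * (a + eps) + (c + eps) <= 2 * (m + del) by rewrite /eps; lra.
  have h2 : s * sn * v * (2 * (a + eps) + (c + eps)) <= s * sn * v * (2 * (m + del)).
    by rewrite ler_pM2l.
  have h3 : 2688 * (s * sn * v) * del = e.
    by rewrite mulrC (divfK (lt0r_neq0 d0)).
  rewrite /T (_ : k.+1%:R^-1 = e + e); last exact: splitr.
  rewrite (_ : 672 * s * _ * v * _ = 672 * (s * sn * v * (2 * (a + eps) + (c + eps)))); last first.
    by rewrite /sn; ring.
  rewrite (_ : 1344 * s * sn * v * m = 1344 * (s * sn * v * m)); last by ring.
  have h4 : 2688 * (s * sn * v * del) = e by rewrite -h3; ring.
  move: h2 h4; rewrite (_ : s * sn * v * (2 * (m + del)) =
    2 * (s * sn * v * m) + 2 * (s * sn * v * del)); last by ring.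
  set z1 := s * sn * v * m; set z2 := s * sn * v * del; set z3 := s * sn * v * _.
  by lra.
exists ((\bigcup_k A_ k) `|` [set w | (420 * n%:R * s ^+ 2 < en w)%R]); split.
- apply: measurableU; first exact: bigcupT_measurable.
  by apply: measurable_lt_fun => //; exact: measurable_energy.
- apply: le_trans (measureU2 P _ _) _.
  + exact: bigcupT_measurable.
  + by apply: measurable_lt_fun => //; exact: measurable_energy.
  rewrite [X in (_ <= X%:E)%E]addrC EFinD; apply: leeD.
    apply: probability_bigcup_le => // k w [enw [q /mapP[j jk ->] h]]; split => //.
    exists (pts j); first by apply/mapP; exists j => //; move: jk; rewrite !mem_iota/= !add0n => /ltnW.
    by apply: le_lt_trans h; rewrite lerD2l lef_pV2 ?posrE// ler_nat.
  exact: (energy_tail n0 lawXY indXY s0 ys).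
move=> w /not_orP[notA noten] q Lq.
have enw : en w <= 420 * n%:R * s ^+ 2 by rewrite leNgt; apply/negP.
have devT j : dev x y X Y b (pts j) w <= T.
  apply/ler_addgt0Pr => eps eps0.
  pose k := maxn j.+1 (Num.truncn eps^-1).
  have ie : 0 <= eps^-1 by rewrite invr_ge0 ltW.
  have /andP[_ kP] := truncn_itv ie.
  have keps : k.+1%:R^-1 <= eps.
    rewrite -[leRHS]invrK lef_pV2 ?posrE ?invr_gt0//; apply: le_trans (ltW kP) _.
    by rewrite ler_nat ltnS leq_maxr.
  rewrite leNgt; apply/negP => h; apply: notA; exists k => //; split => //.
  exists (pts j); first by apply/mapP; exists j => //; rewrite mem_iota/= add0n leq_maxl.
  by apply: le_lt_trans h; rewrite lerD2l.
have : dev x y X Y b q w <= T.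
  apply: (@linear_fun_le_dense R p (fun v => dev x y X Y b v w) pts q T _ _ (dense q Lq) devT).
  - by move=> a c; exact: (devD X Y sNg sNe HB s0 ys).
  - by move=> a c; exact: (devZ X Y sNg sNe HB s0 ys).
by rewrite /dev lerBlDl.
Qed.

End Events.

Section MismatchCovariance.
Context {R : realType} {d : measure_display} {Omega : measurableType d}.
Variable P : probability Omega R.
Context {p : nat} (x : {RV P >-> borel_rV R p}) (y : {RV P >-> R}).
Variables (Ng Ne : 'rV[R]_p -> R) (b : 'rV[R]_p) (s : R).
Hypothesis sNg : seminorm Ng.
Hypothesis sNe : seminorm Ne.
Hypothesis HB : generic_bernstein P x Ng Ne.
Hypothesis s0 : 0 < s.
Hypothesis ys : (\int[P]_w (expR (`|y w - dot (x w) b| / s))%:E <= 2%:E)%E.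

Lemma covar_le_mismatch (K : set 'rV[R]_p) v :
  (conic_hull (diff_set K [set b]) `&` sphere) v ->
  ((covar x y b v)%:E <= mismatch_covariance P x y K b)%E.
Proof.
move=> Lv; apply: ereal_sup_ubound; exists v => //; congr EFin.
rewrite {2}(row_sum_delta v).
rewrite (linear_fun_sum (covarD sNg sNe HB s0 ys) (covarZ sNg sNe HB s0 ys)).
apply: eq_bigr => j _; rewrite (covarZ sNg sNe HB s0 ys) mxE mulrC; congr (_ * fine _).
rewrite expectation_int; apply: eq_integral => w _; congr ((_ * _)%:E).
rewrite /dot (bigD1 j)//= big1 ?addr0 => [|i ij]; first by rewrite mxE !eqxx mulr1.
by rewrite mxE (negbTE ij) mulr0.
Qed.

End MismatchCovariance.

Section NoNoise.
Context {R : realType} {d : measure_display} {Omega : measurableType d}.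
Variable P : probability Omega R.
Context {p n : nat} (x : {RV P >-> borel_rV R p}) (y : {RV P >-> R}).
Variables (X : 'I_n -> {RV P >-> borel_rV R p}) (Y : 'I_n -> {RV P >-> R}).
Variable b : 'rV[R]_p.
Hypothesis lawXY : forall i, same_law P (fun w => (X i w, Y i w)) (fun w => (x w, y w)).

(** The multiplier bounds divide by the scale [s], which must be positive. At noise level zero the
    residuals vanish almost surely instead, and the whole process with them. *)
Lemma event_no_noise : psi1_norm P (fun w => y w - dot (x w) b) = 0%E ->
  exists bad : set Omega, [/\ measurable bad, P bad = 0%E
    & forall w, ~ bad w -> forall i, Y i w - dot (X i w) b = 0].
Proof.
move=> psi0.
have mres (U : {RV P >-> borel_rV R p}) (V : {RV P >-> R}) :
    measurable_fun setT (fun w => V w - dot (U w) b).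
  apply: measurable_funB; first exact: measurable_funPT.
  exact: measurable_dot_rv.
have mne (f : Omega -> R) : measurable_fun setT f -> measurable [set w | f w != 0].
  move=> mf; rewrite (_ : [set w | f w != 0] = [set w | 0 < `|f w|]).
    by apply: measurable_lt_fun => //; exact: measurableT_comp.
  by apply/seteqP; split => w /=; rewrite normr_gt0.
have Z := psi1_norm_eq0 (mres x y) psi0.
have mB : measurable [set t : borel_rV R p * R | t.2 - dot t.1 b != 0].
  rewrite (_ : [set t | _] = resid b @^-1` [set~ 0]).
    rewrite -[X in measurable X]setTI; apply: (measurable_resid b) => //.
    exact: measurableC.
  by apply/seteqP; split => t /= /eqP.
have Zi i : P [set w | Y i w - dot (X i w) b != 0] = 0%E.
  by rewrite -Z; exact: (@lawXY i _ mB).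
have mZi i : measurable [set w | Y i w - dot (X i w) b != 0] by exact: mne.
have [mU PU] := union_bound_seq (c := 0) (fun i (_ : i \in enum 'I_n) => mZi i)
  (fun i _ => eq_ind_r (fun e => (e <= 0%:E)%E) (lexx _) (Zi i)).
exists [set w | exists2 i, i \in enum 'I_n & Y i w - dot (X i w) b != 0]; split => //.
  by apply/eqP; rewrite eq_le measure_ge0 andbT; move: PU; rewrite mulr0.
move=> w good i; apply/eqP; rewrite -[_ == _]negbK; apply/negP => h.
by apply: good; exists i => //; rewrite mem_enum.
Qed.

End NoNoise.

(** * Thresholds in real form and assembly of the theorem *)

Lemma small_ball_level (R : realType) (d : measure_display) (Omega : measurableType d)
    (P : probability Omega R) (p : nat) (x : {RV P >-> borel_rV R p}) (tau : R)
    (L : set 'rV[R]_p) : L !=set0 -> (0 < small_ball P (2 * tau) L x)%E ->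
  exists Q : R, [/\ 0 < Q <= 1, small_ball P (2 * tau) L x = Q%:E
    & forall v, L v -> (Q%:E <= P [set w | (2 * tau <= `|dot (x w) v|)%R])%E].
Proof.
move=> [v0 Lv0] SB0.
have le v : L v -> (small_ball P (2 * tau) L x <=
    P [set w | (2 * tau <= `|dot (x w) v|)%R])%E.
  by move=> Lv; apply: ereal_inf_lbound; exists v.
have mv v : measurable [set w | (2 * tau <= `|dot (x w) v|)%R].
  by apply: measurable_le_cst; apply: measurableT_comp => //; exact: measurable_dot_rv.
have SB1 := le_trans (le v0 Lv0) (probability_le1 P (mv v0)).
move: SB0 SB1 le; case: (small_ball P (2 * tau) L x) => [Q| |] //.
by rewrite lte_fin lee_fin => Q0 Q1 le; exists Q; rewrite Q0 Q1.
Qed.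

(* The bound on the excess comes with a free constant; it is absorbed into [u]
   rather than into the threshold, because [rho] may be negative. *)
Lemma multiplier_threshold (R : realType) (rho : \bar R) (r0 W sigma u sn : R)
    (mm : \bar R) : (r0%:E <= rho)%E -> 0 < sn -> 0 < u -> 0 < sigma -> (0 <= mm)%E ->
    (rho + (u ^+ 2)%:E * sigma%:E * (mm / sn%:E) <= W%:E)%E ->
  exists2 m : R, mm = m%:E & forall c, (c%:E <= rho)%E ->
    c + u ^+ 2 * sigma * (m / sn) <= W.
Proof.
move=> rr sn0 u0 sig0; have us : 0 < u ^+ 2 * sigma by rewrite mulr_gt0// exprn_gt0.
rewrite inver (gt_eqF sn0) -EFinM.
case: mm => [m'| |] // _.
  rewrite -!EFinM => h; exists m' => // c cr.
  by rewrite -lee_fin EFinD; apply: le_trans h; rewrite leeD2r.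
rewrite gt0_mulye ?lte_fin ?invr_gt0// gt0_muley ?lte_fin//.
by rewrite addey ?leye_eq//; case: rho rr.
Qed.

Lemma threshold_real (R : realType) (tau Q t : R) (a : \bar R) : 0 < tau -> 0 < Q ->
    (16%:E * (1 / (tau%:E * Q%:E) ^+ 2) * Order.max a 0 <= t%:E)%E ->
  (a <= (t * (tau * Q) ^+ 2 / 16)%:E)%E.
Proof.
move=> tau0 Q0; have tQ : 0 < (tau * Q) ^+ 2 by rewrite exprn_gt0// mulr_gt0.
rewrite -EFinM -EFin_expe inver (gt_eqF tQ) mul1e -EFinM.
have c0 : 0 < 16 / (tau * Q) ^+ 2 by apply: divr_gt0 => //; rewrite ltr0n.
have lem : (a <= Order.max a 0)%E by rewrite le_max lexx.
move=> h; apply: (le_trans lem).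
rewrite (_ : t * _ / 16 = (16 / (tau * Q) ^+ 2)^-1 * t); last first.
  by rewrite invf_div [RHS]mulrC [RHS]mulrA.
by rewrite EFinM lee_pdivlMl.
Qed.

Theorem corollary2p12 (R : realType) :
  exists C C1 C2 : R, [/\ 0 < C, 0 < C1, 0 < C2 &
  forall (p n : nat) (Ng Ne : 'rV[R]_p -> R)
    (d : measure_display) (Omega : measurableType d) (P : probability Omega R)
    (x : {RV P >-> borel_rV R p}) (y : {RV P >-> R})
    (X : 'I_n -> {RV P >-> borel_rV R p}) (Y : 'I_n -> {RV P >-> R})
    (K : set 'rV[R]_p) (tau : R) (b : 'rV[R]_p) (u t : R),
  let KD := linear_hull (diff_set K K) `&` sphere in
  let Kb := diff_set K [set b] in
  (0 < p)%N -> (0 < n)%N ->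
  seminorm Ng -> seminorm Ne ->
  generic_bernstein P x Ng Ne ->
  sub_exponential P y ->
  convex_set K ->
  0 < tau -> (0 < small_ball P (2 * tau) KD x)%E ->
  (forall i, same_law P (fun w => (X i w, Y i w)) (fun w => (x w, y w))) ->
  mutually_independent P (fun i w => (X i w, Y i w)) ->
  K b -> 8 <= u -> 0 <= t ->
  exists E : set Omega, [/\ measurable E,
    ((1 - 5 * expR (- (C * u ^+ 2)) - 2 * expR (- (C * Num.sqrt n%:R)))%:E
       <= P E)%E
    & forall w, E w ->
      (C1%:E * ((q0 n Ng Ne Kb + (tau * u)%:E)
                / (tau%:E * small_ball P (2 * tau) KD x)) ^+ 2
         <= n%:R%:E)%E ->
      (C2%:E * (1 / (tau%:E * small_ball P (2 * tau) KD x) ^+ 2)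
           * Order.max
               (mismatch_covariance P x y K b
                + (u ^+ 2)%:E * mismatch_deviation P x y b
                  * (m0 Ng Ne Kb / (Num.sqrt n%:R)%:E)) 0
         <= t%:E)%E ->
      forall bhat : 'rV[R]_p,
        minimizer K (empirical_risk (fun i => X i w) (fun i => Y i w)) bhat ->
        norm2 (bhat - b) <= t]].
Proof.
(* The multiplier bound [1344 s v] at [s = 2 sigma] equals [u ^ 2 sigma] when [u ^ 2 = 2688 v], so
   the chaining parameter is [v = u ^ 2 / 2688]. Then [C u ^ 2 = v / 24], which is at most [v - 6]
   when [12 <= v]. *)
have [c0 c0E c0gt] : exists2 c : R, c = 24 * 2688 & 1 <= c.
  by exists (24 * 2688); [reflexivity|lra].
have c0pos : 0 < c0 by lra.
exists c0^-1, ((384 * 175) ^+ 2), 16; split.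
- by rewrite invr_gt0.
- by apply: exprn_gt0; apply: mulr_gt0; rewrite ltr0n.
- by rewrite ltr0n.
move=> p n Ng Ne d Omega P x y X Y K tau b u t KD Kb p0 n0 sNg sNe HB suby _ tau0 SB0
  law ind Kbb u8 t0.
set prob := _ - 2 * expR _.
have prob1 : prob <= 1.
  rewrite /prob; have := expR_ge0 (- (c0^-1 * u ^+ 2)).
  by have := expR_ge0 (- (c0^-1 * Num.sqrt n%:R) : R); lra.
have trivialE (F : Omega -> Prop) : (forall w, F w) ->
    exists E : set Omega, [/\ measurable E, (prob%:E <= P E)%E & forall w, E w -> F w].
  by move=> H; exists setT; split => //; rewrite probability_setT lee_fin.
have u0 : 0 < u by lra.
pose L := conic_hull Kb `&` sphere.
(* If [L] is empty, a minimizer other than [b] cannot exist, since its normalized difference from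
   [b] would lie in [L]; the uniform bounds hold vacuously with incompatible constants. *)
have [L0|L0] := pselect (L !=set0); last first.
  apply: trivialE => w _ _ bhat mini; rewrite leNgt; apply/negP => tn.
  have r0 := le_lt_trans t0 tn.
  have noL v : ~ L v by move=> Lv; apply: L0; exists v.
  have := minimizer_bound (kappa := 1) (W := 0) n0 Kbb mini
    (fun v Lv => False_ind _ (noL v Lv)) (fun v Lv => False_ind _ (noL v Lv)) r0.
  by rewrite mulr1 mulr0 leNgt r0.
have LKD : L `<=` KD := conic_sphere_subset Kbb.
have KD0 : KD !=set0 by case: L0 => v /LKD; exists v.
have [Q [Q01 SBE KDQ]] := small_ball_level KD0 SB0; rewrite SBE.
have [Q0 Q1] := andP Q01.
have LQ v : L v -> (Q%:E <= P [set w | (2 * tau <= `|dot (x w) v|)%R])%E.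
  by move=> /LKD; exact: KDQ.
(* Here [C u ^ 2 <= 1 / 2], hence [5 exp (- C u ^ 2) >= 5 / 2] and the asserted probability is
   negative. *)
have [u_small|u_big] := ltP (u ^+ 2) (12 * 2688).
  exists set0; split => //; rewrite measure0 lee_fin /prob.
  have : c0^-1 * u ^+ 2 <= 1 / 2.
    by rewrite mulrC ler_pdivrMr// c0E; lra.
  have := expR_ge1Dx (- (c0^-1 * u ^+ 2)).
  by have := expR_ge0 (- (c0^-1 * Num.sqrt n%:R) : R); lra.
(* Neither condition depends on the sample, so each is decided beforehand; if one fails, the whole
   space is a suitable event. *)
have [condq|ncondq] := pselect (((384 * 175) ^+ 2)%:E *
    ((q0 n Ng Ne Kb + (tau * u)%:E) / (tau%:E * Q%:E)) ^+ 2 <= n%:R%:E)%E; last first.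
  by apply: trivialE => w /ncondq.
set a := (mismatch_covariance P x y K b + _)%E.
have [condt|ncondt] := pselect (16%:E * (1 / (tau%:E * Q%:E) ^+ 2) * Order.max a 0 <= t%:E)%E;
  last by apply: trivialE => w _ /ncondt.
pose W := t * (tau * Q) ^+ 2 / 16.
have W0 : 0 <= W by rewrite divr_ge0// mulr_ge0 ?sqr_ge0.
have aW : (a <= W%:E)%E by exact: threshold_real condt.
have [badA [mA PA goodA]] := event_small_ball n0 sNg sNe HB law ind L0 tau0 Q01 (ltW u0) LQ condq u0.
clear condq condt.
pose sn : R := Num.sqrt n%:R.
have nr0 : 0 < n%:R :> R by rewrite ltr0n.
have sn0 : 0 < sn by rewrite sqrtr_gt0.
have sn2 : sn ^+ 2 = n%:R by rewrite sqr_sqrtr// ltW.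
have [v vE v12] : exists2 v : R, u ^+ 2 = 2688 * v & 12 <= v.
  by exists (u ^+ 2 / 2688); [rewrite mulrC divfK ?pnatr_eq0|rewrite ler_pdivlMr ?ltr0n].
have c0v : c0^-1 * u ^+ 2 = v / 24 by rewrite vE c0E; field.
clear c0E u_big.
pose pB := expR (- sn) + 4 * expR (6 - v).
have [badB [mB PB goodB]] : exists badB : set Omega, [/\ measurable badB, (P badB <= pB%:E)%E
    & forall w, ~ badB w -> forall q, L q ->
        \sum_i (Y i w - dot (X i w) b) * dot (X i w) q <= n%:R * W].
  have sigma_fin : (mismatch_deviation P x y b < +oo)%E.
    apply: psi1_norm_sub => //.
    - exact: measurable_dot_rv.
    - exact: psi1_norm_bernstein (generic_bernstein_tail b sNg sNe HB ltr01).
  have [sigma sigE] : exists sigma, mismatch_deviation P x y b = sigma%:E.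
    have := psi1_norm_ge0 P (fun w => y w - dot (x w) b).
    by move: sigma_fin; rewrite /mismatch_deviation; case: psi1_norm => [s| |] // _ _; exists s.
  have sig_ge0 : 0 <= sigma by rewrite -lee_fin -sigE; exact: psi1_norm_ge0.
  move: sig_ge0; rewrite le_eqVlt => /orP[/eqP sig0|sig0].
    have [|bad [mbad Pbad good]] := event_no_noise (b := b) law; first exact: (etrans sigE (congr1 EFin (esym sig0))).
    exists bad; split => //; first by rewrite Pbad lee_fin addr_ge0 ?mulr_ge0 ?expR_ge0.
    move=> w wgood q _; rewrite big1; first by rewrite mulr_ge0.
    by move=> i _; rewrite good// mul0r.
  have mres : measurable_fun setT (fun w => y w - dot (x w) b).
    by apply: measurable_funB => //; exact: measurable_dot_rv.
  (* Twice the norm is a scale strictly above the infimum, at the price of the factor 2 in 2688. *)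
  have [|s0 ys] := @psi1_norm_lt _ _ _ P _ (2 * sigma) mres.
    by rewrite -[psi1_norm _ _]/(mismatch_deviation P x y b) sigE lte_fin ltr_pMl// ltr1n.
  have covL q : L q -> ((covar x y b q)%:E <= mismatch_covariance P x y K b)%E.
    exact: (covar_le_mismatch sNg sNe HB s0 ys).
  have [q' Lq'] := L0.
  have [m mE mW] : exists2 m : R, m0 Ng Ne Kb = m%:E &
      forall c, (c%:E <= mismatch_covariance P x y K b)%E -> c + u ^+ 2 * sigma * (m / sn) <= W.
    apply: (multiplier_threshold (covL q' Lq') sn0 u0 sig0 (m0_ge0 _ sNg sNe)).
    by rewrite -sigE.
  have v7 : 7 <= v by apply: le_trans v12; rewrite ler_nat.
  have [bad [mbad Pbad good]] := event_multiplier n0 sNg sNe HB law ind L0 s0 ys mE v7.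
  exists bad; split => // w wgood q Lq.
  apply: le_trans (good w wgood q Lq) _.
  have := mW _ (covL q Lq); rewrite -(ler_pM2l nr0); apply: le_trans.
  rewrite mulrDr lerD2l -/sn.
  have snE : sn = n%:R / sn by rewrite -sn2 expr2 mulfK// gt_eqF.
  rewrite [leRHS](_ : _ = u ^+ 2 * sigma * m * (n%:R / sn)); last by ring.
  by rewrite -snE vE; clear; lra.
exists (~` (badA `|` badB)); split.
- exact/measurableC/measurableU.
- clear vE; rewrite probability_setC; last exact: measurableU.
  have PU : (P (badA `|` badB) <= (expR (- u ^+ 2) + pB)%:E)%E.
    by apply: le_trans (measureU2 P mA mB) _; rewrite EFinD leeD.
  have fU : P (badA `|` badB) \is a fin_num by rewrite fin_num_measure//; exact: measurableU.
  move: PU; rewrite -(fineK fU) -EFinB !lee_fin => PU.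
  have u2 : 0 <= u ^+ 2 by exact: sqr_ge0.
  have e1 : expR (- u ^+ 2) <= expR (- (c0^-1 * u ^+ 2)).
    by rewrite ler_expR lerN2 ler_piMl// invf_le1.
  have e2 : expR (- sn) <= expR (- (c0^-1 * sn)).
    by rewrite ler_expR lerN2 ler_piMl ?(ltW sn0)// invf_le1.
  have e3 : expR (6 - v) <= expR (- (c0^-1 * u ^+ 2)).
    by rewrite ler_expR c0v; clear -v12; lra.
  move: e2; rewrite /prob -/sn /pB in PU *.
  by have := expR_ge0 (- (c0^-1 * sn)); lra.
move=> w /not_orP[nA nB] _ _ bhat mini; rewrite leNgt; apply/negP => tn.
have r0 := le_lt_trans t0 tn.
have := minimizer_bound n0 Kbb mini (goodA w nA) (goodB w nB) r0.
apply/negP; rewrite -ltNge.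
have k0 : 0 < tau ^+ 2 * Q / 8 by rewrite divr_gt0// mulr_gt0// exprn_gt0.
apply: (@le_lt_trans _ _ (t * (tau ^+ 2 * Q / 8))); last by rewrite ltr_pM2r.
(* The constant 16 makes [2 W] equal to [t * kappa * Q] with [kappa = tau ^ 2 * Q / 8], and [Q <= 1]
   finishes. *)
rewrite (_ : 2 * W = t * (tau ^+ 2 * Q / 8) * Q); last by rewrite /W; field.
by rewrite ler_piMr// mulr_ge0// ltW.
Qed.
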